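(* Let $(\{\Omega_i\}_{i\in\mathcal{A}},\{\eta_i\}_{i\in\mathcal{A}},\{t_i\}_{i\in\mathcal{A}})$ be a RIFS in $\mathbb{R}^d$ and assume one of the following: A. $\Omega_i\subset S_d$ for all $i\in\mathcal{A}$ and the RIFS is distantly non-singular; B. $\Omega_i\subset M_d$ for all $i\in\mathcal{A}$ and the RIFS is non-singular. Suppose $\mathfrak{m}$ is a slowly decaying $\sigma$-invariant ergodic probability measure on $\mathcal{A}^{\mathbb{N}}$ such that $\frac{h(\mathfrak{m})}{\lambda(\eta,\mathfrak{m})}>1$. Then the following statements hold: 1. For any $\mathbf{b}\in\mathcal{A}^{\mathbb{N}}$, for $\eta$-almost every $\omega\in\Omega$, for any $g\in G$ the set $U_\omega(\mathbf{b},\mathfrak{m},g)$ has positive Lebesgue measure. 2. For any $\mathbf{b}\in\mathcal{A}^{\mathbb{N}}$, for $\eta$-almost every $\omega\in\Omega$, for any $\Psi:\mathcal{A}^*\to[0,\infty)$ the set $W_\omega(\mathbf{b},\Psi)$ has positive Lebesgue measure if there exists $g\in G$ such that $\Psi$ is equivalent to $(\mathfrak{m},g)$.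
   Context: **Random iterated function systems (RIFS).** $\mathcal{A}$ is a finite set, $\mathcal{A}^*=\bigcup_{n\ge1}\mathcal{A}^n$ is the set of finite words, $|\mathbf{a}|$ is the length and $l(\mathbf{a})$ the last letter of $\mathbf{a}\in\mathcal{A}^*$. $M_d$ is the set of invertible real $d\times d$ matrices with operator norm $\|A\|<1$, and $S_d\subset M_d$ is the subset of scalar multiples of orthogonal matrices. A RIFS is a tuple $(\{\Omega_i\},\{\eta_i\},\{t_i\})_{i\in\mathcal{A}}$ where each $\Omega_i\subset M_d$ has operator norms uniformly bounded away from $1$, $\eta_i$ is a Borel probability measure supported on $\Omega_i$, and the $t_i\in\mathbb{R}^d$ are pairwise distinct. Put $\Omega=\prod_{\mathbf{a}\in\mathcal{A}^*}\Omega_{l(\mathbf{a})}$ with the product measure $\eta=\prod_{\mathbf{a}\in\mathcal{A}^*}\eta_{l(\mathbf{a})}$. For $\omega\in\Omega$ let $A_{\omega,\mathbf{a}}$ be its coordinate at $\mathbf{a}$ and $f_{\omega,\mathbf{a}}(x)=A_{\omega,\mathbf{a}}x+t_{l(\mathbf{a})}$. Let $\phi_{\omega,a_1\ldots a_n}=f_{\omega,a_1}\circ f_{\omega,a_1a_2}\circ\cdots\circ f_{\omega,a_1\ldots a_n}$ and $\Pi_\omega:\mathcal{A}^{\mathbb{N}}\to\mathbb{R}^d$, $\Pi_\omega(\mathbf{a})=\lim_{k\to\infty}\phi_{\omega,a_1\ldots a_k}(\mathbf{0})$. **Non-singularity.** Balls $B(y,r)$ are Euclidean. The RIFS is *non-singular*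 if there is $C>0$ such that for all $i\in\mathcal{A}$, $x\in\bigcup_{\omega\in\Omega}\Pi_\omega(\mathcal{A}^{\mathbb{N}})$ and all balls $B(y,r)$, $\eta_i(A\in\Omega_i: Ax\in B(y,r))\le C r^d$. It is *distantly non-singular* if there is $C>0$ such that for all $i\in\mathcal{A}$, $x\in\bigcup_{\omega\in\Omega}\Pi_\omega(\mathcal{A}^{\mathbb{N}})$, $y\in\mathbb{R}^d\setminus B\big(0,\tfrac18\min_{i\ne j}|t_i-t_j|\big)$ and $r>0$, $\eta_i(A\in\Omega_i: Ax\in B(y,r))\le C r^d$. **Lyapunov exponent and standing assumption.** $\lambda'(\eta_i)=-\int_{\Omega_i}\log|\mathrm{Det}(A)|\,d\eta_i(A)$ and $\lambda(\eta,\mathfrak{m})=\sum_{i\in\mathcal{A}}\mathfrak{m}([i])\lambda'(\eta_i)$. Throughout it is assumed that $\lambda'(\eta_i)\in\mathbb{R}$ and $\log\int_{\Omega_i}|\mathrm{Det}(A)|^s\,d\eta_i(A)<\infty$ for all $i\in\mathcal{A}$ and all $s\in\mathbb{R}$ with $|s|$ sufficiently small. **Measures on $\mathcal{A}^{\mathbb{N}}$.** $[\mathbf{a}]$ is the cylinder of sequences beginning with $\mathbf{a}$, and $\sigma$ is the left shift. The entropy of a $\sigma$-invariant $\mathfrak{m}$ is $h(\mathfrak{m})=\lim_{k\to\infty}-\frac1k\sum_{\mathbf{a}\in\mathcal{A}^k}\mathfrak{m}([\mathbf{a}])\log\mathfrak{m}([\mathbf{a}])$. A probability measure $\mathfrak{m}$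 is *slowly decaying* if $c_{\mathfrak{m}}:=\operatorname{ess\,inf}_{\mathbf{a}}\inf_{k\in\mathbb{N}}\frac{\mathfrak{m}([a_1\ldots a_{k+1}])}{\mathfrak{m}([a_1\ldots a_k])}>0$ (essential infimum with respect to $\mathfrak{m}$). For slowly decaying $\mathfrak{m}$ and $n\in\mathbb{N}$, $L_{\mathfrak{m},n}=\{\mathbf{a}\in\mathcal{A}^*:\mathfrak{m}([a_1\ldots a_{|\mathbf{a}|}])\le c_{\mathfrak{m}}^n<\mathfrak{m}([a_1\ldots a_{|\mathbf{a}|-1}])\}$ (the cylinder of the empty word has measure $1$). **The class $G$.** For $B\subset\mathbb{N}$, $\overline{d}(B)=\limsup_{n\to\infty}\frac{\#\{1\le j\le n: j\in B\}}{n}$. For $\varepsilon>0$, $G_\varepsilon$ is the set of $g:\mathbb{N}\to[0,\infty)$ with $\sum_{n\in B}g(n)=\infty$ for every $B\subseteq\mathbb{N}$ with $\overline{d}(B)>1-\varepsilon$. $G=\bigcup_{\varepsilon\in(0,1)}G_\varepsilon$. **Limsup sets.** $W_\omega(\mathbf{b},\Psi)=\{x\in\mathbb{R}^d:|x-\Pi_\omega(\mathbf{a}\mathbf{b})|\le\Psi(\mathbf{a})\text{ for infinitely many }\mathbf{a}\in\mathcal{A}^*\}$. $U_\omega(\mathbf{b},\mathfrak{m},g)$ is the set of $x\in\mathbb{R}^d$ such that for infinitely many $n\in\mathbb{N}$ there is $\mathbf{a}\in L_{\mathfrak{m},n}$ with $|x-\Pi_\omega(\mathbf{a}\mathbf{b})|\le(\mathfrak{m}([\mathbf{a}])g(n))^{1/d}$.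 $\Psi$ is *equivalent to* $(\mathfrak{m},g)$ if there is a constant $K\ge1$ with $K^{-1}(\mathfrak{m}([\mathbf{a}])g(n))^{1/d}\le\Psi(\mathbf{a})\le K(\mathfrak{m}([\mathbf{a}])g(n))^{1/d}$ for all $n\in\mathbb{N}$ and $\mathbf{a}\in L_{\mathfrak{m},n}$. *)

(* Defs.v *)
From HB Require Import structures.
From mathcomp Require Import all_boot all_order all_algebra.
From mathcomp Require Import all_classical all_reals all_analysis.
From mathcomp Require Import ess_sup_inf.

Set Implicit Arguments.
Unset Strict Implicit.
Unset Printing Implicit Defensive.

Import Order.TTheory GRing.Theory Num.Theory.
Import numFieldNormedType.Exports.

Local Open Scope classical_set_scope.
Local Open Scope ring_scope.

Section euclidean.
Context {R : realType} {d : nat}.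
Implicit Types (x y : 'cV[R]_d) (A O : 'M[R]_d).

(* The library norm of a matrix or a vector is the max norm. *)
Definition enorm x : R := Num.sqrt (\sum_(i < d) x i 0 ^+ 2).

Definition eball y (r : R) : set 'cV[R]_d := [set x | enorm (x - y) < r].

Definition opnorm A : R :=
  sup [set enorm (A *m x) | x in [set x | enorm x <= 1]].

Definition orthogonal_mx O : Prop := O *m O^T = 1%:M.

Definition contraction_mx : set 'M[R]_d :=
  [set A | A \in unitmx /\ opnorm A < 1].

Definition similarity_mx : set 'M[R]_d :=
  [set A | contraction_mx A /\
           exists c : R, exists2 O, orthogonal_mx O & A = c *: O].

Definition box x y : set 'cV[R]_d :=
  [set z | forall i, x i 0 < z i 0 <= y i 0].

Definition box_volume x y : R := \prod_(i < d) (y i 0 - x i 0).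

Definition lebesgue_outer_measure (E : set 'cV[R]_d) : \bar R :=
  ereal_inf [set (\sum_(0 <= k <oo) (box_volume (p k).1 (p k).2)%:E)%E
            | p in [set p : nat -> 'cV[R]_d * 'cV[R]_d |
                (forall k i, (p k).1 i 0 <= (p k).2 i 0) /\
                E `<=` \bigcup_k box (p k).1 (p k).2]].

(* On its Caratheodory-measurable sets, the outer measure is the Lebesgue
   measure. *)
Definition positive_lebesgue_measure (E : set 'cV[R]_d) : Prop :=
  caratheodory_measurable lebesgue_outer_measure E /\
  (0 < lebesgue_outer_measure E)%E.

End euclidean.

Definition borel_mx (R : realType) (d : nat) :=
  g_sigma_algebraType [set U : set 'M[R]_d | open U].
HB.instance Definition _ (R : realType) (d : nat) :=
  Measurable.on (borel_mx R d).

(* The measurable types of the library are pointed, so the alphabet is a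
   nonempty finite type; its distinguished letter is not used otherwise. *)
#[short(type="pointedFinType")]
HB.structure Definition PointedFinite := {T of Pointed T & Finite T}.

(* The pair (a, s) is the nonempty word a :: s. *)
Definition word (A : Type) : Type := (A * seq A)%type.

Section words.
Context {A : Type}.
Implicit Types (a : word A) (u b : nat -> A).

Definition word_seq a : seq A := a.1 :: a.2.
Definition last_letter a : A := last a.1 a.2.

Definition prefixes a : seq (word A) :=
  [seq (a.1, take k a.2) | k <- iota 0 (size a.2).+1].

(* The first k + 1 letters; sequences are indexed from 0. *)
Definition prefix_word u (k : nat) : word A :=
  (u 0%N, mkseq (fun n => u n.+1) k).

Definition cat_word a b : nat -> A :=
  fun n => nth (b (n - size (word_seq a))%N) (word_seq a) n.

Definition cylinder (s : seq A) : set (nat -> A) :=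
  [set u | mkseq u (size s) = s].

Definition shift u : nat -> A := fun n => u n.+1.

End words.

(* The product sigma-algebra of the discrete alphabet *)
Definition symbolic_space (A : pointedFinType) :=
  g_sigma_algebraType (range (@cylinder A)).
HB.instance Definition _ (A : pointedFinType) :=
  Measurable.on (symbolic_space A).

Section symbolic_measures.
Context {R : realType} {A : pointedFinType}.
Variable m : probability (symbolic_space A) R.

Definition shift_invariant : Prop :=
  forall E : set (symbolic_space A), measurable E -> m (shift @^-1` E) = m E.

Definition shift_ergodic : Prop :=
  forall E : set (symbolic_space A), measurable E ->
    shift @^-1` E = E -> m E = 0%E \/ m E = 1%E.

Definition cylinder_mass (s : seq A) : R := fine (m (cylinder s)).

(* The term 0 * ln 0 is 0. *)
Definition entropy : R :=
  limn (fun k : nat => - (k%:R^-1 *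
    \sum_(s : k.-tuple A) cylinder_mass s * ln (cylinder_mass s))).

Definition decay_ebound : \bar R :=
  ess_inf m (fun u : symbolic_space A =>
    ereal_inf [set (cylinder_mass (mkseq u k.+1) / cylinder_mass (mkseq u k))%:E
              | k in [set k : nat | (0 < k)%N]]).

Definition slowly_decaying : Prop := (0 < decay_ebound)%E.

Definition decay_constant : R := fine decay_ebound.

Definition level_words (n : nat) : set (word A) :=
  [set a | cylinder_mass (word_seq a) <= decay_constant ^+ n
           < cylinder_mass (belast a.1 a.2)].

Definition level_radius (d : nat) (g : nat -> R) (n : nat) (a : word A) : R :=
  (cylinder_mass (word_seq a) * g n) `^ (d%:R^-1).

Definition equivalent_to (d : nat) (Psi : word A -> R)
    (g : nat -> R) : Prop :=
  exists2 K : R, 1 <= K & forall (n : nat) a, (0 < n)%N -> level_words n a ->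
    K^-1 * level_radius d g n a <= Psi a <= K * level_radius d g n a.

End symbolic_measures.

Section divergence_class.
Context {R : realType}.

Definition upper_density (B : set nat) : \bar R :=
  limn_esup (fun n : nat =>
    ((\sum_(1 <= j < n.+1) (j \in B))%N%:R / n%:R : R)%:E).

(* The natural numbers here start at 1: whether 0 is in B and the value of g
   at 0 make no difference. *)
Definition divergence_class_eps (eps : R) (g : nat -> R) : Prop :=
  (forall n, 0 <= g n) /\
  forall B : set nat, ((1 - eps)%:E < upper_density B)%E ->
    (\esum_(n in B) (g n)%:E = +oo)%E.

Definition divergence_class (g : nat -> R) : Prop :=
  exists2 eps : R, 0 < eps < 1 & divergence_class_eps eps g.

End divergence_class.

Record rifs (R : realType) (A : pointedFinType) (d : nat) := Rifs {
  rifs_set : A -> set (borel_mx R d);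
  rifs_law : A -> probability (borel_mx R d) R;
  rifs_trans : A -> 'cV[R]_d;
  rifs_set_measurable : forall i, measurable (rifs_set i);
  rifs_set_contraction : forall i, rifs_set i `<=` contraction_mx;
  rifs_set_bounded : forall i,
    exists2 c : R, c < 1 & forall M, rifs_set i M -> opnorm M <= c;
  rifs_law_supported : forall i, rifs_law i (rifs_set i) = 1%E;
  rifs_trans_inj : injective rifs_trans }.

(* The generators are the preimages of Borel sets under the coordinate maps:
   this is the product sigma-algebra. *)
Definition family_space (R : realType) (A : Type) (d : nat) :=
  g_sigma_algebraType (\bigcup_(a in [set: word A])
    preimage_set_system [set: word A -> borel_mx R d] (fun w => w a)
      (@measurable _ (borel_mx R d))).
HB.instance Definition _ (R : realType) (A : Type) (d : nat) :=
  Measurable.on (family_space R A d).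

Section rifs_theory.
Context {R : realType} {A : pointedFinType} {d : nat}.
Variable S : rifs R A d.
Implicit Types (w : family_space R A d) (m : probability (symbolic_space A) R).

Definition rifs_product_set : set (family_space R A d) :=
  [set w | forall a, rifs_set S (last_letter a) (w a)].

(* Product measures are characterized by their values on finite-dimensional
   rectangles. *)
Definition is_product_law (eta : probability (family_space R A d) R) : Prop :=
  forall (s : seq (word A)) (B : word A -> set (borel_mx R d)),
    uniq s -> (forall a, measurable (B a)) ->
    eta [set w | forall a, a \in s -> B a (w a)] =
    (\prod_(a <- s) rifs_law S (last_letter a) (B a))%E.

Definition rifs_map w (a : word A) (x : 'cV[R]_d) : 'cV[R]_d :=
  (w a : 'M[R]_d) *m x + rifs_trans S (last_letter a).

Definition rifs_comp w (a : word A) (x : 'cV[R]_d) : 'cV[R]_d :=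
  foldr (rifs_map w) x (prefixes a).

Definition rifs_proj w (u : nat -> A) : 'cV[R]_d :=
  limn (fun k => rifs_comp w (prefix_word u k) 0).

Definition rifs_attractors : set 'cV[R]_d :=
  [set x | exists2 w, rifs_product_set w & range (rifs_proj w) x].

Definition nonsingular : Prop :=
  exists2 C : R, 0 < C & forall i x y (r : R),
    rifs_attractors x -> 0 < r ->
    (rifs_law S i [set M | rifs_set S i M /\
                           eball y r ((M : 'M[R]_d) *m x)]
     <= (C * r ^+ d)%:E)%E.

(* The infimum is attained as soon as there are two letters. *)
Definition min_trans_dist : R :=
  inf [set enorm (rifs_trans S p.1 - rifs_trans S p.2)
      | p in [set p : A * A | p.1 != p.2]].

Definition distantly_nonsingular : Prop :=
  exists2 C : R, 0 < C & forall i x y (r : R),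
    rifs_attractors x -> ~ eball 0 (8^-1 * min_trans_dist) y -> 0 < r ->
    (rifs_law S i [set M | rifs_set S i M /\
                           eball y r ((M : 'M[R]_d) *m x)]
     <= (C * r ^+ d)%:E)%E.

Definition letter_lyapunov (i : A) : \bar R :=
  (- \int[rifs_law S i]_(M in rifs_set S i) (ln `|\det (M : 'M[R]_d)|)%:E)%E.

Definition lyapunov m : \bar R :=
  (\sum_(i : A) m (cylinder [:: i]) * letter_lyapunov i)%E.

Definition finite_log_moments : Prop :=
  (forall i, letter_lyapunov i \is a fin_num) /\
  exists2 delta : R, 0 < delta & forall i (s : R), `|s| < delta ->
    (lne (\int[rifs_law S i]_(M in rifs_set S i)
            (`|\det (M : 'M[R]_d)| `^ s)%:E) < +oo)%E.

Definition limsup_set w (b : nat -> A) (Psi : word A -> R) : set 'cV[R]_d :=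
  [set x | infinite_set
     [set a | enorm (x - rifs_proj w (cat_word a b)) <= Psi a]].

Definition level_limsup_set w (b : nat -> A) m (g : nat -> R) :
    set 'cV[R]_d :=
  [set x | infinite_set [set n : nat | (0 < n)%N /\
     exists2 a, level_words m n a &
       enorm (x - rifs_proj w (cat_word a b)) <= level_radius m d g n a]].

End rifs_theory.

(* Main.v *)
(* Fix b and a level n, and let c be the decay constant of m. Since the entropy
   exceeds the Lyapunov exponent, for some alpha > 0 and C a set of sequences u
   of positive m-measure satisfies
     m [u_1 .. u_k] <= C exp (- alpha k - (lambda'_{u_1} + .. + lambda'_{u_k}))
   for all k; this comes from counting words with blocks of larger mass, and
   needs only that m is shift-invariant. At every level n this leaves a family
   W_n of about c^-n words of total mass bounded below.

   Let a, a' in W_n branch after a common prefix v. Resampling the matrix at the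
   branching vertex, (distant) non-singularity bounds the probability that the
   determinant along v is at least z while the points of a and a' are within
   rho by a multiple of rho^d / z. The matrices along a path are independent, so
   by Chernoff's bound the determinant along v is at least
   m [v] exp (alpha |v| / 4) / M for all prefixes v of a, up to a probability
   that tends to 0 as M grows. Summing over a' and v, all but a small
   fraction of the points at level n are, with large probability, at distance at
   least s c^(n/d) from all other points of the level. Markov's inequality,
   applied at each level and then to the levels 1 .. N, gives almost surely a
   set B of levels of upper density as close to 1 as desired at which at least
   half of the points are s c^(n/d)-separated.

   If the sum of g over B diverges, then the second moment method (Kochen-Stone)
   for the balls of radius comparable to (c^n g(n))^(1/d) around these points
   gives a limsup set of positive measure. The exceptional null set depends only
   on b. *)

Require Import Defs.
From HB Require Import structures.
From mathcomp Require Import all_boot all_order all_algebra.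
From mathcomp Require Import all_classical all_reals all_analysis.
From mathcomp Require Import perm measurable_realfun ess_sup_inf.
From mathcomp Require Import ring lra zify.

Set Implicit Arguments.
Unset Strict Implicit.
Unset Printing Implicit Defensive.

Import Order.TTheory GRing.Theory Num.Theory.
Import numFieldNormedType.Exports.

Local Open Scope classical_set_scope.
Local Open Scope ring_scope.

(** * Euclidean norm *)

(** The class $G$ is uncountable, so all probability is spent before $g$ is chosen: the random part
    ends with points separated at scale $c^{n/d}$, and the rest holds for a fixed family and every
    $g$. Divergence along every set of levels of large upper density, as in $G_\varepsilon$, fits a
    separation that fails on a small proportion of the levels. The threshold for the determinant
    along $v$ carries the factor $m[v]$ because the words of a level below $v$ have total mass at
    most $m[v]$: the sum over $a'$ is then bounded for each $v$, and the exponential factor makes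
    the sum over $v$ geometric. The surplus $\alpha$ is shared out: a quarter for this factor, a
    quarter as slack in Chernoff's bound, and half to make the failure probabilities at the prefixes
    summable. The counting of words is a comparison of $m$ with an explicit subprobability built
    from blocks, by Gibbs' inequality. For general matrices a ball seen through a product $P$ pulls
    back to an ellipsoid of volume about $\rho^d/|\det P|$. A grid extends the non-singularity bound
    from balls to ellipsoids, given how volume changes under linear maps. *)

Section euclidean_norm.
Context {R : realType}.

Lemma cauchy_schwarz_sum (I : finType) (a b : I -> R) :
  (\sum_i a i * b i) ^+ 2 <= (\sum_i a i ^+ 2) * (\sum_i b i ^+ 2).
Proof.
set P := \sum_i a i * b i; set X := \sum_i a i ^+ 2; set Y := \sum_i b i ^+ 2.
have Y0 : 0 <= Y by apply: sumr_ge0 => i _; exact: sqr_ge0.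
(* The factor [Y] turns the difference into a sum of squares without division; [Y = 0] is then
   treated apart. *)
have key : 0 <= Y * (X * Y - P ^+ 2).
  have -> : Y * (X * Y - P ^+ 2) = \sum_i (Y * a i - P * b i) ^+ 2.
    rewrite (eq_bigr (fun i => Y ^+ 2 * a i ^+ 2 - (2 * Y * P) * (a i * b i)
      + P ^+ 2 * b i ^+ 2)) => [|i _]; last by ring.
    rewrite big_split/= sumrB -!mulr_sumr -/X -/Y -/P; ring.
  by apply: sumr_ge0 => i _; exact: sqr_ge0.
have [Y_gt0|] := ltP 0 Y; first by rewrite pmulr_rge0// subr_ge0 in key.
move=> Yle0; have Y_eq0 : Y = 0 by apply/eqP; rewrite eq_le Yle0.
have b0 i : b i = 0.
  move/eqP: Y_eq0; rewrite psumr_eq0 => [/allP/(_ i)|j _]; last exact: sqr_ge0.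
  by rewrite mem_index_enum => /(_ isT) /=; rewrite sqrf_eq0 => /eqP.
by rewrite /P big1 => [|i _]; rewrite ?b0 ?mulr0// expr0n/= Y_eq0 mulr0.
Qed.

Context {d : nat}.
Implicit Types (x y : 'cV[R]_d) (A B : 'M[R]_d).

Lemma enorm_ge0 x : 0 <= enorm x.
Proof. exact: sqrtr_ge0. Qed.

Lemma sum_sqr_ge0 x : 0 <= \sum_(i < d) x i 0 ^+ 2.
Proof. by apply: sumr_ge0 => i _; exact: sqr_ge0. Qed.

Lemma sqr_enorm x : enorm x ^+ 2 = \sum_(i < d) x i 0 ^+ 2.
Proof. by rewrite sqr_sqrtr// sum_sqr_ge0. Qed.

Lemma enormZ (c : R) x : enorm (c *: x) = `|c| * enorm x.
Proof.
rewrite /enorm; under eq_bigr do rewrite mxE exprMn.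
by rewrite -mulr_sumr sqrtrM ?sqr_ge0// sqrtr_sqr.
Qed.

Lemma enormN x : enorm (- x) = enorm x.
Proof. by rewrite -scaleN1r enormZ normrN1 mul1r. Qed.

Lemma enorm0 : enorm (0 : 'cV[R]_d) = 0.
Proof. by rewrite -(scale0r 0) enormZ normr0 mul0r. Qed.

Lemma enorm_eq0 x : enorm x = 0 -> x = 0.
Proof.
move=> /(congr1 (fun t => t ^+ 2)); rewrite sqr_enorm expr0n/= => /eqP.
rewrite psumr_eq0 => [/allP h|j _]; last exact: sqr_ge0.
apply/colP => i; rewrite mxE; have := h i.
by rewrite mem_index_enum => /(_ isT); rewrite sqrf_eq0 => /eqP.
Qed.

Lemma enormB x y : enorm (x - y) = enorm (y - x).
Proof. by rewrite -opprB enormN. Qed.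

Lemma enormD x y : enorm (x + y) <= enorm x + enorm y.
Proof.
rewrite -ler_sqr ?nnegrE ?addr_ge0 ?enorm_ge0// sqr_enorm.
rewrite sqrrD !sqr_enorm.
have -> : \sum_(i < d) (x + y) i 0 ^+ 2 =
    \sum_(i < d) x i 0 ^+ 2 + (\sum_(i < d) x i 0 * y i 0) *+ 2
    + \sum_(i < d) y i 0 ^+ 2.
  rewrite -sumrMnl -!big_split/=; apply: eq_bigr => i _.
  by rewrite mxE sqrrD.
rewrite lerD2r lerD2l lerMn2r/=; apply: le_trans (ler_norm _) _.
rewrite -ler_sqr ?nnegrE ?mulr_ge0 ?enorm_ge0// exprMn !sqr_enorm.
by rewrite real_normK ?num_real//; exact: cauchy_schwarz_sum.
Qed.

Lemma enorm_dist_triangle x y z : enorm (x - z) <= enorm (x - y) + enorm (y - z).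
Proof. by rewrite -{1}(subrK y x) -addrA; exact: enormD. Qed.

Lemma entry_le_enorm x i : `|x i 0| <= enorm x.
Proof.
rewrite -ler_sqr ?nnegrE ?enorm_ge0// sqr_enorm real_normK ?num_real//.
by rewrite (bigD1 i)//= lerDl; apply: sumr_ge0 => j _; exact: sqr_ge0.
Qed.

Lemma enorm_le_sum x : enorm x <= \sum_(i < d) `|x i 0|.
Proof.
rewrite -ler_sqr ?nnegrE ?enorm_ge0 ?sumr_ge0// sqr_enorm.
rewrite expr2 mulr_sumr; apply: ler_sum => i _.
rewrite -[x i 0 ^+ 2]real_normK ?num_real// expr2 ler_wpM2r//.
by rewrite (bigD1 i)//= lerDl sumr_ge0.
Qed.

Lemma enorm_le_entries x (r : R) :
  (forall i, `|x i 0| <= r) -> enorm x <= d%:R * r.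
Proof.
move=> h; apply: le_trans (enorm_le_sum x) _.
by apply: (le_trans (ler_sum _ (fun i _ => h i))); rewrite sumr_const card_ord mulr_natl.
Qed.

Definition entry_sum A : R := \sum_i \sum_j `|A i j|.

Lemma enorm_mul_entry_sum A x : enorm (A *m x) <= entry_sum A * enorm x.
Proof.
apply: le_trans (enorm_le_sum _) _; rewrite mulr_suml.
apply: ler_sum => i _; rewrite mxE; apply: le_trans (ler_norm_sum _ _ _) _.
rewrite mulr_suml; apply: ler_sum => j _; rewrite normrM ler_wpM2l//.
exact: entry_le_enorm.
Qed.

Lemma enorm_mul_opnorm A x : enorm (A *m x) <= opnorm A * enorm x.
Proof.
have [/enorm_eq0 ->|x0] := eqVneq (enorm x) 0.
  by rewrite mulmx0 enorm0 mulr0.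
have xgt0 : 0 < enorm x by rewrite lt_def x0 enorm_ge0.
rewrite -ler_pdivrMr//.
have -> : enorm (A *m x) / enorm x = enorm (A *m ((enorm x)^-1 *: x)).
  by rewrite -scalemxAr enormZ ger0_norm ?invr_ge0 ?enorm_ge0// mulrC.
apply: sup_upper_bound; last first.
  exists ((enorm x)^-1 *: x) => //=.
  by rewrite enormZ ger0_norm ?invr_ge0 ?enorm_ge0// mulVf.
split; first by exists (enorm (A *m 0)); exists 0 => //=; rewrite enorm0.
exists (entry_sum A) => _ [y /= y1 <-]; apply: le_trans (enorm_mul_entry_sum _ _) _.
by rewrite ler_piMr// sumr_ge0// => i _; exact: sumr_ge0.
Qed.

Lemma entry_le1_det A : (forall i j, `|A i j| <= 1) -> `|\det A| <= d`!%:R.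
Proof.
move=> A1; apply: le_trans (ler_norm_sum _ _ _) _.
have -> : d`!%:R = \sum_(s : 'S_d) 1 :> R.
  by rewrite sumr_const cardT -cardE -card_Sn; congr (_%:R); exact: eq_card.
apply: ler_sum => s _; rewrite normrM normr_sign mul1r normr_prod.
by apply: prodr_ile1 => i _; rewrite normr_ge0/=.
Qed.

Lemma enorm_delta (i : 'I_d) : enorm (delta_mx i 0 : 'cV[R]_d) = 1.
Proof.
rewrite /enorm (bigD1 i)//= big1 ?addr0 ?mxE ?eqxx ?expr1n ?sqrtr1// => j ji.
by rewrite mxE (negPf ji) expr0n.
Qed.

End euclidean_norm.

(** * Determinants of contractions and orthogonal matrices *)

Section contractions.
Context {R : realType} {d : nat}.
Implicit Types A : 'M[R]_d.

(* The powers of a contraction have entries bounded by 1, so the powers of its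
   determinant are bounded. *)
Lemma contraction_det_le1 A : contraction_mx A -> `|\det A| <= 1.
Proof.
move=> [_ A1]; rewrite leNgt; apply/negP => D1.
pose P n := iter n (mulmx A) 1%:M.
have detP n : \det (P n) = \det A ^+ n.
  by elim: n => [|n IH]; rewrite /P/= ?det1 ?expr0// det_mulmx -/(P n) IH exprS.
have Px n (x : 'cV[R]_d) : enorm (P n *m x) <= enorm x.
  elim: n => [|n IH]; first by rewrite mul1mx.
  rewrite /P/= -mulmxA -/(P n); apply: le_trans (enorm_mul_opnorm _ _) _.
  by apply: le_trans IH; rewrite ler_piMl ?enorm_ge0// ltW.
have bnd n : `|\det A| ^+ n <= d`!%:R.
  rewrite -normrX -detP; apply: entry_le1_det => i j.
  have := Px n (delta_mx j 0); rewrite enorm_delta; apply: le_trans.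
  by rewrite -colE; apply: le_trans (entry_le_enorm _ i); rewrite mxE.
have [n /= ] : exists n, d`!%:R < `|\det A| ^+ n.
  have x0 : 0 < `|\det A| - 1 by rewrite subr_gt0.
  pose n := Num.Def.truncn (d`!%:R / (`|\det A| - 1)); exists n.+1.
  apply: (@lt_le_trans _ _ (n.+1%:R * (`|\det A| - 1))).
    by rewrite -ltr_pdivrMr//; exact: truncnS_gt.
  (* A weak form of Bernoulli's inequality. *)
  have : forall k, k%:R * (`|\det A| - 1) <= `|\det A| ^+ k.
    elim=> [|k IH]; first by rewrite mul0r expr0.
    rewrite exprS -natr1 mulrDl mul1r.
    have := @exprn_ege1 _ k `|\det A| (ltW D1) => h1.
    nra.
  exact.
by rewrite ltNge bnd.
Qed.

Lemma contraction_det_neq0 A : contraction_mx A -> \det A != 0.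
Proof. by move=> [+ _]; rewrite unitmxE unitfE. Qed.

Lemma orthogonal_enorm (O : 'M[R]_d) x : orthogonal_mx O -> enorm (O *m x) = enorm x.
Proof.
move=> /mulmx1C OO; rewrite /enorm; congr Num.sqrt.
have e (y : 'cV[R]_d) : \sum_(i < d) y i 0 ^+ 2 = (y^T *m y) 0 0.
  by rewrite mxE; apply: eq_bigr => i _; rewrite mxE expr2.
by rewrite !e trmx_mul mulmxA -(mulmxA x^T) OO mulmx1.
Qed.

Lemma orthogonal_det (O : 'M[R]_d) : orthogonal_mx O -> `|\det O| = 1.
Proof.
move=> /(congr1 determinant); rewrite det_mulmx det_tr det1 -expr2 => h.
by apply/eqP; rewrite -sqrp_eq1// real_normK ?num_real// h.
Qed.

End contractions.

(** * Lebesgue outer measure *)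

Definition closed_eball {R : realType} {d : nat} (y : 'cV[R]_d) (r : R) :
  set 'cV[R]_d := [set z | enorm (z - y) <= r].

Section box_covers.
Context {R : realType}.

(* Induction on the dimension: every slice of the box is covered by the slices
   of the covering boxes, and the slices are integrated over the first
   coordinate. *)
Lemma box_volume_le_cover (d : nat) (x y : 'I_d -> R) (a b : nat -> 'I_d -> R)
    (P : pred nat) :
  (forall k i, a k i <= b k i) -> (forall i, x i <= y i) ->
  (forall z : 'I_d -> R, (forall i, x i < z i <= y i) ->
     exists2 k, P k & forall i, a k i < z i <= b k i) ->
  ((\prod_i (y i - x i))%:E <=
     \sum_(0 <= k <oo | P k) (\prod_i (b k i - a k i))%:E)%E.
Proof.
elim: d x y a b P => [|d IH] x y a b P ab xy cov.
  (* In dimension 0 every volume is the empty product 1, so one box of the cover is enough. *)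
  have [|k Pk _] := cov (fun=> 0); first by case.
  have h0 n : (0 <= (\prod_(i < 0) (b n i - a n i))%:E)%E by rewrite big_ord0.
  rewrite (nneseriesD1 (n := k))// big_ord0 lee_paddr//= ?big_ord0//.
  by apply: nneseries_ge0 => n _ _; exact: h0.
pose tl (u : 'I_d.+1 -> R) := fun i => u (lift ord0 i).
pose V k := \prod_i (tl (b k) i - tl (a k) i).
pose W := \prod_i (tl y i - tl x i).
have V0 k : 0 <= V k by apply: prodr_ge0 => i _; rewrite subr_ge0; exact: ab.
have W0 : 0 <= W by apply: prodr_ge0 => i _; rewrite subr_ge0; exact: xy.
pose J u v : set R := [set` `](u : R), v]].
have mJ u v : measurable (J u v) by exact: measurable_itv.
have Jm u v : u <= v -> lebesgue_measure (J u v) = (v - u)%:E.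
  rewrite le_eqVlt => /predU1P[->|uv]; rewrite lebesgue_measure_itv/= lte_fin.
    by rewrite ltxx subrr.
  by rewrite uv EFinB.
have slice t : J (x ord0) (y ord0) t ->
    (W%:E <= \sum_(0 <= k <oo | P k) ((V k)%:E * (\1_(J (a k ord0) (b k ord0)) t)%:E))%E.
  rewrite /J/= in_itv/= => xyt.
  (* The predicate [P] serves this induction: above the point [t] only the boxes whose first side
     contains [t] take part. *)
  have := IH (tl x) (tl y) (tl \o a) (tl \o b)
     (fun k => P k && (a k ord0 < t <= b k ord0)).
  move=> /(_ (fun k i => ab k _) (fun i => xy _)) h.
  apply: le_trans (h _) _.
    move=> z zP; have [|k Pk kP] := cov (fun i => oapp z t (unlift ord0 i)).
      by move=> i; case: unliftP => [j ->|->] /=; [exact: zP|].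
    exists k.
      by have := kP ord0; rewrite Pk unlift_none.
    by move=> i; have := kP (lift ord0 i); rewrite liftK.
  rewrite eseries_mkcondr; apply: lee_nneseries => k _.
    by case: ifP => // _; rewrite lee_fin (V0 k).
  rewrite indicE mem_setE in_itv/=.
  case: ifP => _; first by rewrite mule1.
  by rewrite mule0.
rewrite big_ord_recl mulrC EFinM -/W.
have -> : (\sum_(0 <= k <oo | P k) (\prod_i (b k i - a k i))%:E =
   \sum_(0 <= k <oo) (if P k then (V k)%:E * (b k ord0 - a k ord0)%:E else 0))%E.
  rewrite eseries_mkcond; apply: eq_eseriesr => k _; case: ifP => // _.
  by rewrite big_ord_recl mulrC EFinM.
rewrite -Jm//; set mu := lebesgue_measure.
have mind u v : measurable_fun [set: R] (fun t : R => (\1_(J u v) t : R)%:E).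
  by apply/measurable_EFinP; apply: measurable_indic; exact: mJ.
have iJ u v (c : R) : 0 <= c ->
    (c%:E * mu (J u v) = \int[mu]_t (c%:E * (\1_(J u v) t)%:E))%E.
  move=> c0; rewrite ge0_integralZl_EFin//=; last exact: mind.
  congr (_ * _)%E.
  by rewrite (integral_indic mu measurableT (mJ u v)) setIT.
rewrite iJ//.
pose f k t := (if P k then (V k)%:E * (\1_(J (a k ord0) (b k ord0)) t)%:E else 0)%E.
have f0 k t : (0 <= f k t)%E by rewrite /f; case: ifP => // _; rewrite mule_ge0// lee_fin.
have mf k : measurable_fun [set: R] (f k).
  by rewrite /f; case: (P k) => //; apply: measurable_funeM; exact: mind.
apply: (@le_trans _ _ (\int[mu]_t \sum_(0 <= k <oo) f k t)%E).
  apply: ge0_le_integral => //.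
  - by move=> t _; rewrite mule_ge0// lee_fin.
  - by apply: measurable_funeM; exact: mind.
  - by apply: ge0_emeasurable_sum => *; [exact: f0|exact: mf].
  - move=> t _; rewrite indicE; have [|_] := boolP (t \in _).
      by rewrite inE => /slice; rewrite mule1 eseries_mkcond.
    by rewrite mule0; apply: nneseries_ge0 => k _ _; exact: f0.
rewrite integral_nneseries//; apply: lee_nneseries => k _ .
  by move=> _; apply: integral_ge0 => t _; exact: f0.
rewrite /f; case: ifP => _; first by rewrite -iJ// -(Jm _ _ (ab k ord0)).
by rewrite integral0.
Qed.

End box_covers.

Section lebesgue_outer_measure_theory.
Context {R : realType}.

Section any_dimension.
Context {d : nat}.
Implicit Types (x y : 'cV[R]_d) (E : set 'cV[R]_d).
Let leb := @lebesgue_outer_measure R d.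

Lemma box_volume_ge0 x y : (forall i, x i 0 <= y i 0) -> 0 <= box_volume x y.
Proof. by move=> xy; apply: prodr_ge0 => i _; rewrite subr_ge0. Qed.

Lemma lebesgue_outer_ge0 E : (0 <= leb E)%E.
Proof.
apply: le_ereal_inf_tmp => _ [p [p0 _] <-].
by apply: nneseries_ge0 => k _ _; rewrite lee_fin box_volume_ge0.
Qed.

Lemma le_lebesgue_outer : {homo leb : E F / E `<=` F >-> (E <= F)%E}.
Proof.
move=> E F EF; apply/ereal_inf_le_tmp => _ [p [p0 pF] <-].
by exists p => //; split => //; exact: subset_trans pF.
Qed.

Lemma lebesgue_outer_le_cover E (p : nat -> 'cV[R]_d * 'cV[R]_d) :
  (forall k i, (p k).1 i 0 <= (p k).2 i 0) ->
  E `<=` \bigcup_k box (p k).1 (p k).2 ->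
  (leb E <= \sum_(0 <= k <oo) (box_volume (p k).1 (p k).2)%:E)%E.
Proof. by move=> p0 Ep; apply: ereal_inf_lbound; exists p. Qed.

Lemma box_volume_le_lebesgue x y : (forall i, x i 0 <= y i 0) ->
  ((box_volume x y)%:E <= leb (box x y))%E.
Proof.
move=> xy; apply: le_ereal_inf_tmp => _ [p [p0 pB] <-].
pose a k i : R := (p k).1 i 0; pose b k i : R := (p k).2 i 0.
apply: (@box_volume_le_cover _ _ (fun i => x i 0) (fun i => y i 0) a b xpredT) => //.
move=> z zxy; have [|k _ kP] := pB (\col_i z i).
  by move=> i; rewrite mxE.
by exists k => // i; have := kP i; rewrite mxE.
Qed.

Lemma lebesgue_outer_adherent E (e : R) : 0 < e -> leb E \is a fin_num ->
  exists p : nat -> 'cV[R]_d * 'cV[R]_d,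
    [/\ forall k i, (p k).1 i 0 <= (p k).2 i 0,
        E `<=` \bigcup_k box (p k).1 (p k).2 &
        (\sum_(0 <= k <oo) (box_volume (p k).1 (p k).2)%:E < leb E + e%:E)%E].
Proof.
move=> e0 /(lb_ereal_inf_adherent e0)[_ [p [p0 pE] <-] pe].
by exists p.
Qed.

(** Covers that are optimal up to [e / 2 ^ n.+1] are merged into one sequence along a bijection
    between [nat] and [nat * nat]. *)
Lemma lebesgue_outer_sigma_subadditive : sigma_subadditive leb.
Proof.
move=> A; have [[i ioo]|] := pselect (exists i, leb (A i) = +oo%E).
  rewrite (eseries_pinfty _ _ ioo) ?leey// => n _.
  by rewrite -ltNye (lt_le_trans _ (lebesgue_outer_ge0 _)).
rewrite -forallNE => Aoo.
have Afin n : leb (A n) \is a fin_num.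
  by rewrite ge0_fin_numE ?lebesgue_outer_ge0// ltey; apply/eqP; exact: Aoo.
suff add2e (e : {posnum R}) :
    (leb (\bigcup_n A n) <= \sum_(i <oo) leb (A i) + e%:num%:E)%E.
  by apply/lee_addgt0Pr => _/posnumP[].
rewrite (le_trans _ (epsilon_trick _ _ _))//; last first.
  by move=> n; exact: lebesgue_outer_ge0.
pose P n (p : nat -> 'cV[R]_d * 'cV[R]_d) :=
  [/\ forall k i, (p k).1 i 0 <= (p k).2 i 0,
      A n `<=` \bigcup_k box (p k).1 (p k).2 &
  (\sum_(0 <= k <oo) (box_volume (p k).1 (p k).2)%:E <=
      leb (A n) + (e%:num / (2 ^ n.+1)%:R)%:E)%E].
have [G PG] : {G : nat -> nat -> 'cV[R]_d * 'cV[R]_d & forall n, P n (G n)}.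
  apply: (@choice _ _ P) => n.
  have en1 : 0 < e%:num / (2 ^ n.+1)%:R :> R by [].
  have [p [p0 pA /ltW ps]] := lebesgue_outer_adherent en1 (Afin n).
  by exists p.
pose v (q : 'cV[R]_d * 'cV[R]_d) : \bar R := (box_volume q.1 q.2)%:E.
have v0 n k : (0 <= v (G n k))%E.
  by rewrite lee_fin box_volume_ge0//; have [+ _ _] := PG n; exact.
apply: (@le_trans _ _ (\esum_(i in setT) (v \o uncurry G) i)%E).
  have /card_esym/ppcard_eqP[f] := card_nat2.
  apply: (@le_trans _ _ (\sum_(0 <= k <oo) v (uncurry G (f k)))%E).
    apply: lebesgue_outer_le_cover.
      by move=> k i; rewrite /uncurry; case: (f k) => n j; have [+ _ _] := PG n; exact.
    move=> t [i _ Ait]; have [_ /(_ _ Ait)[j _ Bj] _] := PG i.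
    by exists (f^-1%FUN (i, j)) => //=; rewrite invK ?inE.
  rewrite -(esum_pred_image (v \o uncurry G) f xpredT) ?[fun=> _]set_true//.
  - by rewrite image_eq.
  - by move=> n _ /=; rewrite /uncurry; case: (f n) => *; exact: v0.
rewrite (_ : esum _ _ = \sum_(i <oo) \sum_(j <oo) v (G i j))%E; last first.
  pose J : nat -> set (nat * nat) := fun i => [set (i, j) | j in setT].
  rewrite (_ : setT = \bigcup_k J k); last first.
    by rewrite predeqE => -[a b]; split => // _; exists a => //; exists b.
  rewrite esum_bigcupT /=; last 2 first.
    - apply/trivIsetP => i j _ _ ij.
      rewrite predeqE => -[n m] /=; split => //= -[] [_] _ [<-{n} _].
      by move=> [m' _] [] /esym/eqP; rewrite (negbTE ij).
    - by move=> /= [n m]; exact: v0.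
  rewrite -(image_id [set: nat]) -fun_true esum_pred_image//; last first.
    by move=> n _; apply: esum_ge0 => -[n' m] _; exact: v0.
  apply: eq_eseriesr => /= j _.
  rewrite -(esum_pred_image (v \o uncurry G) (pair j) predT)//=; last first.
    by move=> ? ? _ _; exact: (@can_inj _ _ _ snd).
  by congr esum; rewrite predeqE => -[a b]; split; move=> [i _ <-]; exists i.
apply: lee_nneseries => n _; last by have [_ _ +] := PG n.
by move=> _; apply: nneseries_ge0 => k _ _; exact: v0.
Qed.

End any_dimension.

Section positive_dimension.
Context {d : nat}.
Implicit Types (x y : 'cV[R]_d.+1) (E : set 'cV[R]_d.+1).
Let leb := @lebesgue_outer_measure R d.+1.

(** This fails in dimension 0, where every box has volume 1 and a cover always consists of
    infinitely many boxes. Hence the dimension is written [d.+1] from here on. *)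
Lemma lebesgue_outer0 : leb set0 = 0%E.
Proof.
apply/eqP; rewrite eq_le lebesgue_outer_ge0 andbT.
apply: le_trans (lebesgue_outer_le_cover (p := fun=> (0, 0)) _ _) _ => //.
rewrite eseries0// => k _ _ /=.
by rewrite /box_volume big_ord_recl !mxE subrr mul0r.
Qed.

Lemma lebesgue_outer_box_le x y : (forall i, x i 0 <= y i 0) ->
  (leb (box x y) <= (box_volume x y)%:E)%E.
Proof.
move=> xy; pose p (k : nat) : 'cV[R]_d.+1 * 'cV[R]_d.+1 := if k is 0%N then (x, y) else (0, 0).
apply: le_trans (lebesgue_outer_le_cover (p := p) _ _) _.
- by case=> [|k] i /=.
- by move=> z xzy; exists 0%N.
rewrite nneseries_recl//; last first.
  by case=> [|k] _; rewrite lee_fin box_volume_ge0//=.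
rewrite eseries_cond/= eseries0 ?adde0// => -[|k]//= _ _.
by rewrite /box_volume big_ord_recl !mxE subrr mul0r.
Qed.

HB.instance Definition _ := isOuterMeasure.Build R 'cV[R]_d.+1
  (@lebesgue_outer_measure R d.+1)
  lebesgue_outer0 lebesgue_outer_ge0 le_lebesgue_outer
  lebesgue_outer_sigma_subadditive.

Let clamp (a b t : R) := Num.max a (Num.min b t).

(** The hyperplane cuts each box of a cover into two half-open boxes whose volumes add up to that of
    the box; clamping the cut to the side covers the case where one piece is empty. *)
Lemma halfspace_caratheodory (j : 'I_d.+1) (t : R) :
  caratheodory_measurable leb [set z : 'cV[R]_d.+1 | z j 0 <= t].
Proof.
apply: le_caratheodory_measurable => X; set H := [set z | _].
apply: le_ereal_inf_tmp => _ [p [p0 pX] <-].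
pose c k := clamp ((p k).1 j 0) ((p k).2 j 0) t.
pose low k := ((p k).1, \col_i if i == j then c k else (p k).2 i 0).
pose upp k := (\col_i if i == j then c k else (p k).1 i 0, (p k).2).
have cb k : (p k).1 j 0 <= c k <= (p k).2 j 0.
  by rewrite /c /clamp le_max lexx/= ge_max p0/= ge_min lexx.
have low0 k i : (low k).1 i 0 <= (low k).2 i 0.
  by rewrite /= mxE; case: eqP => // ->; have /andP[] := cb k.
have upp0 k i : (upp k).1 i 0 <= (upp k).2 i 0.
  by rewrite /= mxE; case: eqP => // ->; have /andP[] := cb k.
have Hlow : X `&` H `<=` \bigcup_k box (low k).1 (low k).2.
  move=> z [Xz Hz]; have [k _ kz] := pX _ Xz; exists k => // i /=.
  have /andP[h1 h2] := kz i; rewrite mxE h1/=; case: eqP => // ij.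
  by subst i; rewrite /c /clamp le_max le_min h2; apply/orP; right.
have Hupp : X `&` ~` H `<=` \bigcup_k box (upp k).1 (upp k).2.
  move=> z [Xz /negP Hz]; have [k _ kz] := pX _ Xz; exists k => // i /=.
  have /andP[h1 h2] := kz i; rewrite mxE h2 andbT; case: eqP => // ij.
  subst i; rewrite /c /clamp gt_max h1/= gt_min; apply/orP; right.
  by rewrite ltNge.
apply: le_trans (leeD (lebesgue_outer_le_cover low0 Hlow)
  (lebesgue_outer_le_cover upp0 Hupp)) _.
rewrite -nneseriesD; last 2 first.
- by move=> k _ _; rewrite lee_fin box_volume_ge0.
- by move=> k _ _; rewrite lee_fin box_volume_ge0.
apply: lee_nneseries => k _.
  by rewrite adde_ge0// lee_fin box_volume_ge0.
rewrite -EFinD lee_fin /box_volume.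
rewrite (bigD1 j)//= [X in _ + X](bigD1 j)//= [X in _ <= X](bigD1 j)//=.
rewrite !mxE eqxx.
rewrite (eq_bigr (fun i => (p k).2 i 0 - (p k).1 i 0)); last first.
  by move=> i ij; rewrite mxE (negPf ij).
rewrite [X in _ + _ * X](eq_bigr (fun i => (p k).2 i 0 - (p k).1 i 0)); last first.
  by move=> i ij; rewrite mxE (negPf ij).
by rewrite -mulrDl addrC addrA subrK.
Qed.

Local Notation leb_space := (caratheodory_type (@lebesgue_outer_measure R d.+1)).

(** On the Caratheodory sets the outer measure is a measure, which gives integrals, additivity and
    continuity from above. *)
Definition volume : set leb_space -> \bar R := @lebesgue_outer_measure R d.+1.

HB.instance Definition _ := isMeasure.Build _ leb_space R volume
  (@caratheodory_measure0 R _ (@lebesgue_outer_measure R d.+1))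
  (@caratheodory_measure_ge0 R _ (@lebesgue_outer_measure R d.+1))
  (@caratheodory_measure_sigma_additive R _ (@lebesgue_outer_measure R d.+1)).

Lemma measurable_coord (j : 'I_d.+1) :
  measurable_fun [set: leb_space] (fun z : leb_space => (z : 'cV[R]_d.+1) j 0).
Proof.
apply: (measurability _ (RGenOInfty.measurableE R)) => _ [_ [t ->] <-].
rewrite setTI (_ : _ @^-1` _ = ~` [set z : 'cV[R]_d.+1 | z j 0 <= t]).
  by apply: measurableC; exact: halfspace_caratheodory.
by apply/seteqP; split => z /=; rewrite in_itv/= andbT ltNge => /negP.
Qed.

Lemma closed_ball_caratheodory y (r : R) :
  caratheodory_measurable leb (closed_eball y r).
Proof.
have [r0|r0] := leP 0 r; last first.
  rewrite (_ : closed_eball _ _ = set0); first exact: caratheodory_measurable_set0.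
  apply/seteqP; split => // z /= /(le_trans (enorm_ge0 _)).
  by rewrite leNgt r0.
pose f (z : leb_space) : R := \sum_(i < d.+1) ((z : 'cV[R]_d.+1) i 0 - y i 0) ^+ 2.
have mf : measurable_fun [set: leb_space] f.
  apply: measurable_sum => i; apply: measurable_funX.
  by apply: measurable_funB => //; exact: measurable_coord.
have := mf measurableT _ (measurable_itv `]-oo, (r ^+ 2)]).
rewrite setTI; congr (measurable _); apply/seteqP; split => z /=; rewrite in_itv/= /closed_eball/=.
  move=> fz; rewrite -ler_sqr ?nnegrE ?enorm_ge0// sqr_enorm.
  by apply: le_trans fz; apply: ler_sum => i _; rewrite !mxE.
rewrite -ler_sqr ?nnegrE ?enorm_ge0// sqr_enorm => fz.
by apply: le_trans fz; apply: ler_sum => i _; rewrite !mxE.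
Qed.

Lemma closed_ball_volume_le y (r : R) : 0 < r ->
  (leb (closed_eball y r) <= ((4 * r) ^+ d.+1)%:E)%E.
Proof.
(* The half-side is [2 * r] rather than [r] because boxes are open on the left. *)
move=> r0; pose a := y - const_mx (2 * r); pose b := y + const_mx (2 * r).
apply: (@le_trans _ _ (leb (box a b))).
  apply: le_lebesgue_outer => z /= zr i; rewrite /a /b !mxE.
  have := le_trans (entry_le_enorm (z - y) i) zr; rewrite !mxE ler_norml; lra.
apply: le_trans (lebesgue_outer_box_le _) _.
  by move=> i; rewrite /a /b !mxE; lra.
rewrite lee_fin /box_volume (eq_bigr (fun=> 4 * r)).
  by rewrite prodr_const card_ord.
by move=> i _; rewrite /a /b !mxE; ring.
Qed.

Lemma closed_ball_volume_ge y (r : R) : 0 < r ->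
  (((2 * r / d.+1%:R) ^+ d.+1)%:E <= leb (closed_eball y r))%E.
Proof.
move=> r0; pose e := r / d.+1%:R; have e0 : 0 < e by rewrite divr_gt0.
pose a := y - const_mx e; pose b := y + const_mx e.
apply: (@le_trans _ _ (leb (box a b))); last first.
  apply: le_lebesgue_outer => z /= zab; rewrite /closed_eball/=.
  rewrite (le_trans (enorm_le_entries (r := e) _))//.
    move=> i; have := zab i; rewrite /a /b !mxE ler_norml; lra.
  by rewrite /e mulrCA divff ?mulr1 ?pnatr_eq0.
apply: le_trans (box_volume_le_lebesgue _).
  rewrite lee_fin /box_volume (eq_bigr (fun=> 2 * r / d.+1%:R)).
    by rewrite prodr_const card_ord.
  by move=> i _; rewrite /a /b !mxE /e; ring.
by move=> i; rewrite /a /b !mxE; lra.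
Qed.

End positive_dimension.
End lebesgue_outer_measure_theory.

(** * Volume under linear maps *)

Section linear_images.
Context {R : realType} {d : nat}.
Local Notation n := d.+1.
Implicit Types (x y a b : 'cV[R]_n) (E : set 'cV[R]_n) (M N : 'M[R]_n).
Let leb := @lebesgue_outer_measure R n.

(** An upper bound in terms of outer measure: it holds for arbitrary sets, is stable under products
    of matrices, and can be checked on boxes. *)
Definition volume_scaling (c : R) M := forall E,
  (leb [set M *m x | x in E] <= c%:E * leb E)%E.

Lemma volume_scaling_boxes (c : R) M : 0 < c ->
  (forall a b, (forall i, a i 0 <= b i 0) ->
    (leb [set M *m x | x in box a b] <= (c * box_volume a b)%:E)%E) ->
  volume_scaling c M.
Proof.
move=> c0 h E; rewrite -lee_pdivrMl//.
apply: le_ereal_inf_tmp => _ [p [p0 pE] <-]; rewrite lee_pdivrMl//.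
rewrite -nneseriesZl; last by move=> k _; rewrite lee_fin box_volume_ge0.
apply: (@le_trans _ _ (\sum_(0 <= k <oo)
    leb [set M *m x | x in box (p k).1 (p k).2])%E).
  apply: le_trans (lebesgue_outer_sigma_subadditive _).
  apply: le_lebesgue_outer => _ [x /pE[k _ kx] <-].
  by exists k => //; exists x.
apply: lee_nneseries => k _; first by rewrite lebesgue_outer_ge0.
exact: h.
Qed.

Lemma volume_scalingM (c e : R) M N : 0 <= c -> volume_scaling c M ->
  volume_scaling e N -> volume_scaling (c * e) (M *m N).
Proof.
move=> c0 hM hN E.
have -> : [set (M *m N) *m x | x in E] =
    [set M *m y | y in [set N *m x | x in E]].
  apply/seteqP; split => z /=.
    by move=> [x Ex <-]; exists (N *m x); [exists x|rewrite mulmxA].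
  by move=> [_ [x Ex <-] <-]; exists x; rewrite // mulmxA.
apply: le_trans (hM _) _; rewrite EFinM -muleA.
by rewrite lee_wpmul2l ?lee_fin//; exact: hN.
Qed.

Lemma volume_scaling1 : volume_scaling 1 1%:M.
Proof.
move=> E; rewrite mul1e; apply: le_lebesgue_outer => _ [x Ex <-].
by rewrite mul1mx.
Qed.

Lemma le_of_all_slack (z : \bar R) (u v : R) : 0 <= v ->
  (forall e, 0 < e -> (z <= (u + e * v)%:E)%E) -> (z <= u%:E)%E.
Proof.
move=> v0 h; apply/lee_addgt0Pr => e e0.
have v1 : 0 < v + 1 by rewrite ltr_wpDl.
apply: le_trans (h (e / (v + 1)) _) _; first by rewrite divr_gt0.
rewrite -EFinD lee_fin lerD2l mulrAC ler_pdivrMr//; nra.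
Qed.

Lemma max_eq_min_dist (u v : R) : Num.max u v = Num.min u v + `|v - u|.
Proof.
by case: leP => h; [rewrite ger0_norm ?subr_ge0//|rewrite ltr0_norm ?subr_lt0//]; ring.
Qed.

Definition row_op (k : 'I_n) (v : 'I_n -> R) : 'M[R]_n :=
  \matrix_(i, j) if i == k then v j else (i == j)%:R.

Lemma row_op_mulmx p k v (N : 'M[R]_(n, p)) i j :
  (row_op k v *m N) i j = if i == k then \sum_l v l * N l j else N i j.
Proof.
rewrite mxE; case: eqP => [->|/eqP ik].
  by apply: eq_bigr => l _; rewrite mxE eqxx.
rewrite (bigD1 i)//= mxE (negPf ik) eqxx mul1r big1 ?addr0// => l li.
by rewrite mxE (negPf ik) eq_sym (negPf li) mul0r.
Qed.

Lemma volume_scaling_dilation k (c : R) : c != 0 ->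
  volume_scaling `|c| (row_op k (fun j => c * (j == k)%:R)).
Proof.
move=> c0; apply: volume_scaling_boxes; first by rewrite normr_gt0.
move=> a b ab.
pose rest := \prod_(i | i != k) (b i 0 - a i 0).
apply: (@le_of_all_slack _ _ rest).
  by apply: prodr_ge0 => i _; rewrite subr_ge0.
move=> e e0.
(* For negative [c] the image of a side is open at the wrong end. Lowering the left end by [e]
   repairs this and adds only [e * rest] to the volume. *)
pose a' := \col_i if i == k then Num.min (c * a k 0) (c * b k 0) - e else a i 0.
pose b' := \col_i if i == k then Num.max (c * a k 0) (c * b k 0) else b i 0.
have ab' i : a' i 0 <= b' i 0.
  rewrite !mxE; case: eqP => // _; rewrite lerBlDr ge_min; apply/orP; left.
  by rewrite -[leLHS]addr0 lerD ?(ltW e0)// le_max lexx.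
apply: (@le_trans _ _ (leb (box a' b'))).
  apply: le_lebesgue_outer => _ [x xab <-] i; rewrite row_op_mulmx !mxE.
  case: eqP => [_|_]; last exact: xab.
  rewrite (bigD1 k)//= eqxx mulr1 big1 ?addr0; last first.
    by move=> l lk; rewrite (negPf lk) mulr0 mul0r.
  have /andP[x1 x2] := xab k; have := ab k.
  rewrite ltrBlDr gt_min le_max.
  by have [c1 _|c1 _] := ltP c 0; apply/andP; split; apply/orP; nra.
apply: le_trans (lebesgue_outer_box_le ab') _; rewrite lee_fin.
rewrite /box_volume (bigD1 k)//= [in leRHS](bigD1 k)//= !mxE eqxx -/rest.
rewrite (eq_bigr (fun i => b i 0 - a i 0)); last first.
  by move=> i ik; rewrite !mxE (negPf ik).
rewrite -/rest mulrA -mulrDl ler_wpM2r//.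
  by apply: prodr_ge0 => i _; rewrite subr_ge0.
by rewrite max_eq_min_dist -mulrBr normrM [`|b k 0 - _|]ger0_norm ?subr_ge0//; lra.
Qed.

(** Cavalieri's principle by slabs: the box is cut across coordinate [m] into slabs of width [h].
    The sheared slab fits into a box that is longer by [|s| * h] in coordinate [k], and the total
    excess is of order [1 / N.+1]. *)
Lemma volume_scaling_transvection k m (s : R) : m != k ->
  volume_scaling 1 (row_op k (fun j => (j == k)%:R + s * (j == m)%:R)).
Proof.
move=> mk; apply: volume_scaling_boxes => // a b ab; rewrite mul1r.
pose rest := \prod_(i | (i != k) && (i != m)) (b i 0 - a i 0).
pose lk := b k 0 - a k 0; pose lm := b m 0 - a m 0.
have lk0 : 0 <= lk by rewrite subr_ge0.
have lm0 : 0 <= lm by rewrite subr_ge0.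
have rest0 : 0 <= rest by apply: prodr_ge0 => i _; rewrite subr_ge0.
apply: (@le_of_all_slack _ _ (`|s| * lm * lm * rest)).
  by rewrite !mulr_ge0.
move=> e e0.
pose N := Num.Def.truncn e^-1.
have Ne : N.+1%:R^-1 <= e.
  by rewrite invf_ple ?posrE//; apply: ltW; exact: truncnS_gt.
pose h := lm / N.+1%:R.
have h0 : 0 <= h by rewrite divr_ge0.
pose al (q : nat) := a m 0 + q%:R * h.
have als q : al q.+1 = al q + h by rewrite /al -natr1; ring.
pose a' (q : nat) : 'cV[R]_n := \col_i if i == m then al q else
  if i == k then a k 0 + Num.min (s * al q) (s * al q.+1) else a i 0.
pose b' (q : nat) : 'cV[R]_n := \col_i if i == m then al q.+1 else
  if i == k then b k 0 + Num.max (s * al q) (s * al q.+1) else b i 0.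
have minmax (u v : R) : Num.min u v <= Num.max u v.
  by rewrite ge_min le_max lexx.
have ab' q i : a' q i 0 <= b' q i 0.
  rewrite !mxE; case: eqP => _; first by rewrite als lerDl.
  by case: eqP => // _; rewrite lerD.
have vol q : box_volume (a' q) (b' q) = h * (lk + `|s| * h) * rest.
  rewrite /box_volume (bigD1 k)//= (bigD1 m)//= !mxE eqxx (negPf mk) eq_sym (negPf mk) eqxx.
  rewrite (eq_bigr (fun i => b i 0 - a i 0)); last first.
    by move=> i /andP[ik im]; rewrite !mxE (negPf ik) (negPf im).
  rewrite -/rest mulrA; congr (_ * _); rewrite mulrC; congr (_ * _).
    by rewrite als; ring.
  have -> : Num.max (s * al q) (s * al q.+1) =
      Num.min (s * al q) (s * al q.+1) + `|s| * h.
    rewrite max_eq_min_dist -mulrBr normrM (_ : al q.+1 - al q = h) ?(ger0_norm h0)//.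
    by rewrite als addrAC subrr add0r.
  by rewrite /lk; ring.
apply: (@le_trans _ _ (leb (\big[setU/set0]_(q < N.+1) box (a' q) (b' q)))).
  apply: le_lebesgue_outer => _ [x xab <-].
  have ex : exists q, x m 0 <= al q.+1.
    exists N; rewrite /al /h mulrCA divff ?mulr1 ?pnatr_eq0// /lm addrC subrK.
    by have /andP[] := xab m.
  case: (ex_minnP ex) => q q1 qmin.
  have qN : (q < N.+1)%N.
    rewrite ltnS; apply: qmin; rewrite /al /h mulrCA divff ?mulr1 ?pnatr_eq0//.
    by rewrite /lm addrC subrK; have /andP[] := xab m.
  have q0 : al q < x m 0.
    case: q q1 qmin {qN} => [|q] _ qmin.
      by rewrite /al mul0r addr0; have /andP[] := xab m.
    by rewrite ltNge; apply/negP => /qmin; rewrite ltnn.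
  rewrite -(bigcup_mkord N.+1 (fun q => box (a' q) (b' q))); exists q => // i.
  rewrite row_op_mulmx !mxE; case: (eqVneq i m) => [->|im].
    by rewrite (negPf mk) q0.
  case: eqP => [_|_]; last exact: xab.
  rewrite (bigD1 k)//= (bigD1 m)//= eqxx (negPf mk) eq_sym (negPf mk) eqxx big1; last first.
    by move=> l /andP[/negPf-> /negPf->]; rewrite mulr0 addr0 mul0r.
  have /andP[x1 x2] := xab k; rewrite mulr0 !addr0 mul1r add0r mulr1.
  apply/andP; split; [apply: ltr_leD => //|apply: lerD => //].
    rewrite ge_min; have [s0|s0] := leP 0 s; apply/orP; [left|right]; nra.
  rewrite le_max; have [s0|s0] := leP 0 s; apply/orP; [right|left]; nra.
apply: le_trans (outer_measure_subadditive (@lebesgue_outer_measure R n)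
  (fun q => box (a' q) (b' q)) N.+1) _.
apply: (@le_trans _ _ (\sum_(q < N.+1) (h * (lk + `|s| * h) * rest)%:E)%E).
  by apply: lee_sum => q _; rewrite -(vol q); exact: lebesgue_outer_box_le.
rewrite sumEFin lee_fin sumr_const card_ord -mulr_natl.
have -> : N.+1%:R * (h * (lk + `|s| * h) * rest) =
    lm * lk * rest + N.+1%:R^-1 * (`|s| * lm * lm * rest).
  rewrite /h; have : N.+1%:R != 0 :> R by rewrite pnatr_eq0.
  by move: (N.+1%:R : R) => Q Q0; field.
rewrite lerD// ?ler_wpM2r ?mulr_ge0//.
rewrite /box_volume [in leRHS](bigD1 k)//= [in leRHS](bigD1 m)//=.
by rewrite -/rest -/lm -/lk mulrA (mulrC lk).
Qed.

(** The entries of [v] off position [k] are cleared from the last one down, each by a transvection;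
    what remains is a dilation by [v k]. *)
Lemma volume_scaling_row_op k v : v k != 0 -> volume_scaling `|v k| (row_op k v).
Proof.
move=> vk0.
suff : forall m w, (forall j : 'I_n, (m <= j)%N -> j != k -> w j = 0) -> w k = v k ->
    volume_scaling `|v k| (row_op k w).
  by move=> h; apply: (h n) => // j; rewrite leqNgt ltn_ord.
elim=> [|m IH] w w0 wk.
  rewrite (_ : row_op k w = row_op k (fun j => v k * (j == k)%:R)).
    exact: volume_scaling_dilation.
  apply/matrixP => i j; rewrite !mxE; case: eqP => // _.
  case: (eqVneq j k) => [->|jk]; first by rewrite mulr1.
  by rewrite mulr0 w0.
have [mn|mn] := ltnP m n; last first.
  by apply: IH => // j mj jk; apply: w0 => //; have := ltn_ord j; lia.
pose o := Ordinal mn; have [ok|ok] := eqVneq o k.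
  apply: IH => // j mj jk; apply: w0 => //; rewrite ltn_neqAle mj andbT.
  by apply: contra_neqN jk => /eqP mj'; rewrite -ok; apply/val_inj.
pose u j := if j == o then 0 else w j.
have -> : row_op k w = row_op k u *m
    row_op k (fun j => (j == k)%:R + (w o / v k) * (j == o)%:R).
  apply/matrixP => i j; rewrite row_op_mulmx !mxE; case: eqP => // _.
  rewrite (bigD1 k)//= mxE eqxx /u eq_sym (negPf ok) wk.
  have -> : \sum_(l < n | l != k) (if l == o then 0 else w l) *
      row_op k (fun j => (j == k)%:R + w o / v k * (j == o)%:R) l j =
      \sum_(l < n | l != k) (if l == j then (if l == o then 0 else w l) else 0).
    apply: eq_bigr => l lk; rewrite mxE (negPf lk).
    by case: (l == j); rewrite ?mulr1 ?mulr0.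
  rewrite -big_mkcondr/=.
  case: (eqVneq j k) => [->|jk].
    rewrite eq_sym (negPf ok) mulr0 addr0 mulr1 big1 ?addr0 ?wk// => l /andP[lk /eqP].
    by move=> e; rewrite e eqxx in lk.
  rewrite add0r (big_pred1 j); last first.
    by move=> l /=; case: (eqVneq l j) => [->|_]; rewrite ?jk ?andbF// eqxx.
  case: eqP => [->|_]; last by rewrite !mulr0 add0r.
  by rewrite mulr1 addr0 mulrC divfK.
rewrite -[`|v k|]mulr1; apply: volume_scalingM => //.
  apply: IH; last by rewrite /u eq_sym (negPf ok).
  move=> j mj jk; rewrite /u; case: eqP => // /eqP jo; apply: w0 => //.
  by rewrite ltn_neqAle mj andbT; apply: contra_neqN jo => /eqP mj'; apply/val_inj.
exact: volume_scaling_transvection.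
Qed.

(** The ranking [rk] handles upper and lower triangular matrices together. The rows of [T] replace
    those of the identity in order of increasing rank, one row operation for each. *)
Lemma volume_scaling_triangular (rk : 'I_n -> nat) (T : 'M[R]_n) :
  injective rk -> (forall i j, (rk j < rk i)%N -> T i j = 0) ->
  (forall i, T i i != 0) -> volume_scaling `|\prod_i T i i| T.
Proof.
move=> rki T0 Td.
pose U m : 'M[R]_n := \matrix_(i, j) if (rk i < m)%N then T i j else (i == j)%:R.
have [B rkB] : exists B, forall i, (rk i < B)%N.
  exists (\max_i rk i).+1 => i; rewrite ltnS; exact: leq_bigmax.
suff h m : volume_scaling (\prod_(i | (rk i < m)%N) `|T i i|) (U m).
  have := h B; rewrite (_ : U B = T) ?normr_prod; last first.
    by apply/matrixP => i j; rewrite mxE rkB.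
  by under eq_bigl do rewrite rkB.
elim: m => [|m IH].
  rewrite big_pred0// (_ : U 0%N = 1%:M); first exact: volume_scaling1.
  by apply/matrixP => i j; rewrite !mxE.
case: (pickP (fun k => rk k == m)) => [k /eqP km|nok]; last first.
  have e i : (rk i < m.+1)%N = (rk i < m)%N.
    by rewrite ltnS leq_eqVlt nok.
  rewrite (eq_bigl (fun i => rk i < m)%N)// (_ : U m.+1 = U m)//.
  by apply/matrixP => i j; rewrite !mxE e.
have -> : U m.+1 = row_op k (T k) *m U m.
  apply/matrixP => i j; rewrite row_op_mulmx !mxE; case: (eqVneq i k) => [->|ik].
    rewrite km ltnSn (bigD1 j)//= mxE eqxx big1 ?addr0; last first.
      move=> l lj; rewrite mxE (negPf lj); case: ltnP => lm; last by rewrite mulr0.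
      by rewrite T0 ?mul0r// km.
    case: ltnP => jm; last by rewrite mulr1.
    by rewrite T0 ?mul0r// km.
  have -> // : (rk i < m.+1)%N = (rk i < m)%N.
  rewrite ltnS leq_eqVlt -km; case: eqP => // /rki e.
  by rewrite e eqxx in ik.
rewrite (bigD1 k)/= ?km ?ltnSn//.
rewrite (eq_bigl (fun i => rk i < m)%N); last first.
  move=> i; case: (eqVneq i k) => [->|ik]; first by rewrite km andbF ltnn.
  rewrite andbT ltnS leq_eqVlt -km; case: eqP => // /rki e.
  by rewrite e eqxx in ik.
by apply: volume_scalingM => //; exact: volume_scaling_row_op.
Qed.

Lemma volume_scaling_perm (s : 'S_n) : volume_scaling 1 (perm_mx s).
Proof.
have pE (x : 'cV[R]_n) i : (perm_mx s *m x) i 0 = x (s i) 0.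
  by rewrite -row_permE mxE.
apply: volume_scaling_boxes => // a b ab; rewrite mul1r.
pose a' := perm_mx s *m a; pose b' := perm_mx s *m b.
apply: (@le_trans _ _ (leb (box a' b'))).
  by apply: le_lebesgue_outer => _ [x xab <-] i; rewrite !pE.
apply: le_trans (lebesgue_outer_box_le _) _.
  by move=> i; rewrite !pE.
rewrite lee_fin /box_volume [leRHS](reindex_inj (@perm_inj _ s))/=.
by under eq_bigr do rewrite !pE.
Qed.

Lemma volume_scaling_det M : \det M != 0 -> volume_scaling `|\det M| M.
Proof.
move=> M0; have := cormen_lup_correct M.
have := cormen_lup_perm M; have := cormen_lup_detL M.
have := @cormen_lup_lower _ _ M; have := @cormen_lup_upper _ _ M.
case: (cormen_lup M) => -[P L] U /= Uup Llow Ldet /is_perm_mxP[s ->{P}] PM.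
have MLU : M = perm_mx s^-1 *m (L *m U).
  rewrite mulmxE -PM mulrA -mulmxE -perm_mxM (mulVg s) perm_mx1 mul1mx //.
have Ud : \det U = \prod_i U i i.
  rewrite -det_tr det_trig; first by apply: eq_bigr => i _; rewrite mxE.
  by apply/is_trig_mxP => i j ij; rewrite mxE Uup.
have dM : `|\det M| = `|\prod_i U i i|.
  by rewrite MLU !det_mulmx Ldet mul1r det_perm normrM normr_sign mul1r Ud.
have Ui i : U i i != 0.
  have : `|\prod_i U i i| != 0 by rewrite -dM normr_eq0.
  by rewrite normr_eq0 => /prodf_neq0; apply.
rewrite dM [in X in volume_scaling _ X]MLU -[`|_|]mul1r.
apply: volume_scalingM => //; first exact: volume_scaling_perm.
rewrite -[`|_|]mul1r; apply: volume_scalingM => //.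
  have L1 : \prod_i L i i = 1 by rewrite big1// => i _; rewrite Llow// eqxx.
  rewrite -[X in volume_scaling X](normr1 R) -L1.
  apply: (@volume_scaling_triangular (fun i => n - i)%N).
  - move=> i j /= e; apply: ord_inj; have := ltn_ord i; have := ltn_ord j; lia.
  - move=> i j ij; rewrite Llow; last by have := ltn_ord j; lia.
    by case: eqP => // ij'; rewrite ij' ltnn in ij.
  - by move=> i; rewrite Llow// eqxx oner_neq0.
by apply: (@volume_scaling_triangular (fun i => i : nat)) => // i j; exact: ord_inj.
Qed.

(** The ellipsoid is the image of a ball under the inverse matrix. This is how the determinant along
    a prefix enters the probability estimates in the non-conformal case. *)
Lemma volume_ellipsoid_le M (q : 'cV[R]_n) (r : R) : \det M != 0 -> 0 < r ->
  (leb [set p | (enorm (M *m p - q) <= r)%R]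
     <= ((4 * r) ^+ n / `|\det M|)%:E)%E.
Proof.
move=> M0 r0; have uM : M \in unitmx by rewrite unitmxE unitfE.
have iM0 : \det (invmx M) != 0 by rewrite det_inv invr_eq0.
apply: (@le_trans _ _ (leb [set invmx M *m x | x in closed_eball q r])).
  apply: le_lebesgue_outer => p /= pr; exists (M *m p) => //.
  by rewrite mulKmx.
apply: le_trans (volume_scaling_det iM0 _) _.
rewrite det_inv normrV ?unitfE// mulrC EFinM lee_wpmul2l ?lee_fin ?invr_ge0//.
exact: closed_ball_volume_le.
Qed.

End linear_images.

(** * A second moment inequality for balls *)

Section second_moment.
Context {disp : measure_display} {T : measurableType disp} {R : realType}.
Variable mu : {measure set T -> \bar R}.

(* Integrate 2 t k <= 1_(k > 0) + (t k)^2, where k counts the sets E i to which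
   a point belongs. *)
Lemma second_moment_le (I : Type) (s : seq I) (E : I -> set T) (U : set T) (t : R) :
  0 <= t -> (forall i, measurable (E i)) -> measurable U ->
  (forall i, E i `<=` U) ->
  ((2 * t)%:E * (\sum_(i <- s) mu (E i)) <=
     mu U + (t ^+ 2)%:E * (\sum_(i <- s) \sum_(j <- s) mu (E i `&` E j)))%E.
Proof.
move=> t0 mE mU EU.
have ind (A : set T) : measurable A -> measurable_fun setT (fun x => (\1_A x : R)%:E).
  by move=> mA; apply/measurable_EFinP; exact: measurable_indic.
have indi (A : set T) : measurable A -> mu A = (\int[mu]_x (\1_A x)%:E)%E.
  by move=> mA; rewrite integral_indic// setIT.
have mI i j : measurable (E i `&` E j) by exact: measurableI.
pose f x := ((2 * t)%:E * \sum_(i <- s) (\1_(E i) x)%:E)%E.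
pose g x := ((t ^+ 2)%:E * (\sum_(i <- s) \sum_(j <- s) (\1_(E i `&` E j) x)%:E))%E.
have mS : measurable_fun setT (fun x => \sum_(i <- s) (\1_(E i) x : R)%:E)%E.
  by apply: emeasurable_sum => i _; exact: ind.
have mSS i : measurable_fun setT
    (fun x => \sum_(j <- s) (\1_(E i `&` E j) x : R)%:E)%E.
  by apply: emeasurable_sum => j _; exact: ind.
have mSSS : measurable_fun setT
    (fun x => \sum_(i <- s) \sum_(j <- s) (\1_(E i `&` E j) x : R)%:E)%E.
  by apply: emeasurable_sum.
have ind0 (A : set T) x : (0 <= (\1_A x : R)%:E)%E by rewrite lee_fin.
have SS0 i x : (0 <= \sum_(j <- s) (\1_(E i `&` E j) x : R)%:E)%E.
  by apply: sume_ge0 => j _.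
have SSS0 x : (0 <= \sum_(i <- s) \sum_(j <- s) (\1_(E i `&` E j) x : R)%:E)%E.
  by apply: sume_ge0 => i _.
have -> : ((2 * t)%:E * (\sum_(i <- s) mu (E i)) = \int[mu]_x f x)%E.
  rewrite ge0_integralZl_EFin//; first last.
  - by rewrite mulr_ge0.
  - by move=> x _; apply: sume_ge0.
  rewrite ge0_integral_sum//; last by move=> i; exact: ind.
  by congr (_ * _)%E; apply: eq_bigr => i _; exact: indi.
have -> : (mu U + (t ^+ 2)%:E * (\sum_(i <- s) \sum_(j <- s) mu (E i `&` E j)) =
    \int[mu]_x ((\1_U x)%:E + g x))%E.
  rewrite ge0_integralD//; first last.
  - exact: measurable_funeM.
  - by move=> x _; rewrite mule_ge0// lee_fin sqr_ge0.
  - exact: ind.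
  rewrite -indi//; congr (_ + _)%E.
  rewrite ge0_integralZl_EFin//; last by rewrite sqr_ge0.
  rewrite ge0_integral_sum//; congr (_ * _)%E; apply: eq_bigr => i _.
  rewrite ge0_integral_sum//; last by move=> j; exact: ind.
  by apply: eq_bigr => j _; exact: indi.
apply: ge0_le_integral => //.
- by move=> x _; rewrite mule_ge0// ?lee_fin ?mulr_ge0//; apply: sume_ge0.
- exact: measurable_funeM.
- by apply: emeasurable_funD; [exact: ind|exact: measurable_funeM].
move=> x _; rewrite /f /g.
under [X in (_ <= _ + _ * X)%E]eq_bigr do rewrite sumEFin.
rewrite !sumEFin -!EFinM -EFinD lee_fin.
set k := \sum_(i <- s) _.
have -> : \sum_(i <- s) \sum_(j <- s) (\1_(E i `&` E j) x : R) = k * k.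
  rewrite /k mulr_suml; apply: eq_bigr => i _; rewrite mulr_sumr.
  by apply: eq_bigr => j _; rewrite indicI.
have [xU|xU] := boolP (x \in U); rewrite indicE ?xU ?(negPf xU).
  rewrite (_ : true%:R + _ = 2 * t * k + (t * k - 1) ^+ 2) ?lerDl ?sqr_ge0//.
  by rewrite (_ : true%:R = 1 :> R)//; ring.
rewrite (_ : k = 0) ?mulr0 ?addr0// /k big1// => i _; rewrite indicE.
case: (boolP (x \in E i)) => // /set_mem/EU/mem_set.
by rewrite (negPf xU).
Qed.

End second_moment.

Section separated_points.
Context {R : realType} {d : nat}.
Local Notation n := d.+1.
Implicit Types (L : seq 'cV[R]_n) (r sg : R).
Let leb := @lebesgue_outer_measure R n.
Local Notation leb_space := (caratheodory_type (@lebesgue_outer_measure R n)).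

Definition well_separated sg L := uniq L /\
  forall y y', y \in L -> y' \in L -> y != y' -> sg < enorm (y - y').

Definition balls_around L r : set 'cV[R]_n :=
  [set x | exists2 y, y \in L & enorm (x - y) <= r].

Lemma balls_around_bigcup L r :
  balls_around L r = \big[setU/set0]_(i < size L) closed_eball (nth 0 L i) r.
Proof.
rewrite -(bigcup_mkord _ (fun i => closed_eball (nth 0 L i) r)).
apply/seteqP; split => x /=.
  move=> [y yL xy]; exists (index y L); first by rewrite /= index_mem.
  by rewrite nth_index.
by move=> [i /= iL xi]; exists (nth 0 L i) => //; exact: mem_nth.
Qed.

Lemma measurable_balls_around L r : measurable (balls_around L r : set leb_space).
Proof.
rewrite balls_around_bigcup; apply: bigsetU_measurable => i _.
exact: closed_ball_caratheodory.
Qed.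

Lemma balls_around_volume_ge sg L r : 0 < r -> 2 * r <= sg -> well_separated sg L ->
  (((size L)%:R * (2 * r / n%:R) ^+ n)%:E <= leb (balls_around L r))%E.
Proof.
move=> r0 rs [uL sL]; rewrite balls_around_bigcup.
pose F (i : 'I_(size L)) : set leb_space := closed_eball (nth 0 L i) r.
have mF i : measurable (F i) by exact: closed_ball_caratheodory.
have -> : leb (\big[setU/set0]_(i < size L) closed_eball (nth 0 L i) r) =
    (\sum_(i < size L) leb (F i))%E.
  apply: (@measure_semi_additive_ord _ _ _ (@volume R d) _ F) => //.
    apply/trivIsetP => i j _ _ ij; apply/seteqP; split => // x [] /= xi xj.
    have : sg < enorm (nth 0 L i - nth 0 L j).
      by apply: sL; rewrite ?mem_nth// nth_uniq.
    have := enorm_dist_triangle (nth 0 L i) x (nth 0 L j).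
    rewrite (enormB _ x) => h; move: xi xj; rewrite /F /closed_eball/=; lra.
  by apply: bigsetU_measurable => i _; exact: mF.
rewrite mulr_natl -[in X in _ *+ X](card_ord (size L)) -sumr_const -sumEFin.
by apply: lee_sum => i _; exact: closed_ball_volume_ge.
Qed.

Lemma balls_around_volume_le L r : 0 < r ->
  (leb (balls_around L r) <= ((size L)%:R * (4 * r) ^+ n)%:E)%E.
Proof.
move=> r0; rewrite balls_around_bigcup.
apply: le_trans (outer_measure_subadditive (@lebesgue_outer_measure R n)
  (fun i => closed_eball (nth 0 L i) r) (size L)) _.
rewrite mulr_natl -[in X in _ *+ X](card_ord (size L)) -sumr_const -sumEFin.
by apply: lee_sum => i _; exact: closed_ball_volume_le.
Qed.

Lemma separated_filter sg L (P : pred 'cV[R]_n) :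
  well_separated sg L -> well_separated sg [seq y <- L | P y].
Proof.
move=> [uL sL]; split; first exact: filter_uniq.
by move=> y y'; rewrite !mem_filter => /andP[_ yL] /andP[_ y'L]; exact: sL.
Qed.

(** Packing: the balls of radius [sg / 2] around the points are disjoint and lie in the ball of
    radius [r + sg] around [y0]. *)
Lemma separated_size_le sg L (y0 : 'cV[R]_n) r : 0 < sg -> 0 <= r -> well_separated sg L ->
  (forall y, y \in L -> enorm (y - y0) <= r) ->
  (size L)%:R <= ((4 * n)%:R * (r / sg + 1)) ^+ n.
Proof.
move=> s0 r0 sL Lr; have h0 : 0 < sg / 2 by rewrite divr_gt0.
have := balls_around_volume_ge h0 _ sL.
rewrite mulrC divfK ?lexx// => /(_ isT) h1.
have : (leb (balls_around L (sg / 2)) <= ((4 * (r + sg)) ^+ n)%:E)%E.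
  apply: le_trans (closed_ball_volume_le y0 _); last by rewrite ltr_wpDl.
  apply: le_lebesgue_outer => x /= [y yL xy].
  have := enorm_dist_triangle x y y0; have := Lr _ yL; rewrite /closed_eball/=; lra.
move=> /(le_trans h1); rewrite lee_fin -ler_pdivlMr; last first.
  by rewrite exprn_gt0// divr_gt0.
move/le_trans; apply; rewrite -expr_div_n lerXn2r ?nnegrE//.
- by rewrite divr_ge0// ?mulr_ge0// ?addr_ge0// ?divr_ge0// ltW.
- by rewrite mulr_ge0// addr_ge0// divr_ge0// ltW.
rewrite le_eqVlt; apply/orP; left; apply/eqP; rewrite natrM; field.
by rewrite gt_eqF//= addrC natr1 pnatr_eq0.
Qed.

End separated_points.

Section powers.
Context {R : realType}.

Lemma powR_root_expr (d : nat) (x : R) : 0 <= x -> (x `^ (d.+1%:R^-1)) ^+ d.+1 = x.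
Proof.
by move=> x0; rewrite -powR_mulrn ?powR_ge0// -powRrM mulVf ?pnatr_eq0// powRr1.
Qed.

Lemma exprD_le_max d (u v : R) : 0 <= u -> 0 <= v ->
  (u + v) ^+ d <= 2 ^+ d * (u ^+ d + v ^+ d).
Proof.
move=> u0 v0; wlog uv : u v u0 v0 / u <= v => [h|].
  by case: (leP u v) => [|/ltW] uv; [exact: h|rewrite addrC [X in _ * X]addrC; exact: h].
apply: (@le_trans _ _ ((2 * v) ^+ d)).
  rewrite lerXn2r ?nnegrE ?addr_ge0 ?mulr_ge0//; lra.
by rewrite exprMn ler_wpM2l ?exprn_ge0// lerDr exprn_ge0.
Qed.

Lemma geometric_sum_le (c : R) (P : pred nat) N m : 0 < c < 1 ->
  \sum_(0 <= n < N | P n && (n <= m)%N) c ^+ (m - n) <= (1 - c)^-1.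
Proof.
move=> /andP[c0 c1]; have c1' : 0 < 1 - c by rewrite subr_gt0.
(* A stronger bound that passes through the induction on [N]; truncated subtraction freezes it once
   [N] exceeds [m]. *)
apply: (@le_trans _ _ (c ^+ (m.+1 - N) / (1 - c))); last first.
  by rewrite ler_piMl ?invr_ge0 ?exprn_ile1 ?ltW.
elim: N => [|N IH]; first by rewrite big_geq// divr_ge0 ?exprn_ge0 ?ltW.
rewrite big_mkcond big_nat_recr//= -big_mkcond/=.
have [Nm|Nm] := leqP N m; last first.
  rewrite andbF addr0; apply: le_trans IH _.
  have /eqP-> : (m.+1 - N)%N == 0%N by rewrite subn_eq0.
  have /eqP-> : (m.+1 - N.+1)%N == 0%N by rewrite subn_eq0 ltnW.
  exact: lexx.
apply: (@le_trans _ _ (c ^+ (m.+1 - N) / (1 - c) + c ^+ (m - N))).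
  by rewrite lerD//; case: ifP => // _; rewrite exprn_ge0// ltW.
rewrite subSS subSn// exprS le_eqVlt; apply/orP; left; apply/eqP.
by field; rewrite gt_eqF.
Qed.

End powers.

(** * Limsup sets of balls around separated points *)

Section limsup_balls.
Context {R : realType} {d : nat}.
Local Notation D := d.+1.
Let leb := @lebesgue_outer_measure R D.
Local Notation leb_space := (caratheodory_type (@lebesgue_outer_measure R D)).

Variables (c s kap th Kc R0 : R) (delta : nat -> R) (B : pred nat).
Variable Y : nat -> seq 'cV[R]_D.
Hypothesis c01 : 0 < c < 1.
Hypothesis s0 : 0 < s.
Hypothesis kap0 : 0 < kap.
Hypothesis th0 : 0 < th.
Hypothesis Kc0 : 0 < Kc.
Hypothesis delta0 : forall n, 0 < delta n.
Hypothesis deltaE : forall n, delta n ^+ D = c ^+ n.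
Hypothesis Ysep : forall n, B n -> well_separated (s * delta n) (Y n).
Hypothesis Ybnd : forall n y, B n -> y \in Y n -> enorm y <= R0.
Hypothesis Ylow : forall n, B n -> th <= (size (Y n))%:R * c ^+ n.
Hypothesis Yupp : forall n, B n -> (size (Y n))%:R * c ^+ n <= Kc.

Definition ball_radius (g : nat -> R) n := kap * delta n * g n `^ (D%:R^-1).

Definition level_balls (g : nat -> R) n := balls_around (Y n) (ball_radius g n).

Definition limsup_balls (g : nat -> R) : set 'cV[R]_D :=
  [set x | forall N, exists n, [/\ (N <= n)%N, B n & level_balls g n x]].

Let c0 : 0 < c. Proof. by case/andP: c01. Qed.

Lemma ball_radius_expr g n : 0 <= g n -> ball_radius g n ^+ D = kap ^+ D * c ^+ n * g n.
Proof. by move=> g0; rewrite !exprMn deltaE powR_root_expr. Qed.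

Section small_radii.
Variable g : nat -> R.
Hypothesis g0 : forall n, B n -> 0 < g n.
Hypothesis small : forall n, B n -> 4 * ball_radius g n <= s * delta n.
Hypothesis gdiv : forall N T, exists N', T <= \sum_(0 <= n < N' | (N <= n)%N && B n) g n.

Let rad := ball_radius g.
Let rad0 n : B n -> 0 < rad n.
Proof. by move=> Bn; rewrite /rad !mulr_gt0// powR_gt0// g0. Qed.

(** At most [Kc / c ^+ n] points at level n, times the packing number of the points of level m near
    one of them, times the volume [(4 * rad m) ^+ D] of a ball; [32 * D] is [8 * D] from packing
    times this 4. *)
Let C := Kc * (32 * D%:R * kap) ^+ D * ((kap / s) ^+ D + 2 ^+ D).
Let a := th * kap ^+ D * (2 / D%:R) ^+ D.

Let C0 : 0 < C.
Proof.
apply: mulr_gt0; last by apply: addr_gt0; apply: exprn_gt0 => //; exact: divr_gt0.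
by apply: mulr_gt0 => //; apply: exprn_gt0; rewrite !mulr_gt0.
Qed.

Let a0 : 0 < a.
Proof. by rewrite !mulr_gt0// exprn_gt0// divr_gt0. Qed.

Lemma level_balls_ge n : B n -> ((a * g n)%:E <= leb (level_balls g n))%E.
Proof.
move=> Bn; apply: le_trans (balls_around_volume_ge (rad0 Bn) _ (Ysep Bn)); last first.
  by have := small Bn; have := rad0 Bn; rewrite /rad; lra.
rewrite lee_fin (_ : 2 * rad n / D%:R = (2 / D%:R) * rad n); last by ring.
rewrite exprMn /rad (ball_radius_expr (ltW (g0 Bn))).
rewrite (_ : (size _)%:R * _ = (size (Y n))%:R * c ^+ n * (kap ^+ D * (2 / D%:R) ^+ D * g n)); last by ring.
rewrite /a (_ : th * _ * _ * _ = th * (kap ^+ D * (2 / D%:R) ^+ D * g n)); last by ring.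
apply: ler_wpM2r; last exact: Ylow.
rewrite mulr_ge0 ?(ltW (g0 Bn))// mulr_ge0 ?exprn_ge0 ?(ltW kap0)//.
Qed.

(** By packing, a ball of level n meets at most a multiple of [g n * c ^+ n / c ^+ m + 1] balls of
    level m. The first summand yields quasi-independence [g n * g m]; the second yields an error
    that decays geometrically in [m - n]. *)
Lemma level_ballsI_le n m : (n <= m)%N -> B n -> B m ->
  (leb (level_balls g n `&` level_balls g m)
     <= (C * (g n * g m + c ^+ (m - n) * g m))%:E)%E.
Proof.
move=> nm Bn Bm; pose sg := s * delta m.
have sg0 : 0 < sg by rewrite mulr_gt0.
pose L y := [seq y' <- Y m | enorm (y' - y) <= rad n + rad m].
pose F i := balls_around (L (nth 0 (Y n) i)) (rad m).
pose K := (8 * D%:R) ^+ D * ((kap / s) ^+ D * g n * (c ^+ n / c ^+ m) + 2 ^+ D).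
have rmsg : rad m / sg <= 4^-1.
  by rewrite ler_pdivrMr//; have := small Bm; rewrite -/rad -/sg; lra.
have LK y : (size (L y))%:R <= K.
  apply: le_trans (separated_size_le (y0 := y) (r := rad n + rad m) sg0 _ _ _) _.
  - by rewrite addr_ge0// ltW// rad0.
  - by apply: separated_filter; exact: Ysep.
  - by move=> y'; rewrite mem_filter => /andP[].
  apply: (@le_trans _ _ ((4 * D%:R * (rad n / sg + 2)) ^+ D)).
    rewrite lerXn2r ?nnegrE//.
    - by rewrite mulr_ge0// addr_ge0// divr_ge0 ?ltW// addr_gt0 ?rad0.
    - by rewrite mulr_ge0 ?mulr_ge0// addr_ge0// divr_ge0 ?ltW ?rad0.
    by rewrite natrM ler_wpM2l// mulrDl; lra.
  rewrite exprMn.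
  apply: le_trans (ler_wpM2l _ (exprD_le_max _ _ _)) _ => //.
    by apply: divr_ge0; apply: ltW => //; exact: rad0.
  rewrite mulrA -exprMn /K (_ : 4 * D%:R * 2 = 8 * D%:R); last by ring.
  rewrite ler_wpM2l ?exprn_ge0 ?mulr_ge0// lerD2r.
  rewrite expr_div_n (_ : sg ^+ D = s ^+ D * c ^+ m); last by rewrite exprMn deltaE.
  rewrite /rad (ball_radius_expr (ltW (g0 Bn))) expr_div_n le_eqVlt; apply/orP; left; apply/eqP.
  by field; rewrite !gt_eqF ?exprn_gt0.
have K0 : 0 <= K by apply: le_trans (LK 0).
apply: (@le_trans _ _ (leb (\big[setU/set0]_(i < size (Y n)) F i))).
  apply: le_lebesgue_outer => x [[y yn xy] [y' ym xy']].
  rewrite -(bigcup_mkord _ F); exists (index y (Y n)); first by rewrite /= index_mem.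
  rewrite /F nth_index//; exists y' => //; rewrite mem_filter ym andbT.
  apply: le_trans (enorm_dist_triangle _ x _) _.
  by rewrite enormB addrC lerD.
apply: le_trans (outer_measure_subadditive (@lebesgue_outer_measure R D) F _) _.
apply: (@le_trans _ _ (\sum_(i < size (Y n)) (K * (4 * rad m) ^+ D)%:E)%E).
  apply: lee_sum => i _; apply: le_trans (balls_around_volume_le _ (rad0 Bm)) _.
  by rewrite lee_fin ler_wpM2r// exprn_ge0// mulr_ge0// ltW// rad0.
rewrite sumEFin lee_fin sumr_const card_ord -(mulr_natl _ (size (Y n))).
have -> : c ^+ (m - n) = c ^+ m / c ^+ n.
  by rewrite -{2}(subnK nm) exprD mulfK// expf_neq0// gt_eqF.
rewrite exprMn /rad (ball_radius_expr (ltW (g0 Bm))).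
have := Yupp Bn; rewrite -ler_pdivlMr ?exprn_gt0// => Yu.
apply: le_trans (ler_wpM2r _ Yu) _.
  apply: mulr_ge0 => //; apply: mulr_ge0; first exact: exprn_ge0.
  apply: mulr_ge0; last exact: ltW (g0 Bm).
  by apply: mulr_ge0; apply: exprn_ge0; exact: ltW.
have cn0 : c ^+ n != 0 by rewrite expf_neq0// gt_eqF.
have cm0 : c ^+ m != 0 by rewrite expf_neq0// gt_eqF.
have X0 : 0 <= (kap / s) ^+ D by rewrite exprn_ge0// divr_ge0// ltW.
rewrite /K /C.
rewrite (_ : 32 * D%:R * kap = (8 * D%:R) * 4 * kap); last by ring.
move: X0; set X := (kap / s) ^+ D => X0; rewrite !exprMn.
set p := 8 ^+ D * _; set q : R := 4 ^+ D; set k := kap ^+ D.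
set z : R := 2 ^+ D.
have p0 : 0 <= p by rewrite mulr_ge0// exprn_ge0.
have z0 : 0 <= z by rewrite exprn_ge0.
have k0 : 0 <= k by rewrite exprn_ge0// ltW.
have q0 : 0 <= q by rewrite exprn_ge0.
have -> : Kc / c ^+ n * (p * (X * g n * (c ^+ n / c ^+ m) + z) * (q * (k * c ^+ m * g m))) =
   (Kc * p * q * k) * (X * (g n * g m) + z * (c ^+ m / c ^+ n * g m)).
  by field; rewrite cn0 cm0.
have -> : Kc * (p * q * k) * (X + z) * (g n * g m + c ^+ m / c ^+ n * g m) =
   (Kc * p * q * k) * ((X + z) * (g n * g m) + (X + z) * (c ^+ m / c ^+ n * g m)).
  by ring.
have gn0 := ltW (g0 Bn); have gm0 := ltW (g0 Bm).
have ccg : 0 <= c ^+ m / c ^+ n * g m.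
  by rewrite mulr_ge0// divr_ge0// exprn_ge0// ltW.
apply: ler_wpM2l; first by rewrite !mulr_ge0// ltW.
have ggm : 0 <= g n * g m by exact: mulr_ge0.
move: (g n * g m) (c ^+ m / c ^+ n * g m) ggm ccg => u v u0 v0.
rewrite -subr_ge0 (_ : _ - _ = z * u + X * v); last by ring.
by apply: addr_ge0; exact: mulr_ge0.
Qed.

Definition tail_balls g N : set 'cV[R]_D :=
  \bigcup_n (if (N <= n)%N && B n then level_balls g n else set0).

Lemma measurable_tail_balls N : measurable (tail_balls g N : set leb_space).
Proof.
apply: bigcupT_measurable => n; case: ifP => _; last exact: measurable0.
exact: measurable_balls_around.
Qed.

Let D0 := C * (1 + 2 / (1 - c)).

Let D00 : 0 < D0.
Proof.
apply: mulr_gt0 => //; apply: addr_gt0 => //; apply: divr_gt0 => //.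
by rewrite subr_gt0; case/andP: c01.
Qed.

Lemma tail_balls_ge N : ((a ^+ 2 / D0)%:E <= leb (tail_balls g N))%E.
Proof.
(* A partial sum of at least 1, so that [Sg <= Sg ^+ 2] and the geometric error is dominated by the
   main term. *)
have [N'] := gdiv N 1; set Sg := \sum_(_ <= _ < _ | _) _ => Sg1.
have Sg0 : 0 < Sg by apply: lt_le_trans Sg1.
pose sq := [seq n <- index_iota 0 N' | (N <= n)%N && B n].
have sqB n : n \in sq -> B n by rewrite mem_filter => /andP[/andP[]].
have SgE : Sg = \sum_(n <- sq) g n by rewrite big_filter.
pose E n := if (N <= n)%N && B n then level_balls g n else set0.
have mE n : measurable (E n : set leb_space).
  rewrite /E; case: ifP => _; last exact: measurable0.
  exact: measurable_balls_around.
have EU n : E n `<=` tail_balls g N by move=> x Enx; exists n.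
have EE n : n \in sq -> E n = level_balls g n.
  by rewrite mem_filter /E => /andP[->].
(* This value maximizes [2 * t * a * Sg - t ^+ 2 * D0 * Sg ^+ 2]; the maximum [a ^+ 2 / D0] does not
   depend on [N]. *)
pose t := a / (D0 * Sg).
have t0 : 0 <= t by apply: ltW; apply: divr_gt0 => //; exact: mulr_gt0.
have := second_moment_le (@volume R d) sq t0 mE (measurable_tail_balls N) EU.
rewrite /volume -/leb => h.
have h1 : (((2 * t) * (a * Sg))%:E <= (2 * t)%:E * (\sum_(i <- sq) leb (E i)))%E.
  rewrite (EFinM (2 * t)); apply: lee_wpmul2l; first by rewrite lee_fin mulr_ge0.
  rewrite SgE mulr_sumr -sumEFin.
  rewrite big_seq [in leRHS]big_seq; apply: lee_sum => n nsq.
  by rewrite EE//; apply: level_balls_ge; exact: sqB.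
(* The error for a pair in increasing order. Adding [w i j] and [w j i] makes the bound symmetric,
   at the cost of counting the diagonal twice. *)
pose w n m : R := if (n <= m)%N then c ^+ (m - n) * g m else 0.
have h2 : ((t ^+ 2)%:E * (\sum_(i <- sq) \sum_(j <- sq) leb (E i `&` E j)) <=
   (t ^+ 2 * (C * \sum_(i <- sq) \sum_(j <- sq) (g i * g j + w i j + w j i)))%:E)%E.
  rewrite (EFinM (t ^+ 2)); apply: lee_wpmul2l; first by rewrite lee_fin sqr_ge0.
  rewrite mulr_sumr -sumEFin.
  rewrite big_seq [in leRHS]big_seq; apply: lee_sum => i isq.
  rewrite mulr_sumr -sumEFin.
  rewrite big_seq [in leRHS]big_seq; apply: lee_sum => j jsq.
  rewrite !EE//; have Bi := sqB _ isq; have Bj := sqB _ jsq.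
  have w0 k l : B l -> 0 <= w k l.
    by move=> Bl; rewrite /w; case: ifP => // _; rewrite mulr_ge0 ?exprn_ge0 ?ltW ?g0.
  have [ij|/ltnW ji] := leqP i j.
    apply: le_trans (level_ballsI_le ij Bi Bj) _.
    by rewrite lee_fin ler_wpM2l ?(ltW C0)// /w ij lerDl w0.
  rewrite setIC; apply: le_trans (level_ballsI_le ji Bj Bi) _.
  by rewrite lee_fin ler_wpM2l ?(ltW C0)// [g j * _]mulrC [w j i]/w ji addrAC lerDl w0.
have wS : \sum_(i <- sq) \sum_(j <- sq) w i j <= Sg / (1 - c).
  rewrite exchange_big/= SgE mulr_suml big_seq [in leRHS]big_seq; apply: ler_sum => j jsq.
  have := geometric_sum_le (fun n => (N <= n)%N && B n) N' j c01.
  rewrite -big_filter_cond -/sq big_mkcond/= => gs.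
  rewrite (eq_bigr (fun i => g j * (if (i <= j)%N then c ^+ (j - i) else 0))); last first.
    by move=> i _; rewrite /w; case: ifP; rewrite ?mulr0// mulrC.
  by rewrite -mulr_sumr ler_wpM2l// ltW// g0// sqB.
have h3 : \sum_(i <- sq) \sum_(j <- sq) (g i * g j + w i j + w j i) <=
    Sg ^+ 2 * (1 + 2 / (1 - c)).
  have -> : \sum_(i <- sq) \sum_(j <- sq) (g i * g j + w i j + w j i) =
     Sg * Sg + \sum_(i <- sq) \sum_(j <- sq) w i j + \sum_(i <- sq) \sum_(j <- sq) w i j.
    rewrite [X in _ = _ + _ + X]exchange_big/= SgE mulr_suml -!big_split/=.
    apply: eq_bigr => i _; rewrite mulr_sumr -!big_split/=.
    by apply: eq_bigr => j _.
  have : Sg / (1 - c) <= Sg ^+ 2 / (1 - c).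
    rewrite ler_wpM2r//; first by rewrite invr_ge0 subr_ge0 ltW//; case/andP: c01.
    by rewrite expr2 ler_peMl// ltW.
  rewrite (_ : Sg ^+ 2 * (1 + 2 / (1 - c)) = Sg * Sg + Sg ^+ 2 / (1 - c) + Sg ^+ 2 / (1 - c)); last by ring.
  by move: wS; lra.
have h4 : t ^+ 2 * (C * \sum_(i <- sq) \sum_(j <- sq) (g i * g j + w i j + w j i)) <=
    a ^+ 2 / D0.
  apply: (@le_trans _ _ (t ^+ 2 * (C * (Sg ^+ 2 * (1 + 2 / (1 - c)))))).
    by rewrite ler_wpM2l ?sqr_ge0// ler_wpM2l// ltW.
  rewrite (_ : C * _ = Sg ^+ 2 * D0); last by rewrite /D0; ring.
  rewrite /t le_eqVlt; apply/orP; left; apply/eqP; field.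
  by rewrite !gt_eqF.
have h5 : (2 * t) * (a * Sg) = a ^+ 2 / D0 + a ^+ 2 / D0.
  by rewrite /t; field; rewrite !gt_eqF.
have := le_trans h1 (le_trans h (leeD (lexx _) h2)).
rewrite h5 EFinD => h6.
have h7 : ((a ^+ 2 / D0)%:E + (a ^+ 2 / D0)%:E <= leb (tail_balls g N) + (a ^+ 2 / D0)%:E)%E.
  by apply: le_trans h6 _; rewrite leeD2l// lee_fin.
by move: h7; rewrite leeD2rE.
Qed.

Lemma limsup_balls_small : (0 < leb (limsup_balls g))%E.
Proof.
have -> : limsup_balls g = \bigcap_N tail_balls g N.
  apply/seteqP; split => x.
    move=> h N _; have [n [Nn Bn xn]] := h N.
    by exists n => //; rewrite Nn Bn.
  move=> h N; have [n _] := h N I; case: ifP => // /andP[Nn Bn] xn.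
  by exists n.
have mT := measurable_tail_balls.
apply: (@lt_le_trans _ _ (a ^+ 2 / D0)%:E); first by rewrite lte_fin; apply: divr_gt0 => //; exact: exprn_gt0.
have cv := @nonincreasing_cvg_mu _ leb_space _ (@volume R d) (tail_balls g).
have -> : leb (\bigcap_N tail_balls g N) = lim ((@volume R d) \o tail_balls g @ \oo).
  apply/esym/cvg_lim => //; apply: cv => //.
  (* Continuity from above needs finite volume: the centres are bounded by [R0] and the radii by
     [s]. *)
  - apply: le_lt_trans (_ : _ <= leb (closed_eball 0 (`|R0| + s)))%E _.
      apply: le_lebesgue_outer => x [n _]; case: ifP => // /andP[_ Bn] [y yn xy].
      rewrite /closed_eball/= subr0 -(subrK y x).
      apply: le_trans (enormD _ _) _; rewrite addrC lerD//.
        by apply: le_trans (Ybnd Bn yn) _; exact: ler_norm.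
      apply: le_trans xy _.
      have d1 : delta n <= 1.
        rewrite -(ler_pXn2r (ltn0Sn d)) ?nnegrE ?ler01 ?(ltW (delta0 n))//.
        rewrite deltaE expr1n; apply: exprn_ile1; first exact: ltW.
        by case/andP: c01 => _ /ltW.
      have := small Bn; have := rad0 Bn; rewrite -/rad.
      have : s * delta n <= s by rewrite ler_piMr// ltW.
      lra.
    apply: le_lt_trans (closed_ball_volume_le _ _) (ltry _).
    by rewrite ltr_wpDl.
  - by apply: bigcapT_measurable => N; exact: mT.
  - apply/nonincreasing_seqP => N; apply/subsetPset => x [n _].
    by case: ifP => // /andP[Nn Bn] xn; exists n => //; rewrite Bn (ltnW Nn).
apply: lime_ge; last by apply: nearW => N; exact: tail_balls_ge.
apply: ereal_nonincreasing_is_cvgn => N M NM; apply: le_lebesgue_outer => x [n _].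
by case: ifP => // /andP[Nn Bn] xn; exists n => //; rewrite Bn (leq_trans NM Nn).
Qed.

End small_radii.

Section truncation.
Variable g : nat -> R.
Hypothesis g0 : forall n, 0 <= g n.
Hypothesis gdiv : forall T, exists N, T <= \sum_(0 <= n < N | B n) g n.

(** Either infinitely many terms are at least [G] and each contributes [G], or the truncation
    changes only finitely many terms. *)
Lemma divergent_tail_min (G : R) N T : 0 < G ->
  exists N', T <= \sum_(0 <= n < N' | (N <= n)%N && B n) Num.min (g n) G.
Proof.
move=> G0; have m0 n : 0 <= Num.min (g n) G by rewrite le_min g0 ltW.
have [inf|fin] := pselect (forall M, exists n, [/\ (M <= n)%N, B n & G <= g n]).
  have step k : exists N', k%:R * G <= \sum_(0 <= n < N' | (N <= n)%N && B n) Num.min (g n) G.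
    elim: k => [|k [N1 IH]]; first by exists 0%N; rewrite mul0r big_geq.
    have [n [nM Bn Gn]] := inf (maxn N N1); exists n.+1.
    have [Nn N1n] : (N <= n)%N /\ (N1 <= n)%N by apply/andP; rewrite -geq_max.
    rewrite big_mkcond big_nat_recr//= -big_mkcond/= Nn Bn/= (min_idPr Gn).
    rewrite -natr1 mulrDl mul1r lerD2r; apply: le_trans IH _.
    by rewrite [leRHS](big_cat_nat (n := N1))//= lerDl sumr_ge0.
  have [N' h] := step (Num.Def.truncn (T / G)).+1; exists N'.
  by apply: le_trans h; rewrite -ler_pdivrMr// ltW// truncnS_gt.
have [M hM] : exists M, forall n, (M <= n)%N -> B n -> g n < G.
  apply: contrapT => h; apply: fin => M; apply: contrapT => h2; apply: h.
  exists M => n Mn Bn; rewrite ltNge; apply/negP => Gn; apply: h2.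
  by exists n.
pose M' := maxn N M.
have [N' h] := gdiv (T + \sum_(0 <= n < M' | B n) g n); exists N'.
have : \sum_(0 <= n < N' | B n) g n <= \sum_(0 <= n < M' | B n) g n +
    \sum_(0 <= n < N' | (N <= n)%N && B n) Num.min (g n) G.
  have [N'M|/ltnW MN'] := leqP N' M'.
    by rewrite [X in _ <= X + _](big_cat_nat (n := N'))//= -addrA lerDl addr_ge0// sumr_ge0.
  rewrite (big_cat_nat (n := M'))//= lerD2l [leRHS](big_cat_nat (n := M'))//=.
  apply: le_trans (_ : _ <= \sum_(M' <= n < N' | (N <= n)%N && B n) Num.min (g n) G) _; last first.
    by rewrite lerDr sumr_ge0.
  rewrite le_eqVlt; apply/orP; left; apply/eqP.
  rewrite big_nat_cond [RHS]big_nat_cond; apply: congr_big => // n.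
    have [/andP[]|] := boolP (M' <= n < N')%N => //=.
    by rewrite geq_max => /andP[-> _].
  move=> /andP[/andP[]]; rewrite geq_max => /andP[_ Mn] _ Bn.
  by rewrite (min_idPl _)// ltW// hM.
by move: h; lra.
Qed.

End truncation.
End limsup_balls.

Section limsup_balls_positive.
Context {R : realType} {d : nat}.
Local Notation D := d.+1.

Theorem limsup_balls_positive (c s kap th Kc R0 : R) (delta : nat -> R) (B : pred nat)
    (Y : nat -> seq 'cV[R]_D) (g : nat -> R) :
  0 < c < 1 -> 0 < s -> 0 < kap -> 0 < th -> 0 < Kc ->
  (forall n, 0 < delta n) -> (forall n, delta n ^+ D = c ^+ n) ->
  (forall n, B n -> well_separated (s * delta n) (Y n)) ->
  (forall n y, B n -> y \in Y n -> enorm y <= R0) ->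
  (forall n, B n -> th <= (size (Y n))%:R * c ^+ n) ->
  (forall n, B n -> (size (Y n))%:R * c ^+ n <= Kc) ->
  (forall n, 0 <= g n) ->
  (forall T, exists N, T <= \sum_(0 <= n < N | B n) g n) ->
  (0 < @lebesgue_outer_measure R D (limsup_balls kap delta B Y g))%E.
Proof.
move=> c01 s0 kap0 th0 Kc0 delta0 deltaE Ysep Ybnd Ylow Yupp g0 gdiv.
(* At [g n = G] the radius is [s * delta n / 4]. Truncating [g] at [G] thus makes the balls of a
   level disjoint, and it can only shrink the limsup set. *)
pose G := (s / (4 * kap)) ^+ D.
have G0 : 0 < G by apply: exprn_gt0; apply: divr_gt0 => //; exact: mulr_gt0.
pose g' n := Num.min (g n) G.
(* The volume estimates ask for positive radii; levels with [g n = 0] contribute nothing to the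
   divergent sum. *)
pose B' n := B n && (0 < g n).
have g'0 n : 0 <= g' n by rewrite le_min g0 ltW.
have rad_le n : @ball_radius R d kap delta g' n <= @ball_radius R d kap delta g n.
  rewrite /ball_radius ler_wpM2l//; first by rewrite mulr_ge0 ?(ltW kap0) ?(ltW (delta0 n)).
  by apply: ge0_ler_powR; rewrite ?nnegrE// /g' ge_min lexx.
apply: lt_le_trans (_ : _ < lebesgue_outer_measure (limsup_balls kap delta B' Y g'))%E _; last first.
  apply: le_lebesgue_outer => x h N; have [n [Nn /andP[Bn _] [y yn xy]]] := h N.
  by exists n; split=> //; exists y => //; apply: le_trans xy _.
apply: (limsup_balls_small c01 s0 kap0 th0 Kc0 delta0 deltaE (R0 := R0)).
- by move=> n /andP[/Ysep].
- by move=> n y /andP[/Ybnd h _]; exact: h.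
- by move=> n /andP[/Ylow].
- by move=> n /andP[/Yupp].
- by move=> n /andP[_ gn]; rewrite /g' lt_min gn.
- move=> n _; rewrite /ball_radius.
  have : g' n `^ (D%:R^-1) <= s / (4 * kap).
    rewrite -(ler_pXn2r (ltn0Sn d)) ?nnegrE ?powR_ge0//; last first.
      by apply: divr_ge0; [exact: ltW|apply: mulr_ge0 => //; exact: ltW].
    by rewrite powR_root_expr// /g' ge_min lexx orbT.
  move=> h; apply: le_trans (_ : _ <= 4 * (kap * delta n * (s / (4 * kap)))) _.
    by rewrite ler_wpM2l// ler_wpM2l// mulr_ge0 ?(ltW kap0) ?(ltW (delta0 n)).
  rewrite le_eqVlt; apply/orP; left; apply/eqP; field.
  by rewrite gt_eqF.
- move=> N T; have [N' h] := divergent_tail_min g0 gdiv N T G0; exists N'.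
  apply: le_trans h _; rewrite le_eqVlt; apply/orP; left; apply/eqP.
  rewrite [RHS]big_mkcond [LHS]big_mkcond/=; apply: eq_bigr => n _.
  rewrite /B' andbA; case: ifP => //= _; case: ltP => // gn.
  have -> : g n = 0 by apply/eqP; rewrite eq_le gn g0.
  by rewrite (min_idPl _)// ltW.
Qed.

End limsup_balls_positive.

(** * Cylinder masses *)

Section word_sums.
Context {R : realType} {A : finType}.

(** Recursion on the first letter instead of a sum over tuples, so that [f] takes plain sequences
    and words can be cut and concatenated without casts. *)
Fixpoint word_sum (n : nat) (f : seq A -> R) : R :=
  if n is k.+1 then \sum_a word_sum k (fun t => f (a :: t)) else f [::].

Lemma eq_word_sum n f g : (forall s, size s = n -> f s = g s) ->
  word_sum n f = word_sum n g.
Proof.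
elim: n f g => [|n IH] f g fg /=; first exact: fg.
by apply: eq_bigr => a _; apply: IH => s sn; apply: fg; rewrite /= sn.
Qed.

Lemma le_word_sum n f g : (forall s, size s = n -> f s <= g s) ->
  word_sum n f <= word_sum n g.
Proof.
elim: n f g => [|n IH] f g fg /=; first exact: fg.
by apply: ler_sum => a _; apply: IH => s sn; apply: fg; rewrite /= sn.
Qed.

Lemma word_sum0 n : word_sum n (fun=> 0) = 0.
Proof. by elim: n => //= n IH; rewrite big1. Qed.

Lemma word_sum_ge0 n f : (forall s, 0 <= f s) -> 0 <= word_sum n f.
Proof. by move=> f0; rewrite -(word_sum0 n); exact: le_word_sum. Qed.

Lemma word_sumD n f g :
  word_sum n (fun s => f s + g s) = word_sum n f + word_sum n g.
Proof.
elim: n f g => //= n IH f g; rewrite -big_split/=.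
by apply: eq_bigr => a _; rewrite IH.
Qed.

Lemma word_sumZ n c f : word_sum n (fun s => c * f s) = c * word_sum n f.
Proof.
elim: n f => //= n IH f; rewrite mulr_sumr.
by apply: eq_bigr => a _; rewrite IH.
Qed.

Lemma word_sum_sum (I : Type) (r : seq I) (P : pred I) n (f : I -> seq A -> R) :
  word_sum n (fun s => \sum_(i <- r | P i) f i s) = \sum_(i <- r | P i) word_sum n (f i).
Proof.
elim: n f => //= n IH f; rewrite exchange_big/=.
by apply: eq_bigr => a _; rewrite IH.
Qed.

Lemma word_sum_cat k l f :
  word_sum (k + l) f = word_sum k (fun s => word_sum l (fun t => f (s ++ t))).
Proof. by elim: k f => //= k IH f; apply: eq_bigr => a _; rewrite IH. Qed.

Lemma sum_tuple_word_sum n (f : seq A -> R) :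
  \sum_(s : n.-tuple A) f s = word_sum n f.
Proof.
elim: n f => [|n IH] f /=.
  rewrite (big_pred1 [tuple]) => [//|t]; by rewrite [t]tuple0 /= eqxx.
under [RHS]eq_bigr do rewrite -IH.
rewrite pair_big/= (reindex (fun p : A * n.-tuple A => cons_tuple p.1 p.2))//=.
exists (fun t : n.+1.-tuple A => (thead t, behead_tuple t)) => [[a t] _|t _] /=.
  by congr pair; apply/val_inj.
by apply/val_inj; rewrite /= [in RHS](tuple_eta t).
Qed.

End word_sums.

Section finite_unions.
Context {disp : measure_display} {T : measurableType disp} {R : realType}.
Variable mu : {measure set T -> \bar R}.

Lemma measure_bigcup_fintype (I : finType) (F : I -> set T) :
  (forall i, measurable (F i)) -> (forall i j x, F i x -> F j x -> i = j) ->
  mu (\bigcup_i F i) = (\sum_i mu (F i))%E.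
Proof.
move=> mF dF; rewrite measure_fin_bigcup//=; first last.
- by apply/trivIsetP => i j _ _ ij; apply/seteqP; split => // x [/dF h /h e];
    rewrite e eqxx in ij.
rewrite fsbig_finite//=; apply: perm_big; apply: uniq_perm.
- exact: finmap.fset_uniq.
- exact: index_enum_uniq.
by move=> i; rewrite mem_index_enum in_fset_set; [exact: mem_set|exact: finite_finset].
Qed.

End finite_unions.

Section cylinder_masses.
Context {R : realType} {A : pointedFinType}.
Variable m : probability (symbolic_space A) R.
Implicit Types (s t : seq A) (u : nat -> A).
Local Notation mass := (cylinder_mass m).

Lemma measurable_cylinder s : measurable (cylinder s : set (symbolic_space A)).
Proof. by apply: sub_sigma_algebra; exists s. Qed.

Lemma mass_fin s : m (cylinder s) \is a fin_num.
Proof. by apply: fin_num_measure; exact: measurable_cylinder. Qed.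

Lemma massE s : m (cylinder s) = (mass s)%:E.
Proof. by rewrite /cylinder_mass fineK// mass_fin. Qed.

Lemma mass_ge0 s : 0 <= mass s.
Proof. by rewrite /cylinder_mass fine_ge0. Qed.

Lemma cylinder_nil : cylinder [::] = [set: nat -> A].
Proof. by apply/seteqP; split. Qed.

Lemma mass_nil : mass [::] = 1.
Proof. by rewrite /cylinder_mass cylinder_nil probability_setT. Qed.

Lemma cylinder_prefix s t : cylinder (s ++ t) `<=` cylinder s.
Proof.
move=> u; rewrite /cylinder/= size_cat => /(congr1 (take (size s))).
rewrite take_size_cat// => <-; rewrite /mkseq -map_take take_iota.
by rewrite (minn_idPl (leq_addr _ _)) size_map size_iota.
Qed.

Lemma mass_cat_le s t : mass (s ++ t) <= mass s.
Proof.
rewrite -lee_fin -!massE; apply: le_measure; rewrite ?inE; try exact: measurable_cylinder.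
exact: cylinder_prefix.
Qed.

Lemma mass_le1 s : mass s <= 1.
Proof. by rewrite -mass_nil; exact: (mass_cat_le [::]). Qed.

Lemma cylinder_disjoint s t u : size s = size t -> cylinder s u -> cylinder t u -> s = t.
Proof. by rewrite /cylinder/= => -> -> ->. Qed.

Lemma mass_rcons s : mass s = \sum_a mass (rcons s a).
Proof.
apply: EFin_inj; rewrite -sumEFin -massE.
under eq_bigr do rewrite -massE.
have -> : cylinder s = \bigcup_a cylinder (rcons s a).
  apply/seteqP; split => u /=.
    move=> us; exists (u (size s)) => //; rewrite /cylinder/= size_rcons mkseqS.
    by rewrite us.
  by move=> [a _]; rewrite -cats1 => /cylinder_prefix.
rewrite (measure_bigcup_fintype m)//= => [a|a b u ua ub]; first exact: measurable_cylinder.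
by have := cylinder_disjoint _ ua ub; rewrite !size_rcons => /(_ erefl) /rcons_inj[].
Qed.

Hypothesis minv : shift_invariant m.

(** Invariance enters the entropy estimate through this identity; [mass_rcons] is plain
    additivity. *)
Lemma mass_cons s : \sum_a mass (a :: s) = mass s.
Proof.
apply: EFin_inj; rewrite -sumEFin -massE.
under eq_bigr do rewrite -massE.
rewrite -minv; last exact: measurable_cylinder.
have -> : @Defs.shift A @^-1` cylinder s = \bigcup_a cylinder (a :: s).
  have e u : mkseq u (size s).+1 = u 0%N :: mkseq (Defs.shift u) (size s).
    rewrite /mkseq/= -[1%N]add1n iotaDl -map_comp; congr cons.
  apply/seteqP; split => u /=.
    by move=> us; exists (u 0%N) => //; rewrite /cylinder/= e us.
  by move=> [a _]; rewrite /cylinder/= e => -[].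
rewrite (measure_bigcup_fintype m)//= => [a|a b u ua ub]; first exact: measurable_cylinder.
by have := cylinder_disjoint _ ua ub; rewrite /= => /(_ erefl) [].
Qed.

Lemma word_sum_mass_cat s n : word_sum n (fun t => mass (s ++ t)) = mass s.
Proof.
elim: n s => [|n IH] s /=; first by rewrite cats0.
rewrite mass_rcons; apply: eq_bigr => a _; rewrite -IH.
by apply: eq_word_sum => t _; rewrite cat_rcons.
Qed.

Lemma word_sum_mass n : word_sum n mass = 1.
Proof. by rewrite -mass_nil -(word_sum_mass_cat [::] n). Qed.

Lemma word_sum_mass_behead n (f : seq A -> R) :
  word_sum n.+1 (fun s => mass s * f (behead s)) = word_sum n (fun s => mass s * f s).
Proof.
rewrite /= -word_sum_sum; apply: eq_word_sum => s _ /=.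
by rewrite -mulr_suml mass_cons.
Qed.

Lemma word_sum_mass_take n k (f : seq A -> R) : (k <= n)%N ->
  word_sum n (fun s => mass s * f (take k s)) = word_sum k (fun s => mass s * f s).
Proof.
move=> kn; rewrite -(subnKC kn) word_sum_cat; apply: eq_word_sum => s sk.
rewrite -[in RHS](word_sum_mass_cat s (n - k)) mulrC -word_sumZ.
by apply: eq_word_sum => t _; rewrite take_size_cat// mulrC.
Qed.

End cylinder_masses.

(** * Entropy of blocks *)

Section block_entropy.
Context {R : realType} {A : pointedFinType}.
Variable m : probability (symbolic_space A) R.
Hypothesis minv : shift_invariant m.
Implicit Types (s t : seq A) (u : nat -> A).
Local Notation mass := (cylinder_mass m).

Variables (lam : A -> R) (alpha e : R) (N0 K : nat).
Hypothesis lam0 : forall i, 0 <= lam i.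
Hypothesis alpha0 : 0 <= alpha.
Hypothesis e0 : 0 < e.
Hypothesis N0_gt0 : (0 < N0)%N.
Hypothesis N0_large : expR (- e) ^+ N0 / (1 - expR (- e)) <= 2^-1.

Definition weight s : R := \sum_(a <- s) lam a.

Lemma weight_cat s t : weight (s ++ t) = weight s + weight t.
Proof. by rewrite /weight big_cat. Qed.

Lemma weight_ge0 s : 0 <= weight s.
Proof. by apply: sumr_ge0. Qed.

(** A heavy word violates the decay wanted along typical sequences, up to the constant. *)
Definition heavy s : bool := expR (- (alpha * (size s)%:R + weight s)) <= mass s.

(** Only lengths from [N0] to [K] are tested. The lower limit makes the total weight of the block
    lengths small; the upper limit makes the test depend on [K] letters and is removed at the
    end. *)
Definition no_heavy_prefix s : bool :=
  ~~ has (fun k => (k <= size s)%N && heavy (take k s)) (iota N0 (K.+1 - N0)).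

Fixpoint count_no_heavy s : nat :=
  if s is a :: t then (no_heavy_prefix s + count_no_heavy t)%N else 0%N.

(* A subprobability on words: cut off either a uniform letter, or a block of
   length k distributed according to m. It charges every word that is mostly
   made of heavy blocks. *)
Fixpoint block_law (fuel : nat) s : R :=
  if fuel is f.+1 then
    if s is a :: t then
      (2 * #|A|%:R)^-1 * block_law f t +
      \sum_(k <- iota N0 (K.+1 - N0) | (k <= size s)%N)
        expR (- e) ^+ k * (mass (take k s) * block_law f (drop k s))
    else 1
  else (nilp s)%:R.

Let q := expR (- e).
Let q0 : 0 < q. Proof. exact: expR_gt0. Qed.
Let q1 : q < 1. Proof. by rewrite /q -expR0 ltr_expR oppr_lt0. Qed.
Let A0 : (0 : R) < #|A|%:R.
Proof. by rewrite ltr0n; apply/card_gt0P; exists point. Qed.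

Lemma block_law_ge0 f s : 0 <= block_law f s.
Proof.
elim: f s => [|f IH] [|a t] //=.
apply: addr_ge0; first by rewrite mulr_ge0// invr_ge0 mulr_ge0.
apply: sumr_ge0 => k _; apply: mulr_ge0; first by rewrite exprn_ge0// expR_ge0.
by apply: mulr_ge0 => //; exact: mass_ge0.
Qed.

Lemma iota_geometric_le : \sum_(k <- iota N0 (K.+1 - N0)) q ^+ k <= 2^-1.
Proof.
apply: le_trans N0_large; rewrite -/q.
suff h n : \sum_(k <- iota N0 n) q ^+ k <= (q ^+ N0 - q ^+ (N0 + n)) / (1 - q).
  apply: le_trans (h _) _; rewrite ler_wpM2r ?invr_ge0 ?subr_ge0 ?(ltW q1)//.
  by rewrite gerBl exprn_ge0// ltW.
elim: n => [|n IH]; first by rewrite addn0 subrr mul0r big_nil.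
rewrite -addn1 iotaD big_cat/= big_seq1; apply: le_trans (lerD IH (lexx _)) _.
rewrite addnA addn1 exprS le_eqVlt; apply/orP; left; apply/eqP; field.
by rewrite subr_eq0 gt_eqF.
Qed.

(** Each of the two alternatives receives at most half of the mass: the letters by the factor
    [2 * #|A|], the blocks by [N0_large]. *)
Lemma word_sum_block_law f n : word_sum n (block_law f) <= 1.
Proof.
elim: f n => [|f IH] [|n] //=.
  rewrite big1// => a _; rewrite (eq_word_sum (g := fun=> 0)) ?word_sum0//.
rewrite -word_sum_sum.
rewrite (eq_word_sum (g := fun t => (2^-1 * block_law f t) +
   \sum_a \sum_(k <- iota N0 (K.+1 - N0) | (k <= n.+1)%N)
     q ^+ k * (mass (take k (a :: t)) * block_law f (drop k (a :: t))))); last first.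
  move=> t tn; rewrite big_split/=; congr (_ + _).
    rewrite sumr_const -mulr_natl; field; by rewrite gt_eqF.
  by apply: eq_bigr => a _; rewrite tn.
rewrite word_sumD word_sumZ.
apply: (@le_trans _ _ (2^-1 + 2^-1)); last by lra.
apply: lerD; first by rewrite ler_piMr.
rewrite word_sum_sum.
apply: le_trans iota_geometric_le.
have -> : \sum_a word_sum n (fun t => \sum_(k <- iota N0 (K.+1 - N0) | (k <= n.+1)%N)
     q ^+ k * (mass (take k (a :: t)) * block_law f (drop k (a :: t)))) =
  word_sum n.+1 (fun s => \sum_(k <- iota N0 (K.+1 - N0) | (k <= n.+1)%N)
     q ^+ k * (mass (take k s) * block_law f (drop k s))) by [].
rewrite word_sum_sum big_mkcond; apply: ler_sum => k _; case: ifP => kn; last first.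
  by rewrite exprn_ge0// ltW.
rewrite word_sumZ ler_piMr ?exprn_ge0 ?(ltW q0)//.
rewrite -(subnKC kn) word_sum_cat.
rewrite (eq_word_sum (g := fun s => word_sum (n.+1 - k) (block_law f) * mass s)).
  rewrite word_sumZ word_sum_mass mulr1; exact: IH.
move=> s sk; rewrite mulrC -word_sumZ; apply: eq_word_sum => t _.
by rewrite take_size_cat// drop_size_cat.
Qed.

Let L := ln (2 * #|A|%:R : R).

(** Greedy parsing: cut off a heavy block where there is one, at cost [alpha + e] per letter plus
    its weight, and otherwise a single letter at cost [L]. The positions skipped inside blocks only
    lower the count. The fuel is there because [drop k s] is not a structural subterm. *)
Lemma block_law_ge f s : (size s <= f)%N ->
  expR (- ((alpha + e) * (size s)%:R + weight s + L * (count_no_heavy s)%:R))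
    <= block_law f s.
Proof.
have A1 : (1 : R) <= #|A|%:R by rewrite ler1n -(ltr0n R).
have L0 : 0 <= L by apply: ln_ge0; lra.
have ae0 : 0 <= alpha + e by rewrite addr_ge0// ltW.
have cdrop k t : (count_no_heavy (drop k t) <= count_no_heavy t)%N.
  elim: t k => [|a t IH] [|k] //=; apply: leq_trans (IH k) _.
  exact: leq_addl.
elim: f s => [|f IH] [|a t] // st.
- by rewrite /weight big_nil mulr0 mulr0 !addr0 oppr0 expR0.
- by rewrite /weight big_nil mulr0 mulr0 !addr0 oppr0 expR0.
have [bad|] := boolP (no_heavy_prefix (a :: t)).
  rewrite [count_no_heavy _]/= bad add1n [block_law _ _]/=.
  apply: (@le_trans _ _ ((2 * #|A|%:R)^-1 * block_law f t)); last first.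
    rewrite lerDl; apply: sumr_ge0 => k _; rewrite mulr_ge0 ?exprn_ge0 ?expR_ge0//.
    by apply: mulr_ge0; [exact: mass_ge0|exact: block_law_ge0].
  have -> : (2 * #|A|%:R)^-1 = expR (- L).
    by rewrite expRN lnK// posrE mulr_gt0.
  apply: (@le_trans _ _ (expR (- L) * expR (- ((alpha + e) * (size t)%:R + weight t + L * (count_no_heavy t)%:R)))); last first.
    by rewrite ler_wpM2l ?expR_ge0// IH.
  rewrite -expRD ler_expR /weight big_cons/= -!natr1.
  have := lam0 a; lra.
rewrite negbK => /hasP[k kN /andP[kst hk]].
rewrite [block_law _ _]/= -[in leRHS]/(size (a :: t)).
have k0 : (0 < k)%N by move: kN; rewrite mem_iota => /andP[h _]; exact: leq_trans h.
apply: (@le_trans _ _ (q ^+ k * (mass (take k (a :: t)) * block_law f (drop k (a :: t))))); last first.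
  apply: ler_wpDl; first by rewrite mulr_ge0 ?invr_ge0 ?mulr_ge0 ?block_law_ge0.
  rewrite big_mkcond (bigD1_seq k) ?iota_uniq// kst lerDl; apply: sumr_ge0 => j _.
  case: ifP => // _; rewrite mulr_ge0 ?exprn_ge0 ?expR_ge0//.
  by apply: mulr_ge0; [exact: mass_ge0|exact: block_law_ge0].
have sd : (size (drop k (a :: t)) <= f)%N.
  by rewrite size_drop/=; move: st => /=; lia.
apply: (@le_trans _ _ (q ^+ k * (expR (- (alpha * k%:R + weight (take k (a :: t)))) *
   expR (- ((alpha + e) * (size (drop k (a :: t)))%:R + weight (drop k (a :: t))
      + L * (count_no_heavy (drop k (a :: t)))%:R))))); last first.
  rewrite ler_wpM2l ?exprn_ge0 ?(ltW q0)// ler_pM ?expR_ge0//; last exact: IH.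
  by move: hk; rewrite /heavy size_takel.
rewrite /q -expRM_natl -!expRD ler_expR.
have hs : (size (a :: t))%:R = k%:R + (size (drop k (a :: t)))%:R :> R.
  by rewrite -natrD size_drop subnKC.
have hw : weight (a :: t) = weight (take k (a :: t)) + weight (drop k (a :: t)).
  by rewrite -weight_cat cat_take_drop.
have hc : L * (count_no_heavy (drop k (a :: t)))%:R <= L * (count_no_heavy (a :: t))%:R.
  by rewrite ler_wpM2l// ler_nat.
rewrite hs hw; move: hc; lra.
Qed.

Definition block_entropy n : R := word_sum n (fun s => - (mass s * ln (mass s))).

(** Gibbs' inequality: the entropy of [m] is at most its cross entropy relative to the
    subprobability [block_law]. Adding [mass s] on the left and [block_law n s] on the right makes
    the inequality hold word by word. *)
Lemma block_entropy_le_cost n : block_entropy n <=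
  word_sum n (fun s => mass s *
    ((alpha + e) * n%:R + weight s + L * (count_no_heavy s)%:R)).
Proof.
pose cost s := (alpha + e) * n%:R + weight s + L * (count_no_heavy s)%:R.
change (block_entropy n <= word_sum n (fun s => mass s * cost s)).
have h : word_sum n (fun s => - (mass s * ln (mass s)) + mass s) <=
    word_sum n (fun s => mass s * cost s + block_law n s).
  apply: le_word_sum => s sn.
  have [m0|m0] := leP (mass s) 0.
    have -> : mass s = 0 by apply/eqP; rewrite eq_le m0 mass_ge0.
    by rewrite !mul0r oppr0 !add0r block_law_ge0.
  have bl := @block_law_ge n s; rewrite sn leqnn in bl.
  have {}bl := bl isT.
  apply: le_trans (lerD (lexx _) bl).
  rewrite -/(cost s); set x := cost s.
  have := @expR_ge1Dx R (- x - ln (mass s)).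
  rewrite expRD expRN [expR (- ln _)]expRN lnK ?posrE// -expRN => h.
  have : mass s * (1 + (- x - ln (mass s))) <= expR (- x).
    by move: h; rewrite ler_pdivlMr// mulrC.
  lra.
move: h; rewrite !word_sumD (word_sum_mass m) /block_entropy.
have := word_sum_block_law n n; lra.
Qed.

Lemma word_sum_mass_weight n :
  word_sum n (fun s => mass s * weight s) = n%:R * \sum_a mass [:: a] * lam a.
Proof.
elim: n => [|n IH]; first by rewrite /= /weight big_nil mulr0 mul0r.
rewrite -natr1 mulrDl mul1r -IH addrC.
rewrite -(word_sum_mass_behead minv n weight).
rewrite [LHS]/= [X in _ = _ + X]/= -big_split/=; apply: eq_bigr => a _.
rewrite -(word_sum_mass_cat m [:: a] n) mulrC -word_sumZ -word_sumD.
apply: eq_word_sum => t _; rewrite /weight big_cons /=; ring.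
Qed.

Definition no_heavy_mass : R := word_sum K (fun s => mass s * (no_heavy_prefix s)%:R).

(** By invariance each position followed by enough letters fails the test with probability
    [no_heavy_mass]; the fewer than [K] positions near the end are counted as failures. The
    induction carries [minn n K] for these. *)
Lemma word_sum_mass_count n :
  word_sum n (fun s => mass s * (count_no_heavy s)%:R) <= K%:R + n%:R * no_heavy_mass.
Proof.
have nh0 : 0 <= no_heavy_mass.
  by apply: word_sum_ge0 => s; rewrite mulr_ge0// mass_ge0.
suff h : word_sum n (fun s => mass s * (count_no_heavy s)%:R) <=
    (minn n K)%:R + n%:R * no_heavy_mass.
  by apply: le_trans h _; rewrite lerD2r ler_nat geq_minr.
elim: n => [|n IH]; first by rewrite /= mulr0 min0n mul0r addr0.
rewrite (eq_word_sum (g := fun s => mass s * (no_heavy_prefix s)%:R +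
   mass s * (count_no_heavy (behead s))%:R)); last first.
  by case=> [//|a t] _; rewrite /= natrD mulrDr.
rewrite word_sumD (word_sum_mass_behead minv n (fun s => (count_no_heavy s)%:R)).
have [Kn|nK] := leqP K n.+1.
  have -> : word_sum n.+1 (fun s => mass s * (no_heavy_prefix s)%:R) = no_heavy_mass.
    rewrite /no_heavy_mass -(word_sum_mass_take m (fun s => (no_heavy_prefix s)%:R) Kn).
    apply: eq_word_sum => s sn; congr (_ * _%:R); congr (nat_of_bool (~~ _)).
    apply: eq_in_has => k; rewrite mem_iota => /andP[k1 k2].
    have kK : (k <= K)%N by move: k2; have := N0_gt0; lia.
    rewrite size_takel ?sn// kK (leq_trans kK Kn)/=.
    by rewrite take_takel.
  rewrite addrC; apply: le_trans (lerD IH (lexx _)) _.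
  rewrite -natr1 mulrDl mul1r addrA lerD2r lerD2r ler_nat.
  exact: geq_minr.
have h1 : word_sum n.+1 (fun s => mass s * (no_heavy_prefix s)%:R) <= 1.
  rewrite -[leRHS](word_sum_mass m n.+1); apply: le_word_sum => s _.
  by rewrite ler_piMr ?mass_ge0//; case: no_heavy_prefix.
rewrite addrC; apply: le_trans (lerD IH h1) _.
have -> : minn n K = n by apply/minn_idPl; lia.
rewrite -natr1 mulrDl; have := nh0; lra.
Qed.

Lemma block_entropy_le n : block_entropy n <=
  n%:R * (alpha + e + \sum_a mass [:: a] * lam a + L * no_heavy_mass) + L * K%:R.
Proof.
apply: le_trans (block_entropy_le_cost n) _.
have L0 : 0 <= L.
  apply: ln_ge0; have : (1 : R) <= #|A|%:R by rewrite ler1n -(ltr0n R).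
  lra.
rewrite (eq_word_sum (g := fun s => ((alpha + e) * n%:R) * mass s +
   (mass s * weight s + L * (mass s * (count_no_heavy s)%:R)))); last first.
  by move=> s _; ring.
rewrite word_sumD word_sumZ (word_sum_mass m) word_sumD word_sumZ word_sum_mass_weight.
have := ler_wpM2l L0 (word_sum_mass_count n); lra.
Qed.

End block_entropy.

(** * Typical sequences and level words *)

Lemma ae_imply (disp : measure_display) (T : measurableType disp) (R : realType)
    (mu : {measure set T -> \bar R}) (P Q : T -> Prop) :
  (forall x, P x -> Q x) -> {ae mu, forall x, P x} -> {ae mu, forall x, Q x}.
Proof.
move=> PQ [N [mN N0 PN]]; exists N; split => // x /= nQ; apply: PN => /= Px.
exact: nQ (PQ _ Px).
Qed.

Lemma ae_and (disp : measure_display) (T : measurableType disp) (R : realType)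
    (mu : {measure set T -> \bar R}) (P Q : T -> Prop) :
  {ae mu, forall x, P x} -> {ae mu, forall x, Q x} -> {ae mu, forall x, P x /\ Q x}.
Proof.
exact: filterI.
Qed.

Lemma measure_le_ae (disp : measure_display) (T : measurableType disp) (R : realType)
    (mu : {measure set T -> \bar R}) (P : T -> Prop) (E F : set T) :
  measurable E -> measurable F -> {ae mu, forall x, P x} ->
  (forall x, P x -> E x -> F x) -> (mu E <= mu F)%E.
Proof.
move=> mE mF [N [mN N0 PN]] EF; apply: (@le_trans _ _ (mu (F `|` N))).
  apply: le_measure; rewrite ?inE//; first exact: measurableU.
  move=> x Ex; have [Px|nPx] := pselect (P x); first by left; exact: EF.
  by right; exact: PN.
by rewrite measureU0.
Qed.

Section typical_sequences.
Context {R : realType} {A : pointedFinType}.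
Variable m : probability (symbolic_space A) R.
Hypothesis minv : shift_invariant m.
Implicit Types (s t : seq A) (u : nat -> A).
Local Notation mass := (cylinder_mass m).
Variable lam : A -> R.
Hypothesis lam0 : forall i, 0 <= lam i.

Lemma prefix_set_bigcup k (P : pred (seq A)) :
  [set u : symbolic_space A | P (mkseq u k)] =
  \bigcup_(t in [set: k.-tuple A]) (if P t then cylinder t else set0).
Proof.
apply/seteqP; split => u /=.
  move=> Pu; have sk : size (mkseq u k) == k by rewrite size_mkseq.
  exists (Tuple sk) => //=; rewrite Pu.
  by rewrite /cylinder/= size_mkseq.
move=> [t _]; case: ifP => // Pt; rewrite /cylinder/= size_tuple => ->.
exact: Pt.
Qed.

Lemma measurable_prefix_set k (P : pred (seq A)) :
  measurable [set u : symbolic_space A | P (mkseq u k)].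
Proof.
rewrite prefix_set_bigcup; apply: fin_bigcup_measurable => // t _.
by case: ifP => _; [exact: measurable_cylinder|exact: measurable0].
Qed.

Lemma measure_prefix_set k (P : pred (seq A)) :
  m [set u : symbolic_space A | P (mkseq u k)] =
  (word_sum k (fun s => mass s * (P s)%:R))%:E.
Proof.
rewrite prefix_set_bigcup (measure_bigcup_fintype m)/=; first last.
- move=> t t' u; case: ifP => // _ ut; case: ifP => // _ ut'.
  by apply/val_inj; apply: cylinder_disjoint ut ut'; rewrite !size_tuple.
- by move=> t; case: ifP => _; [exact: measurable_cylinder|exact: measurable0].
rewrite -sum_tuple_word_sum -sumEFin; apply: eq_bigr => t _.
case: (P t); first by rewrite mulr1 massE.
by rewrite mulr0 measure0.
Qed.

(** The value of [limn] on a divergent sequence is the default point, here 0, so a positive entropy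
    forces convergence. *)
Lemma entropy_cvg : 0 < entropy m ->
  (fun n => n%:R^-1 * block_entropy m n) @ \oo --> entropy m.
Proof.
pose v (k : nat) := - (k%:R^-1 * \sum_(s : k.-tuple A) mass s * ln (mass s)).
have vE : v = (fun n => n%:R^-1 * block_entropy m n).
  apply/funext => n; rewrite /v -mulrN -sumrN.
  by rewrite (sum_tuple_word_sum n (fun s => - (mass s * ln (mass s)))).
rewrite -vE /entropy -/v => h0; have [//|nc] := pselect (cvgn v).
exfalso; move: h0; have -> : limn v = point; last by rewrite ltxx.
by apply: xgetPN => l vl; apply: nc; exact: (@xgetI _ point (fun l : R => v @ \oo --> l) l vl).
Qed.

Definition typical_set (alpha C : R) : set (symbolic_space A) :=
  [set u | forall k, mass (mkseq u k) <=
     C * expR (- (alpha * k%:R + weight lam (mkseq u k)))].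

Lemma measurable_typical_set alpha C : measurable (typical_set alpha C).
Proof.
have -> : typical_set alpha C = \bigcap_k [set u : symbolic_space A |
   mass (mkseq u k) <= C * expR (- (alpha * k%:R + weight lam (mkseq u k)))].
  by apply/seteqP; split => u /= h; [move=> k _|move=> k]; apply: h.
apply: bigcapT_measurable => k.
exact: (measurable_prefix_set k (fun s => mass s <= C * expR (- (alpha * k%:R + weight lam s)))).
Qed.

Lemma exists_expr_lt (q eps : R) : 0 < q < 1 -> 0 < eps ->
  exists n, q ^+ n < eps.
Proof.
move=> /andP[q0 q1] eps0.
have /cvgrPdist_lt/(_ _ eps0)[n _ h] : (GRing.exp q) @ \oo --> (0 : R).
  by apply: cvg_expr; rewrite gtr0_norm.
exists n; have := h n (leqnn n).
by rewrite sub0r normrN gtr0_norm// exprn_gt0.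
Qed.

(** The bound of [block_entropy_le] is divided by [n]; the boundary term [L * K] disappears in the
    limit, so [K] is arbitrary. *)
Lemma no_heavy_mass_ge (alpha e : R) N0 K : 0 < e -> 0 <= alpha -> (0 < N0)%N ->
  expR (- e) ^+ N0 / (1 - expR (- e)) <= 2^-1 ->
  0 < entropy m ->
  entropy m <= alpha + e + (\sum_a mass [:: a] * lam a)
     + ln (2 * #|A|%:R) * no_heavy_mass m lam alpha N0 K.
Proof.
move=> e0 alpha0 N00 N0l h0.
set X := alpha + _ + _ + _.
rewrite leNgt; apply/negP => hX.
pose eps := (entropy m - X) / 2; have eps0 : 0 < eps by rewrite divr_gt0// subr_gt0.
set L := ln (2 * #|A|%:R) in X hX eps eps0 *.
have /cvgrPdist_lt/(_ _ eps0)[n1 _ h1] := entropy_cvg h0.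
pose n := maxn n1 (Num.Def.truncn (L * K%:R / eps)).+1.
have n0 : (0 < n)%N by rewrite leq_max orbT.
have hn : L * K%:R < n%:R * eps.
  rewrite -ltr_pdivrMr//; apply: lt_le_trans (truncnS_gt _) _.
  by rewrite ler_nat leq_maxr.
have := h1 n (leq_maxl _ _); rewrite ltr_norml => /andP[_ h2].
have h3 := block_entropy_le minv K lam0 alpha0 e0 N00 N0l n.
have {h2} : (entropy m - eps) * n%:R < block_entropy m n.
  rewrite -ltr_pdivlMr ?ltr0n// mulrC; lra.
have -> : entropy m - eps = X + eps by rewrite /eps; field.
rewrite mulrDl => h2; move: h3; rewrite -/L -/X => h3.
lra.
Qed.

(** A sequence without heavy prefixes is typical. The probability of having none of length up to [K]
    is bounded below uniformly in [K], hence so is that of the decreasing intersection. *)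
Lemma typical_set_positive : \sum_a mass [:: a] * lam a < entropy m ->
  exists alpha C, [/\ 0 < alpha, 0 < C & (0 < m (typical_set alpha C))%E].
Proof.
set lbar := \sum_a _ => hgt.
have lbar0 : 0 <= lbar by apply: sumr_ge0 => a _; rewrite mulr_ge0 ?mass_ge0.
(* The entropy surplus is [4 * e]; [alpha = 2 * e] and the block lengths use up [3 * e], and the
   last [e] forces [no_heavy_mass] to be at least [e / L]. *)
pose e := (entropy m - lbar) / 4; have e0 : 0 < e by rewrite divr_gt0// subr_gt0.
pose alpha := 2 * e; have alpha0 : 0 < alpha by rewrite mulr_gt0.
have h0 : 0 < entropy m by apply: le_lt_trans hgt.
pose q := expR (- e).
have q01 : 0 < q < 1 by rewrite expR_gt0 -expR0 ltr_expR oppr_lt0.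
have [N hN] : exists n, q ^+ n < (1 - q) / 2.
  by apply: exists_expr_lt => //; rewrite divr_gt0// subr_gt0; case/andP: q01.
have N0l : expR (- e) ^+ N.+1 / (1 - expR (- e)) <= 2^-1.
  rewrite -/q ler_pdivrMr ?subr_gt0; last by case/andP: q01.
  rewrite exprS mulrC; apply: le_trans (_ : _ <= q ^+ N * 1) _.
    by rewrite ler_wpM2l ?exprn_ge0 ?ltW//; case/andP: q01 => // _ /ltW.
  by rewrite mulr1 mulrC ltW.
pose L : R := ln (2 * #|A|%:R).
have A1 : (1 : R) <= #|A|%:R by rewrite ler1n; apply/card_gt0P; exists point.
have L0 : 0 < L by apply: ln_gt0; lra.
have nh K : e / L <= no_heavy_mass m lam alpha N.+1 K.
  have := no_heavy_mass_ge K e0 (ltW alpha0) (ltn0Sn N) N0l h0.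
  rewrite -/lbar -/L => h; rewrite ler_pdivrMr// mulrC.
  have : entropy m = lbar + 4 * e by rewrite /e; field.
  move: h; rewrite /alpha; lra.
pose S K := [set u : symbolic_space A | no_heavy_prefix m lam alpha N.+1 K (mkseq u K)].
have mS K : measurable (S K) by exact: measurable_prefix_set.
have SE K : m (S K) = (no_heavy_mass m lam alpha N.+1 K)%:E.
  by rewrite /S measure_prefix_set.
have heavyP u k K : no_heavy_prefix m lam alpha N.+1 K (mkseq u K) ->
    (N.+1 <= k <= K)%N -> ~~ heavy m lam alpha (mkseq u k).
  move=> + /andP[Nk kK]; apply: contraNN => hk; apply/hasP; exists k.
    by rewrite mem_iota Nk; lia.
  rewrite size_mkseq kK /mkseq -map_take take_iota (minn_idPl kK).
  exact: hk.
pose Lm := \sum_a lam a.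
have Lm0 : 0 <= Lm by exact: sumr_ge0.
(* The constant absorbs the prefixes shorter than [N.+1], which are not tested: there the mass is at
   most 1 and the weight at most [k * Lm]. *)
exists alpha, (expR ((alpha + Lm) * N.+1%:R)); split => //; first exact: expR_gt0.
apply: (@lt_le_trans _ _ (m (\bigcap_K S K))); last first.
  apply: le_measure; rewrite ?inE.
  - by apply: bigcapT_measurable => K; exact: mS.
  - exact: measurable_typical_set.
  move=> u Su k; set s := mkseq u k.
  have CN : 1 <= expR ((alpha + Lm) * N.+1%:R).
    by rewrite -[leLHS]expR0 ler_expR mulr_ge0// addr_ge0// ltW.
  have [kN|Nk] := ltnP k N.+1.
    apply: le_trans (mass_le1 _ _) _; rewrite -expRD -[leLHS]expR0 ler_expR.
    have ws : weight lam s <= k%:R * Lm.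
      have -> : k%:R * Lm = \sum_(a <- s) Lm.
        by rewrite big_const_seq count_predT size_mkseq iter_addr addr0 mulr_natl.
      apply: ler_sum => a _; rewrite /Lm (bigD1 a)//= lerDl.
      exact: sumr_ge0.
    have kN' : k%:R * (alpha + Lm) <= N.+1%:R * (alpha + Lm).
      by rewrite ler_wpM2r ?ler_nat ?(ltnW kN)// addr_ge0// ltW.
    lra.
  have := heavyP u k k (Su k I); rewrite Nk leqnn => /(_ isT).
  rewrite /heavy -ltNge size_mkseq -/s => /ltW h; apply: le_trans h _.
  by rewrite ler_peMl// expR_ge0.
have SM K K' : (K <= K')%N -> S K' `<=` S K.
  move=> KK' u Su; rewrite /S/= /no_heavy_prefix; apply/hasPn => k.
  rewrite mem_iota => /andP[Nk kK]; rewrite negb_and size_mkseq.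
  have kK2 : (k <= K)%N by lia.
  have := heavyP u k K' Su; rewrite Nk (leq_trans kK2 KK') => /(_ isT) h.
  rewrite kK2/= /mkseq -map_take take_iota (minn_idPl kK2); exact: h.
have cv : m \o S @ \oo --> m (\bigcap_K S K).
  apply: nonincreasing_cvg_mu => //.
  - by apply: le_lt_trans (probability_le1 m (mS _)) (ltry 1).
  - by apply: bigcapT_measurable => K; exact: mS.
  - by apply/nonincreasing_seqP => K; apply/subsetPset; exact: SM.
apply: (@lt_le_trans _ _ (e / L)%:E); first by rewrite lte_fin divr_gt0.
have <- := cvg_lim _ cv => //.
apply: lime_ge; first by apply/cvg_ex; eexists; exact: cv.
by apply: nearW => K; move: (nh K); rewrite -lee_fin -SE.
Qed.

End typical_sequences.

Section level_words.
Context {R : realType} {A : pointedFinType}.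
Variable m : probability (symbolic_space A) R.
Hypothesis m_slow : slowly_decaying m.
Implicit Types (s t v : seq A) (u : nat -> A) (a : word A).
Local Notation mass := (cylinder_mass m).
Local Notation c := (decay_constant m).

Lemma ae_decay_ebound : {ae m, forall u, forall k, (0 < k)%N ->
  (decay_ebound m <= (mass (mkseq u k.+1) / mass (mkseq u k))%:E)%E}.
Proof.
have := ess_inf_le m (fun u : symbolic_space A =>
    ereal_inf [set (mass (mkseq u k.+1) / mass (mkseq u k))%:E
              | k in [set k : nat | (0 < k)%N]]).
apply: filterS => u /= h k k0; apply: le_trans h _.
by apply: ereal_inf_lbound; exists k.
Qed.

Lemma mass_mkseqS_le u k : mass (mkseq u k.+1) <= mass (mkseq u k).
Proof. by rewrite mkseqS -cats1 mass_cat_le. Qed.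

(** The essential infimum is finite, since off a null set it is bounded by the ratio of two real
    masses; so [fine] loses nothing. *)
Lemma decay_constantE : (c%:E = decay_ebound m)%E.
Proof.
rewrite /decay_constant fineK// ge0_fin_numE; last exact: ltW m_slow.
have [N [mN N0 Nh]] := ae_decay_ebound.
have [u uN] : exists u, ~ N u.
  apply: contrapT => /forallNP h; have : m [set: symbolic_space A] = 0%E.
    rewrite -N0; congr (m _); apply/seteqP; split => // u _.
    exact: contrapT (h u).
  by rewrite probability_setT => /eqP; rewrite onee_eq0.
have hu : (forall k, (0 < k)%N ->
    (decay_ebound m <= (mass (mkseq u k.+1) / mass (mkseq u k))%:E)%E).
  by apply: contrapT => h; apply: uN; apply: Nh.
exact: le_lt_trans (hu 1%N isT) (ltry _).
Qed.

Lemma decay_constant_gt0 : 0 < c.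
Proof. by rewrite -lte_fin decay_constantE. Qed.

Lemma ae_mass_decay : {ae m, forall u, forall k, (0 < k)%N ->
  c * mass (mkseq u k) <= mass (mkseq u k.+1)}.
Proof.
apply: ae_imply ae_decay_ebound => u h k k0.
have := h k k0; rewrite -decay_constantE lee_fin.
have [->|m0] := eqVneq (mass (mkseq u k)) 0.
  by rewrite mulr0 mass_ge0.
by rewrite ler_pdivlMr// lt_def m0 mass_ge0.
Qed.

Lemma ae_mass_gt0 : {ae m, forall u, forall k, 0 < mass (mkseq u k)}.
Proof.
exists (\bigcup_k [set u : symbolic_space A | mass (mkseq u k) == 0]); split.
- by apply: bigcupT_measurable => k; exact: (measurable_prefix_set k (fun s => mass s == 0)).
- apply/eqP; rewrite eq_le measure_ge0 andbT.
  apply: le_trans (measure_sigma_subadditive _ _ _ _) _.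
  + by move=> k; exact: (measurable_prefix_set k (fun s => mass s == 0)).
  + by apply: bigcupT_measurable => k; exact: (measurable_prefix_set k (fun s => mass s == 0)).
  + exact: subset_refl.
  rewrite eseries0// => k _ _ /=.
  have := measure_prefix_set m k (fun s => mass s == 0); rewrite /= => ->.
  rewrite (eq_word_sum (g := fun=> 0)) ?word_sum0// => s _.
  by case: eqP => [->|_]; rewrite ?mul0r ?mulr0.
move=> u /= /existsNP[k h]; exists k => //=; apply/eqP/le_anti.
by rewrite mass_ge0 andbT leNgt; apply/negP.
Qed.

Lemma belast_takeE a : belast a.1 a.2 = take (size a.2) (word_seq a).
Proof.
case: a => x s; rewrite /word_seq/= lastI -cats1 take_size_cat//.
by rewrite size_belast.
Qed.

Lemma take_mkseq u k n : (k <= n)%N -> take k (mkseq u n) = mkseq u k.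
Proof. by move=> kn; rewrite /mkseq -map_take take_iota (minn_idPl kn). Qed.

Lemma cylinder_mkseq u s : cylinder s u -> mkseq u (size s) = s.
Proof. by []. Qed.

(** If [a] were a proper prefix of [b], then [b] without its last letter would have mass at most
    that of [a], hence at most [c ^+ n]. *)
Lemma level_words_antichain n a b u : level_words m n a -> level_words m n b ->
  cylinder (word_seq a) u -> cylinder (word_seq b) u -> a = b.
Proof.
wlog ab : a b / (size (word_seq a) <= size (word_seq b))%N => [h|].
  by case: (leqP (size (word_seq a)) (size (word_seq b))) => [|/ltnW] ab la lb ua ub;
    [exact: h|apply/esym; exact: h].
move=> /andP[la _] /andP[_ lb] ua ub.
have tab : take (size (word_seq a)) (word_seq b) = word_seq a.
  by rewrite -(cylinder_mkseq ub) take_mkseq// (cylinder_mkseq ua).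
move: ab; rewrite leq_eqVlt => /predU1P[eab|ab].
  move: tab; rewrite eab take_size; case: a b {la lb ua ub eab} => [x s] [y t].
  by rewrite /word_seq/= => -[-> ->].
have : mass (belast b.1 b.2) <= mass (word_seq a).
  rewrite belast_takeE -tab.
  have -> : take (size b.2) (word_seq b) = take (size (word_seq a)) (word_seq b) ++
     drop (size (word_seq a)) (take (size b.2) (word_seq b)).
    by rewrite -{1}(cat_take_drop (size (word_seq a)) (take (size b.2) _)) take_takel.
  exact: mass_cat_le.
by move=> /(lt_le_trans lb) /(le_lt_trans la); rewrite ltxx.
Qed.

(** The cylinders are disjoint, by the antichain property, and lie in the cylinder of [v]. *)
Lemma level_words_mass_sum n (r : seq (word A)) v : uniq r ->
  (forall a, a \in r -> level_words m n a) ->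
  \sum_(a <- r | prefix v (word_seq a)) mass (word_seq a) <= mass v.
Proof.
move=> ur lr; rewrite -big_filter; set r' := [seq a <- r | _].
have ur' : uniq r' by exact: filter_uniq.
pose a0 : word A := (point, [::]).
pose F (i : 'I_(size r')) : set (symbolic_space A) := cylinder (word_seq (nth a0 r' i)).
have r'P (i : 'I_(size r')) : (nth a0 r' i \in r) && prefix v (word_seq (nth a0 r' i)).
  by have := mem_nth a0 (ltn_ord i); rewrite mem_filter andbC.
rewrite (big_nth a0) big_mkord -lee_fin -sumEFin -massE.
rewrite (eq_bigr (fun i => m (F i))) => [|i _]; last by rewrite /F massE.
rewrite -(measure_bigcup_fintype m); first last.
- move=> i j u ui uj; have /andP[ri _] := r'P i; have /andP[rj _] := r'P j.
  have := level_words_antichain (lr _ ri) (lr _ rj) ui uj.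
  by move=> /eqP; rewrite nth_uniq// => /eqP/val_inj.
- by move=> i; exact: measurable_cylinder.
apply: le_measure; rewrite ?inE.
- by apply: fin_bigcup_measurable => // i _; exact: measurable_cylinder.
- exact: measurable_cylinder.
move=> u [i _]; rewrite /F; have /andP[_ /prefixP[t ->]] := r'P i.
exact: cylinder_prefix.
Qed.

Section level_selection.
Variables (lam : A -> R) (alpha C : R).
Hypothesis lam0 : forall i, 0 <= lam i.
Hypothesis alpha0 : 0 < alpha.
Hypothesis C0 : 0 < C.
Hypothesis typ0 : (0 < m (typical_set m lam alpha C))%E.

Definition typical_word s := forall k, (k <= size s)%N ->
  mass (take k s) <= C * expR (- (alpha * k%:R + weight lam (take k s))).

Definition regular_sequences : set (symbolic_space A) :=
  [set u | [/\ typical_set m lam alpha C u, forall k, 0 < mass (mkseq u k) &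
    forall k, (0 < k)%N -> c * mass (mkseq u k) <= mass (mkseq u k.+1)]].

(** Almost every typical sequence is regular. Stating this for measurable supersets fits its use:
    with the empty set for existence, and with a union of cylinders for the total mass. *)
Lemma exists_regular_cover (E : set (symbolic_space A)) : measurable E ->
  regular_sequences `<=` E -> (m (typical_set m lam alpha C) <= m E)%E.
Proof.
move=> mE rE.
apply: (measure_le_ae (measurable_typical_set m lam alpha C) mE
  (ae_and ae_mass_gt0 ae_mass_decay)) => u [h1 h2] tu.
by apply: rE; split.
Qed.

Lemma exists_regular : exists u, regular_sequences u.
Proof.
apply: contrapT => /forallNP h.
have := @exists_regular_cover set0 measurable0 (fun u ru => h u ru).
by rewrite measure0 leNgt typ0.
Qed.

Lemma regular_mass_small u eps : typical_set m lam alpha C u -> 0 < eps ->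
  exists k, mass (mkseq u k) < eps.
Proof.
move=> tu eps0; have [n hn] : exists n, expR (- alpha) ^+ n < eps / C.
  apply: exists_expr_lt; last exact: divr_gt0.
  by rewrite expR_gt0 -[ltRHS]expR0 ltr_expR oppr_lt0.
exists n; apply: le_lt_trans (tu n) _; rewrite mulrC -ltr_pdivlMr//.
apply: le_lt_trans hn; rewrite -expRM_natl ler_expR.
have := weight_ge0 lam0 (mkseq u n); lra.
Qed.

(** Otherwise the masses along a regular sequence would stop decreasing after the first letter,
    while typicality makes them tend to 0. *)
Lemma decay_constant_lt1 : c < 1.
Proof.
rewrite ltNge; apply/negP => c1.
have [u [tu u0 uc]] := exists_regular.
have [k hk] := regular_mass_small tu (u0 1%N).
have h n : mass (mkseq u 1) <= mass (mkseq u n.+1).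
  elim: n => [//|n IH]; apply: le_trans IH _; apply: le_trans (uc n.+1 isT).
  by rewrite ler_peMl// mass_ge0.
have : mass (mkseq u 1) < mass (mkseq u 1).
  apply: le_lt_trans hk; case: k => [|k]; last exact: h.
  exact: mass_mkseqS_le.
by rewrite ltxx.
Qed.

(** The decay constant controls the ratios from length 1 on; the ratio of a first letter to the
    empty word is bounded separately. *)
Lemma exists_letter_mass_bound : exists2 c1, 0 < c1 &
  forall i, 0 < mass [:: i] -> c1 <= mass [:: i].
Proof.
exists (\big[Num.min/1]_(i | 0 < mass [:: i]) mass [:: i]).
  by elim/big_ind: _ => // x y x0 y0; rewrite lt_min x0.
by move=> i i0; rewrite (bigD1 i)//= ge_min lexx.
Qed.

Lemma exists_level_selection : exists (c1 th : R) (W : nat -> seq (word A)),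
  [/\ 0 < c1, 0 < th & forall n, (0 < n)%N ->
   [/\ uniq (W n),
       forall a, a \in W n -> [/\ level_words m n a,
         c1 * c ^+ n <= mass (word_seq a) & typical_word (word_seq a)],
       th <= \sum_(a <- W n) mass (word_seq a) &
       forall v, \sum_(a <- W n | prefix v (word_seq a)) mass (word_seq a) <= mass v]].
Proof.
have [c1 c10 c1P] := exists_letter_mass_bound.
pose c2 := Num.min c1 c; have c20 : 0 < c2 by rewrite lt_min c10 decay_constant_gt0.
pose G n : set (word A) := [set a | [/\ level_words m n a,
   c2 * c ^+ n <= mass (word_seq a) & typical_word (word_seq a)]].
have cn0 n : 0 < c ^+ n by rewrite exprn_gt0// decay_constant_gt0.
(* Many distinct words of mass at least [c2 * c ^+ n] would exceed total mass 1. *)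
have finG n : finite_set (G n).
  apply: contrapT => inf.
  have [B BG Bn] := infinite_set_fset (Num.Def.truncn (c2 * c ^+ n)^-1).+1 inf.
  have h1 : \sum_(a <- finmap.enum_fset B) mass (word_seq a) <= 1.
    rewrite -(mass_nil m) (eq_bigl (fun a => prefix [::] (word_seq a))) => [|a]; last by rewrite prefix0s.
    by apply: (@level_words_mass_sum n); [exact: finmap.fset_uniq|move=> a /BG []].
  have h2 : (size (finmap.enum_fset B))%:R * (c2 * c ^+ n) <= \sum_(a <- finmap.enum_fset B) mass (word_seq a).
    have -> : (size (finmap.enum_fset B))%:R * (c2 * c ^+ n) = \sum_(a <- finmap.enum_fset B) (c2 * c ^+ n).
      by rewrite big_const_seq count_predT iter_addr addr0 mulr_natl.
    by rewrite big_seq [leRHS]big_seq; apply: ler_sum => a /BG [].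
  have h3 : 1 < (size (finmap.enum_fset B))%:R * (c2 * c ^+ n).
    rewrite -ltr_pdivrMr ?mulr_gt0// div1r; apply: lt_le_trans (truncnS_gt _) _.
    by rewrite ler_nat.
  by have := lt_le_trans h3 (le_trans h2 h1); rewrite ltxx.
pose fs n : seq (word A) := finmap.enum_fset (fset_set (G n)).
have thfin : m (typical_set m lam alpha C) \is a fin_num.
  by apply: fin_num_measure; exact: measurable_typical_set.
exists c2, (fine (m (typical_set m lam alpha C))), fs; split => //.
  by apply: fine_gt0; rewrite typ0/= ltey_eq thfin.
move=> n n0.
have WG a : a \in fs n -> G n a by rewrite /fs in_fset_set// inE.
split.
- exact: finmap.fset_uniq.
- exact: WG.
- rewrite -lee_fin fineK// -sumEFin.
  rewrite (eq_bigr (fun a => m (cylinder (word_seq a)))) => [|a _]; last by rewrite massE.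
  apply: (@le_trans _ _ (m (\big[setU/set0]_(a <- fs n) cylinder (word_seq a)))); last first.
    elim: (fs n) => [|a r IH]; first by rewrite !big_nil measure0.
    rewrite !big_cons; apply: le_trans (measureU2 _ _ _) _.
    + exact: measurable_cylinder.
    + by apply: bigsetU_measurable => b _; exact: measurable_cylinder.
    by rewrite leeD2l.
  apply: exists_regular_cover.
    by apply: bigsetU_measurable => b _; exact: measurable_cylinder.
  move=> u [tu u0 uc].
  (* The shortest prefix of mass at most [c ^+ n] is a word of level n. It is nonempty because
     [c ^+ n < 1], and its last ratio is bounded below by [c2]. *)
  have [|k kn kmin] := @ex_minnP (fun k => mass (mkseq u k) <= c ^+ n).
    by have [k /ltW hk] := regular_mass_small tu (cn0 n); exists k.
  have k0 : (0 < k)%N.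
    rewrite lt0n; apply: contraTneq kn => ->; rewrite -ltNge mass_nil.
    by rewrite exprn_ilt1 ?decay_constant_lt1 ?(ltW decay_constant_gt0)// -lt0n.
  case: k k0 kn kmin => // k _ kn kmin.
  pose a : word A := (u 0%N, [seq u i | i <- iota 1 k]).
  have aE : word_seq a = mkseq u k.+1 by [].
  have sa : size a.2 = k by rewrite /= size_map size_iota.
  have lt_k : c ^+ n < mass (mkseq u k).
    by rewrite ltNge; apply/negP => /kmin; rewrite ltnn.
  suff Ga : G n a.
    have : a \in fs n by rewrite /fs in_fset_set// inE.
    elim: (fs n) => [//|b r IH]; rewrite in_cons big_cons.
    move=> /predU1P[<-|/IH h]; [left|by right].
    by rewrite aE /cylinder/= size_map size_iota.
  split.
  + apply/andP; split; first by rewrite aE.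
    by rewrite belast_takeE sa aE take_mkseq.
  + rewrite aE; case: k kn kmin a aE sa lt_k => [|k] kn kmin a aE sa lt_k.
      apply: le_trans (c1P _ (u0 1%N)).
      apply: le_trans (_ : _ <= c1 * 1) _; last by rewrite mulr1.
      apply: ler_pM => //; [exact: ltW|exact: ltW|by rewrite ge_min lexx|].
      by apply: exprn_ile1; [exact: ltW decay_constant_gt0|exact: ltW decay_constant_lt1].
    apply: le_trans (uc k.+1 isT); apply: ler_pM; [exact: ltW|exact: ltW| |exact: ltW].
    by rewrite ge_min lexx orbT.
  + rewrite aE => j; rewrite size_mkseq => jk; rewrite take_mkseq//.
- by move=> v; apply: (@level_words_mass_sum n); [exact: finmap.fset_uniq|move=> a /WG []].
Qed.

End level_selection.
End level_words.

(** * Resampling one coordinate *)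

Section product_law.
Context {R : realType} {A : pointedFinType} {d : nat}.
Variable S : rifs R A d.
Variable eta : probability (family_space R A d) R.
Hypothesis eta_product : is_product_law S eta.
Local Notation Fam := (family_space R A d).
Local Notation Mat := (borel_mx R d).
Implicit Types (w : Fam) (a : word A) (B : Mat).

Lemma measurable_family_coord a : measurable_fun [set: Fam] (fun w : Fam => w a : Mat).
Proof.
move=> _ E mE; apply: sub_sigma_algebra; exists a => //.
by exists E => //; rewrite setTI.
Qed.

Lemma measurable_into_family (disp : measure_display) (X : measurableType disp)
    (f : X -> Fam) :
  (forall a, measurable_fun [set: X] (fun x => f x a : Mat)) ->
  measurable_fun [set: X] f.
Proof.
move=> mf; apply: (@measurability _ _ _ _ _ f (\bigcup_(a in [set: word A])
  preimage_set_system [set: word A -> Mat] (fun w => w a) measurable)) => //.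
move=> _ [_ [a _ [E mE <-]] <-].
by rewrite !setTI; have := mf a measurableT E mE; rewrite setTI.
Qed.

Definition resample a w B : Fam := fun b => if b == a then B else w b.

Definition resample_pair a (p : Fam * Mat) : Fam := resample a p.1 p.2.

Lemma measurable_resample_pair a :
  measurable_fun [set: Fam * Mat] (resample_pair a).
Proof.
apply: measurable_into_family => b; rewrite /resample_pair /resample.
case: eqP => _; first exact: measurable_snd.
by apply: (measurableT_comp (measurable_family_coord b)); exact: measurable_fst.
Qed.

HB.instance Definition _ a := @isMeasurableFun.Build _ _ _ _
  (resample_pair a) (measurable_resample_pair a).

Definition rectangle (s : seq (word A)) (B : word A -> set Mat) : set Fam :=
  [set w | forall a, a \in s -> B a (w a)].

Definition rectangles : set (set Fam) :=
  [set E | exists (s : seq (word A)) (B : word A -> set Mat), (forall a, measurable (B a)) /\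
     E = rectangle s B].

Lemma measurable_rectangle (s : seq (word A)) (B : word A -> set Mat) :
  (forall a, measurable (B a)) ->
  measurable (rectangle s B).
Proof.
move=> mB; elim: s => [|a s IH].
  have -> : rectangle [::] B = setT by apply/seteqP; split.
  exact: measurableT.
have -> : rectangle (a :: s) B = ((fun w : Fam => w a) @^-1` B a) `&` rectangle s B; last first.
  apply: measurableI => //; rewrite -[X in measurable X]setTI.
  exact: measurable_family_coord.
apply/seteqP; split => w /=.
  move=> h; split; first by apply: h; rewrite mem_head.
  by move=> b bs; apply: h; rewrite in_cons bs orbT.
by move=> [ha hs] b; rewrite in_cons => /predU1P[->//|]; exact: hs.
Qed.

Lemma rectanglesI : setI_closed rectangles.
Proof.
move=> _ _ [s1 [B1 [m1 ->]]] [s2 [B2 [m2 ->]]].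
exists (s1 ++ s2), (fun a => (if a \in s1 then B1 a else setT) `&`
                    (if a \in s2 then B2 a else setT)); split.
  by move=> a; apply: measurableI; case: ifP.
apply/seteqP; split => w /=.
  by move=> [h1 h2] a _; split; case: ifP => // ha; [exact: h1|exact: h2].
move=> h; split => a ha.
  by have := h a; rewrite mem_cat ha => /(_ isT) [].
by have := h a; rewrite mem_cat ha orbT => /(_ isT) [].
Qed.

Lemma measurable_familyE : (@measurable _ Fam) = <<s rectangles >>.
Proof.
apply/seteqP; split; apply: smallest_sub => //; try exact: smallest_sigma_algebra.
  move=> _ [a _ [E mE <-]]; apply: sub_sigma_algebra.
  exists [:: a], (fun=> E); split => //; rewrite setTI.
  by apply/seteqP; split => w /=; [move=> h b; rewrite inE => /eqP->|apply; rewrite inE].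
by move=> _ [s [B [mB ->]]]; exact: measurable_rectangle.
Qed.

Lemma product_law_rectangle (s : seq (word A)) (B : word A -> set Mat) :
  (forall a, measurable (B a)) ->
  eta (rectangle s B) =
  (\prod_(a <- undup s) rifs_law S (last_letter a) (B a))%E.
Proof.
move=> mB; rewrite -(eta_product (undup_uniq s) mB); congr (eta _).
by apply/seteqP; split => w /= h a; have := h a; rewrite mem_undup.
Qed.

(** An independent copy of one coordinate does not change the law: both sides agree on the
    rectangles, a pi-system that generates the sigma-algebra. *)
Lemma resample_law a (E : set Fam) : measurable E ->
  eta E = pushforward (eta \x rifs_law S (last_letter a))%E (resample_pair a) E.
Proof.
move=> mE; apply: (measure_unique rectangles (fun=> setT)) => //.
- exact: measurable_familyE.
- exact: rectanglesI.
- move=> _; exists [::], (fun=> setT); split => //.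
  by apply/seteqP; split.
- by rewrite bigcup_const.
- move=> _ [s [B [mB ->]]]; rewrite /pushforward.
  etransitivity; first exact: product_law_rectangle.
  pose Ba := if a \in s then B a else setT.
  change ((\prod_(b <- undup s) rifs_law S (last_letter b) (B b))%E =
    (eta \x rifs_law S (last_letter a))%E (resample_pair a @^-1` rectangle s B)).
  rewrite (_ : resample_pair a @^-1` _ =
     rectangle (rem a (undup s)) B `*` Ba); last first.
    apply/seteqP; split => -[w M] /=.
      move=> h; split.
        move=> b; rewrite (rem_filter _ (undup_uniq s)) mem_filter mem_undup => /andP[/= ba bs].
        by have := h b bs; rewrite /resample_pair/resample/= (negPf ba).
      rewrite /Ba; case: ifP => // sa.
      by have := h a sa; rewrite /resample_pair/resample/= eqxx.
    move=> [h1 h2] b bs; rewrite /resample_pair/resample/=; case: eqP => [ba|/eqP ba].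
      by move: h2; rewrite /Ba -ba bs.
    by apply: h1; rewrite (rem_filter _ (undup_uniq s)) mem_filter mem_undup bs/= andbT.
  have mBa : measurable Ba by rewrite /Ba; case: ifP.
  apply/esym; etransitivity; first by apply: product_measure1E; first exact: measurable_rectangle.
  transitivity ((\prod_(b <- rem a (undup s)) rifs_law S (last_letter b) (B b)) *
      rifs_law S (last_letter a) Ba)%E.
    congr (_ * _)%E; etransitivity; first exact: product_law_rectangle.
    by rewrite undup_id// rem_uniq// undup_uniq.
  rewrite /Ba; have [sa|sa] := boolP (a \in s).
    by rewrite [RHS](big_rem a) ?mem_undup//= muleC.
  by rewrite probability_setT mule1 rem_id ?mem_undup.
- by move=> _; apply: le_lt_trans (probability_le1 eta measurableT) (ltry 1).
Qed.

Definition slice a (E : set Fam) w : set Mat := [set B | E (resample a w B)].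

Lemma measurable_slice a (E : set Fam) w : measurable E -> measurable (slice a E w).
Proof.
move=> mE; have : measurable_fun [set: Mat] (fun B => resample a w B).
  apply: measurable_into_family => b; rewrite /resample.
  by case: eqP => _; [exact: measurable_id|exact: measurable_cst].
by move=> /(_ measurableT E mE); rewrite setTI.
Qed.

Lemma law_slice a (E : set Fam) : measurable E ->
  eta E = (\int[eta]_w rifs_law S (last_letter a) (slice a E w))%E.
Proof.
move=> mE; rewrite (resample_law a mE) /pushforward.
(* The product measure is by definition the integral of the measures of the sections. *)
change ((\int[eta]_w rifs_law S (last_letter a) (xsection (resample_pair a @^-1` E) w))%E = 
  (\int[eta]_w rifs_law S (last_letter a) (slice a E w))%E).
apply: eq_integral => w _; congr (rifs_law _ _ _).
by apply/seteqP; split => B; rewrite xsectionE/=.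
Qed.

(* Off the product set, the slice of E is empty or equal to the slice at a
   point of the product set. *)
Lemma law_le_of_slices a (E : set Fam) (K : R) : measurable E -> 0 <= K ->
  E `<=` rifs_product_set S ->
  (forall w, rifs_product_set S w ->
     (rifs_law S (last_letter a) (slice a E w) <= K%:E)%E) ->
  (eta E <= K%:E)%E.
Proof.
move=> mE K0 EO h; rewrite (law_slice a mE).
have hw w : (rifs_law S (last_letter a) (slice a E w) <= K%:E)%E.
  have [[B0 EB0]|/forallNP emp] := pselect (exists B, E (resample a w B)); last first.
    have -> : slice a E w = set0 by apply/seteqP; split => // B /emp.
    by rewrite measure0 lee_fin.
  have := h _ (EO _ EB0); congr (rifs_law _ _ _ <= _)%E.
  apply/seteqP; split => B; rewrite /slice/=; congr (E _); apply/funext => b;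
    by rewrite /resample; case: eqP.
apply: (@le_trans _ _ (\int[eta]_w (cst K%:E w))%E).
  apply: ge0_le_integral => //.
  - have -> : (fun w => rifs_law S (last_letter a) (slice a E w)) =
        rifs_law S (last_letter a) \o xsection (resample_pair a @^-1` E).
      apply/funext => w /=; congr (rifs_law _ _ _).
      by apply/seteqP; split => B; rewrite xsectionE/=.
    apply: measurable_fun_xsection; rewrite -[X in measurable X]setTI.
    exact: measurable_resample_pair.
rewrite integral_cst//= -[leRHS]mule1; apply: lee_wpmul2l; first by rewrite lee_fin.
exact: (probability_le1 eta measurableT).
Qed.

End product_law.

(** * Projections of a random family *)

Section matrix_limits.
Context {R : realType} {m n : nat}.

Lemma cvg_matrix (f : nat -> 'M[R]_(m, n)) (M : 'M[R]_(m, n)) :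
  (forall i j, (fun k => f k i j) @ \oo --> M i j) -> f @ \oo --> M.
Proof.
move=> h B [P MP PB].
have : \forall k \near \oo, forall ij : 'I_m * 'I_n, P ij.1 ij.2 (f k ij.1 ij.2).
  apply: filter_forall => -[i j] /=; exact: h (MP i j).
by apply: filterS => k fk; apply: PB => i j; exact: (fk (i, j)).
Qed.

Lemma cvg_matrix_entry (f : nat -> 'M[R]_(m, n)) (M : 'M[R]_(m, n)) i j :
  f @ \oo --> M -> (fun k => f k i j) @ \oo --> M i j.
Proof.
move=> fM B MB; apply: (fM [set N : 'M[R]_(m, n) | B (N i j)]).
exact: (@coord_continuous _ _ _ i j M B MB).
Qed.

End matrix_limits.

Lemma mkseq_consE (T : Type) (f : nat -> T) n :
  mkseq f n.+1 = f 0%N :: mkseq (fun i => f i.+1) n.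
Proof. by rewrite /mkseq /= -[iota 1 n]/(iota (1 + 0) n) iotaDl -map_comp. Qed.

Section rifs_maps.
Context {R : realType} {A : pointedFinType} {d : nat}.
Variable S : rifs R A d.
Local Notation Fam := (family_space R A d).
Local Notation Mat := (borel_mx R d).
Implicit Types (w : Fam) (a : word A) (x y : A) (s : seq A) (u : nat -> A).
Local Notation t := (rifs_trans S).

(* The family seen from the vertex x of the tree of words. *)
Definition subfamily x w : Fam := fun a => w (x, word_seq a).

Definition subfamilies s w : Fam := foldl (fun w x => subfamily x w) w s.

Definition vertex_mx x w : 'M[R]_d := w (x, [::]).

Fixpoint path_mx s w : 'M[R]_d :=
  if s is x :: s' then vertex_mx x w *m path_mx s' (subfamily x w) else 1%:M.

Lemma subfamiliesE s w a : subfamilies s w a =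
  if s is x :: s' then w (x, s' ++ word_seq a) else w a.
Proof.
case: s => [//|x s]; elim/last_ind: s a => [|s y IH] a; first by [].
rewrite /subfamilies -rcons_cons -cats1 foldl_cat.
change (subfamilies (x :: s) w (y, word_seq a) = w (x, rcons s y ++ word_seq a)).
by rewrite IH cat_rcons.
Qed.

Lemma subfamilies_rcons s x w : subfamilies (rcons s x) w = subfamily x (subfamilies s w).
Proof. by rewrite /subfamilies -cats1 foldl_cat. Qed.

Lemma product_set_subfamily x w : rifs_product_set S w -> rifs_product_set S (subfamily x w).
Proof. by move=> h [y s]; have := h (x, y :: s). Qed.

Lemma product_set_subfamilies s w :
  rifs_product_set S w -> rifs_product_set S (subfamilies s w).
Proof.
by elim: s w => //= x s IH w hw; apply: IH; exact: product_set_subfamily.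
Qed.

Lemma product_set_vertex x w : rifs_product_set S w -> rifs_set S x (vertex_mx x w).
Proof. by move=> /(_ (x, [::])). Qed.

Definition approx w u k : 'cV[R]_d := rifs_comp S w (prefix_word u k) 0.

Lemma prefixes_cons x y s : prefixes (x, y :: s) =
  (x, [::]) :: [seq (x, word_seq b) | b <- prefixes (y, s)].
Proof.
rewrite /prefixes [size _]/= -[(size s).+2]/(1 + (size s).+1)%N iotaD map_cat.
by rewrite -[iota (0 + 1) _]/(iota (1 + 0) _) iotaDl -!map_comp.
Qed.

Lemma rifs_comp_cons w x y s z : rifs_comp S w (x, y :: s) z =
  vertex_mx x w *m rifs_comp S (subfamily x w) (y, s) z + t x.
Proof. by rewrite /rifs_comp prefixes_cons /= foldr_map. Qed.

Lemma approx0 w u : approx w u 0 = t (u 0%N).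
Proof. by rewrite /approx /rifs_comp /= /rifs_map mulmx0 add0r. Qed.

Lemma approxS w u k : approx w u k.+1 =
  vertex_mx (u 0%N) w *m approx (subfamily (u 0%N) w) (Defs.shift u) k + t (u 0%N).
Proof.
have -> : approx w u k.+1 = rifs_comp S w (u 0%N, u 1%N :: mkseq (fun n => u n.+2) k) 0.
  by rewrite /approx /prefix_word mkseq_consE.
by rewrite rifs_comp_cons.
Qed.

Lemma exists_contraction_ratio : exists2 rho, 0 < rho < 1 &
  forall x (M : 'M[R]_d), rifs_set S x M -> opnorm M <= rho.
Proof.
have [f fP] : {f : A -> R & forall x, f x < 1 /\ forall M, rifs_set S x M -> opnorm M <= f x}.
  apply: (@choice _ _ (fun x r => r < 1 /\ forall M, rifs_set S x M -> opnorm M <= r)) => x.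
  by have [r r1 h] := rifs_set_bounded S x; exists r.
exists (\big[Num.max/2^-1]_x f x).
  apply/andP; split.
    by elim/big_rec: _ => [|x r _ r0]; [rewrite invr_gt0|rewrite lt_max r0 orbT].
  elim/big_rec: _ => [|x r _ r1]; first by rewrite invf_lt1 ?ltr1n.
  by rewrite gt_max r1 andbT; case: (fP x).
move=> x M xM; rewrite (bigD1 x)//= le_max; apply/orP; left.
by have [_] := fP x; exact.
Qed.

Section limits.
Variables (rho T : R).
Hypothesis rho01 : 0 < rho < 1.
Hypothesis rhoP : forall x (M : 'M[R]_d), rifs_set S x M -> opnorm M <= rho.
Hypothesis TP : forall x, enorm (t x) <= T.

Let rho0 : 0 <= rho. Proof. by case/andP: rho01 => /ltW. Qed.

Lemma T_ge0 : 0 <= T.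
Proof. exact: le_trans (enorm_ge0 _) (TP point). Qed.

Lemma enorm_mul_rho x (M : 'M[R]_d) v : rifs_set S x M -> enorm (M *m v) <= rho * enorm v.
Proof.
move=> xM; apply: le_trans (enorm_mul_opnorm _ _) _.
by rewrite ler_wpM2r ?enorm_ge0//; exact: rhoP xM.
Qed.

Lemma enorm_approx_le w u k : rifs_product_set S w -> enorm (approx w u k) <= T / (1 - rho).
Proof.
have r1 : 0 < 1 - rho by rewrite subr_gt0; case/andP: rho01.
elim: k w u => [|k IH] w u hw.
  rewrite approx0 ler_pdivlMr//; apply: le_trans (ler_wpM2r (ltW r1) (TP _)) _.
  by rewrite ler_piMr ?T_ge0// gerBl.
rewrite approxS; apply: le_trans (enormD _ _) _.
have h1 := @enorm_mul_rho _ _ (approx (subfamily (u 0%N) w) (Defs.shift u) k) (product_set_vertex (u 0%N) hw).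
have h2 := ler_wpM2l rho0 (IH (subfamily (u 0%N) w) (Defs.shift u) (product_set_subfamily _ hw)).
apply: le_trans (lerD (le_trans h1 h2) (TP _)) _.
by rewrite le_eqVlt; apply/orP; left; apply/eqP; field; rewrite gt_eqF.
Qed.

Lemma approx_diff_le w u k : rifs_product_set S w ->
  enorm (approx w u k.+1 - approx w u k) <= T / (1 - rho) * rho ^+ k.+1.
Proof.
elim: k w u => [|k IH] w u hw.
  rewrite approxS [approx w u 0]approx0 addrK expr1 mulrC.
  have h1 := @enorm_mul_rho _ _ (approx (subfamily (u 0%N) w) (Defs.shift u) 0) (product_set_vertex (u 0%N) hw).
  by apply: le_trans h1 _; rewrite ler_wpM2l// enorm_approx_le//; exact: product_set_subfamily.
rewrite approxS [approx w u k.+1]approxS opprD addrACA subrr addr0 -mulmxBr.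
have h1 := @enorm_mul_rho _ _ (approx (subfamily (u 0%N) w) (Defs.shift u) k.+1 - approx (subfamily (u 0%N) w) (Defs.shift u) k) (product_set_vertex (u 0%N) hw).
apply: le_trans h1 _.
have h2 := ler_wpM2l rho0 (IH (subfamily (u 0%N) w) (Defs.shift u) (product_set_subfamily _ hw)).
by apply: le_trans h2 _; rewrite [rho ^+ k.+2]exprS mulrCA.
Qed.

Lemma cvg_approx w u : rifs_product_set S w -> cvgn (approx w u).
Proof.
move=> hw; set K := T / (1 - rho).
have K0 : 0 <= K by rewrite divr_ge0 ?T_ge0// subr_ge0 ltW//; case/andP: rho01.
suff h i : exists l : R, (fun k => approx w u k i 0) @ \oo --> l.
  have [l lP] : {l : 'I_d -> R & forall i, (fun k => approx w u k i 0) @ \oo --> l i}.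
    exact: (@choice _ _ (fun i l => (fun k => approx w u k i 0) @ \oo --> l)).
  apply/cvg_ex; exists (\col_i l i); apply: cvg_matrix => i j.
  by rewrite (ord1 j) mxE; exact: lP.
pose a k := approx w u k i 0.
pose b k := a k.+1 - a k.
have bk k : `|b k| <= geometric (K * rho) rho k.
  rewrite /geometric/= -mulrA -exprS /b /a.
  apply: le_trans (approx_diff_le u k hw).
  by have := entry_le_enorm (approx w u k.+1 - approx w u k) i; rewrite !mxE.
have sb : cvgn (series b).
  apply: normed_cvg; apply: (series_le_cvg _ _ bk) => //.
  - by move=> k; apply: le_trans (bk k).
  - by apply: is_cvg_geometric_series; rewrite ger0_norm//; case/andP: rho01.
have -> : (fun k => approx w u k i 0) = (fun k => a 0%N + series b k).
  apply/funext => k; rewrite /series /= telescope_sumr//.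
  by rewrite addrC subrK.
exists (a 0%N + limn (series b)).
by apply: cvgD => //; exact: cvg_cst.
Qed.

Lemma cvg_approx_proj w u : rifs_product_set S w -> approx w u @ \oo --> rifs_proj S w u.
Proof. exact: cvg_approx. Qed.

End limits.

Section projections.
Let ratio_bound := exists_contraction_ratio.

Lemma exists_trans_bound : exists T, forall x, enorm (t x) <= T.
Proof.
exists (\sum_x enorm (t x)) => x; rewrite (bigD1 x)//= lerDl.
by apply: sumr_ge0 => y _; exact: enorm_ge0.
Qed.

Lemma cvg_proj w u : rifs_product_set S w -> approx w u @ \oo --> rifs_proj S w u.
Proof.
move=> hw; have [rho r01 rP] := ratio_bound; have [T TP] := exists_trans_bound.
exact: cvg_approx_proj r01 rP TP w u hw.
Qed.

Lemma exists_proj_bound : exists R0, forall w u,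
  rifs_product_set S w -> enorm (rifs_proj S w u) <= R0.
Proof.
have [rho r01 rP] := ratio_bound; have [T TP] := exists_trans_bound.
exists (d%:R * (T / (1 - rho))) => w u hw.
apply: enorm_le_entries => i.
have h := @cvg_matrix_entry _ _ _ _ _ i 0 (@cvg_proj w u hw).
have h' : (fun k => `|approx w u k i 0|) @ \oo --> `|rifs_proj S w u i 0|.
  exact: cvg_norm.
rewrite -(cvg_lim _ h')//; apply: limr_le; first by apply/cvg_ex; eexists; exact: h'.
apply: nearW => k; apply: le_trans (entry_le_enorm _ _) _.
exact: enorm_approx_le r01 rP TP w u k hw.
Qed.

Lemma proj_step w u : rifs_product_set S w ->
  rifs_proj S w u = vertex_mx (u 0%N) w *m
     rifs_proj S (subfamily (u 0%N) w) (Defs.shift u) + t (u 0%N).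
Proof.
move=> hw; apply/colP => i.
have h1 := @cvg_matrix_entry _ _ _ _ _ i 0 (@cvg_proj w u hw).
have h2 j := @cvg_matrix_entry _ _ _ _ _ j 0 (@cvg_proj (subfamily (u 0%N) w) (Defs.shift u) (product_set_subfamily (u 0%N) hw)).
have h3 : (fun k => approx w u k.+1 i 0) @ \oo --> rifs_proj S w u i 0.
  by rewrite (cvg_shiftS (fun k => approx w u k i 0)).
have h4 : (fun k => approx w u k.+1 i 0) @ \oo -->
    (vertex_mx (u 0%N) w *m rifs_proj S (subfamily (u 0%N) w) (Defs.shift u) + t (u 0%N)) i 0.
  have -> : (fun k => approx w u k.+1 i 0) = (fun k =>
      \sum_j vertex_mx (u 0%N) w i j * approx (subfamily (u 0%N) w) (Defs.shift u) k j 0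
      + t (u 0%N) i 0).
    by apply/funext => k; rewrite approxS !mxE.
  rewrite !mxE; apply: cvgD; last exact: cvg_cst.
  apply: cvg_big => [|j _]; [exact: add_continuous|apply: cvgM => //; exact: cvg_cst].
by rewrite -(cvg_lim _ h3)// (cvg_lim _ h4).
Qed.

Definition cat_seq s u : nat -> A := foldr (fun x v n => if n is k.+1 then v k else x) u s.

Lemma cat_seqE s u n : cat_seq s u n = nth (u (n - size s)%N) s n.
Proof.
elim: s n => [|x s IH] n /=; first by rewrite subn0 nth_nil.
by case: n => [//|n]; rewrite subSS; exact: IH.
Qed.

Lemma cat_wordE a u : cat_word a u = cat_seq (word_seq a) u.
Proof. by apply/funext => n; rewrite cat_seqE. Qed.

Lemma cat_seq_cat s1 s2 u : cat_seq (s1 ++ s2) u = cat_seq s1 (cat_seq s2 u).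
Proof. by rewrite /cat_seq foldr_cat. Qed.

Lemma proj_cons w x u : rifs_product_set S w ->
  rifs_proj S w (cat_seq [:: x] u) =
  vertex_mx x w *m rifs_proj S (subfamily x w) u + t x.
Proof. by move=> hw; rewrite proj_step. Qed.

(* The common prefix contributes the same affine map to both points. *)
Lemma proj_cat_sub w s u v : rifs_product_set S w ->
  rifs_proj S w (cat_seq s u) - rifs_proj S w (cat_seq s v) =
  path_mx s w *m (rifs_proj S (subfamilies s w) u - rifs_proj S (subfamilies s w) v).
Proof.
elim: s w => [|x s IH] w hw; first by rewrite /= mul1mx.
rewrite -cat1s !cat_seq_cat !proj_cons// opprD addrACA subrr addr0 -mulmxBr.
by rewrite IH ?mulmxA//; exact: product_set_subfamily.
Qed.

Lemma proj_attractor w s u : rifs_product_set S w ->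
  rifs_attractors S (rifs_proj S (subfamilies s w) u).
Proof.
by move=> hw; exists (subfamilies s w); [exact: product_set_subfamilies|exists u].
Qed.

End projections.

Section measurability.

Lemma measurable_entry (i j : 'I_d) : measurable_fun [set: Mat] (fun M : Mat => (M : 'M[R]_d) i j).
Proof.
apply: (measurability _ (RGenOpens.measurableE R)) => _ [_ [a [b ->]] <-].
rewrite setTI; apply: sub_sigma_algebra => /=.
apply: open_comp; last exact: interval_open.
by move=> M _; exact: coord_continuous.
Qed.

Lemma measurable_det : measurable_fun [set: Mat] (fun M : Mat => \det (M : 'M[R]_d)).
Proof.
apply: measurable_sum => s; apply: measurable_funM => //.
by apply: measurable_prod => i _; exact: measurable_entry.
Qed.

Lemma measurable_coord_entry a (i j : 'I_d) :
  measurable_fun [set: Fam] (fun w : Fam => (w a : 'M[R]_d) i j).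
Proof. exact: (measurableT_comp (measurable_entry i j) (measurable_family_coord a)). Qed.

Lemma measurable_path_mx s (i j : 'I_d) :
  measurable_fun [set: Fam] (fun w : Fam => path_mx s w i j).
Proof.
suff h s0 (f : Fam -> Fam) : (forall a, measurable_fun [set: Fam] (fun w => f w a : Mat)) ->
    forall i j, measurable_fun [set: Fam] (fun w : Fam => path_mx s0 (f w) i j).
  by apply: (h s id) => a; exact: measurable_family_coord.
elim: s0 f => [|x s0 IH] f mf {}i {}j /=; first exact: measurable_cst.
rewrite (_ : (fun w => _) = (fun w => \sum_k vertex_mx x (f w) i k *
   path_mx s0 (subfamily x (f w)) k j)); last by apply/funext => w; rewrite mxE.
apply: measurable_sum => k; apply: measurable_funM.
  exact: (measurableT_comp (measurable_entry i k) (mf (x, [::]))).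
by apply: (IH (fun w => subfamily x (f w))) => a; exact: mf.
Qed.

Lemma measurable_det_path_mx s :
  measurable_fun [set: Fam] (fun w : Fam => \det (path_mx s w)).
Proof.
apply: measurable_sum => p; apply: measurable_funM => //.
by apply: measurable_prod => i _; exact: measurable_path_mx.
Qed.

Lemma measurable_norm_det_path_mx s :
  measurable_fun [set: Fam] (fun w : Fam => `|\det (path_mx s w)|).
Proof. by apply: measurableT_comp => //; exact: measurable_det_path_mx. Qed.

(** There are countably many words, enumerated by [unpickle]. *)
Lemma measurable_product_set : measurable (rifs_product_set S : set Fam).
Proof.
have -> : rifs_product_set S = \bigcap_n
   (if unpickle n is Some a then (fun w : Fam => w a) @^-1` rifs_set S (last_letter a) else setT).
  apply/seteqP; split => w /=.
    by move=> h n _; case: unpickle => //= a; exact: h.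
  by move=> h a; have := h (pickle a) I; rewrite pickleK.
apply: bigcapT_measurable => n; case: unpickle => // a.
rewrite -[X in measurable X]setTI.
apply: measurable_family_coord => //; exact: rifs_set_measurable.
Qed.

Lemma measurable_approx u k (i : 'I_d) :
  measurable_fun [set: Fam] (fun w : Fam => approx w u k i 0).
Proof.
rewrite /approx /rifs_comp; elim: (prefixes _) i => [|a l IH] i /=; first exact: measurable_cst.
rewrite (_ : (fun w => _) = (fun w : Fam => \sum_j (w a : 'M[R]_d) i j *
   (foldr (rifs_map S w) 0 l) j 0 + t (last_letter a) i 0)); last first.
  by apply/funext => w; rewrite !mxE.
apply: measurable_funD => //; apply: measurable_sum => j; apply: measurable_funM => //.
exact: measurable_coord_entry.
Qed.

Lemma measurable_proj u (i : 'I_d) :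
  measurable_fun (rifs_product_set S) (fun w : Fam => rifs_proj S w u i 0).
Proof.
apply: (@measurable_fun_cvg _ _ _ _ (fun k (w : Fam) => approx w u k i 0)).
  by move=> k; apply: measurable_funTS; exact: measurable_approx.
by move=> w hw; apply: cvg_matrix_entry; exact: cvg_proj.
Qed.

Lemma measurable_proj_close u v (r : R) :
  measurable [set w : Fam | rifs_product_set S w /\
    (enorm (rifs_proj S w u - rifs_proj S w v) <= r)%R].
Proof.
have [r0|r0] := leP 0 r; last first.
  rewrite (_ : [set w : Fam | _] = set0); first exact: measurable0.
  apply/seteqP; split => // w [_ /(le_trans (enorm_ge0 _))].
  by rewrite leNgt r0.
pose f (w : Fam) : R := \sum_(i < d) (rifs_proj S w u i 0 - rifs_proj S w v i 0) ^+ 2.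
have mf : measurable_fun (rifs_product_set S) f.
  apply: measurable_sum => i; apply: measurable_funX.
  by apply: measurable_funB; exact: measurable_proj.
have := mf measurable_product_set _ (measurable_itv `]-oo, (r ^+ 2)]).
congr (measurable _); apply/seteqP; split => w /=; rewrite in_itv/=.
  move=> [hw fw]; split => //; rewrite -ler_sqr ?nnegrE ?enorm_ge0// sqr_enorm.
  by apply: le_trans fw; apply: ler_sum => i _; rewrite !mxE.
move=> [hw]; rewrite -ler_sqr ?nnegrE ?enorm_ge0// sqr_enorm => fw; split=> //.
by apply: le_trans fw; apply: ler_sum => i _; rewrite !mxE.
Qed.

End measurability.

End rifs_maps.

(** * Transversality *)

Lemma measure_le_sum (disp : measure_display) (T : measurableType disp) (R : realType)
    (mu : {measure set T -> \bar R}) (I : eqType) (r : seq I) (P : pred I) (F : I -> set T) E :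
  measurable E -> (forall i, measurable (F i)) ->
  (forall x, E x -> exists i, [/\ i \in r, P i & F i x]) ->
  (mu E <= \sum_(i <- r | P i) mu (F i))%E.
Proof.
move=> mE mF; elim: r E mE => [|j r IH] E mE EF.
  rewrite big_nil (_ : E = set0) ?measure0//.
  by apply/seteqP; split => // x /EF[i []].
rewrite big_cons; case: ifP => Pj; last first.
  apply: IH => // x /EF[i []]; rewrite inE => /predU1P[->|ir Pi Fi]; last by exists i.
  by rewrite Pj.
rewrite -(setUIDK E (F j)); apply: le_trans (measureU2 _ _ _) _ => //.
- exact: measurableI.
- exact: measurableD.
apply: leeD; first by apply: le_measure; rewrite ?inE//; exact: measurableI.
apply: IH; first exact: measurableD.
move=> x [/EF[i []]]; rewrite inE => /predU1P[-> _ //|ir Pi Fi nF]; by exists i.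
Qed.

Section grid.
Context {R : realType}.

Lemma exists_grid_cell (h t : R) K : 0 < t <= K%:R * h ->
  exists k : 'I_K, k%:R * h < t <= k.+1%:R * h.
Proof.
elim: K => [|K IH]; first by rewrite mul0r => /andP[/lt_le_trans h1 /h1]; rewrite ltxx.
move=> /andP[t0 tK]; have [tK'|Kt] := leP t (K%:R * h).
  by have [|k kP] := IH; [rewrite t0|exists (widen_ord (leqnSn K) k)].
by exists ord_max; rewrite /= Kt.
Qed.

End grid.

Section law_regularity.
Context {R : realType} {A : pointedFinType} {d : nat}.
Variable S : rifs R A d.+1.
Local Notation Mat := (borel_mx R d.+1).
Local Notation D := d.+1.

Lemma measurable_enorm_affine (P : 'M[R]_D) (x q : 'cV[R]_D) :
  measurable_fun [set: Mat] (fun B : Mat => enorm (P *m ((B : 'M[R]_D) *m x) - q)).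
Proof.
suff mf : measurable_fun [set: Mat] (fun B : Mat =>
    \sum_(k < D) (P *m ((B : 'M[R]_D) *m x) - q) k 0 ^+ 2).
  have ms : measurable_fun [set: R] (@Num.sqrt R).
    exact: (continuous_measurable_fun (@sqrt_continuous R)).
  have := measurableT_comp ms mf; exact.
apply: measurable_sum => j; apply: measurable_funX.
rewrite (_ : (fun B => _) = (fun B : Mat => \sum_k P j k * (\sum_l (B : 'M[R]_D) k l * x l 0) - q j 0)).
  apply: measurable_funB => //; apply: measurable_sum => k; apply: measurable_funM => //.
  by apply: measurable_sum => l; apply: measurable_funM => //; exact: measurable_entry.
apply/funext => B; rewrite !mxE; congr (_ - _).
by apply: eq_bigr => k _; rewrite mxE.
Qed.

Lemma measurable_law_event i (P : 'M[R]_D) (x q : 'cV[R]_D) (r : R) :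
  measurable [set B : Mat | rifs_set S i B /\
    (enorm (P *m ((B : 'M[R]_D) *m x) - q) <= r)%R].
Proof.
apply: measurableI; first exact: rifs_set_measurable.
have := @measurable_enorm_affine P x q measurableT _ (measurable_itv `]-oo, r]).
by rewrite setTI; congr (measurable _); apply/seteqP; split => B /=; rewrite in_itv.
Qed.

Lemma measurable_law_ball i (x y : 'cV[R]_D) (r : R) :
  measurable [set B : Mat | rifs_set S i B /\ eball y r ((B : 'M[R]_D) *m x)].
Proof.
apply: measurableI; first exact: rifs_set_measurable.
have := @measurable_enorm_affine 1%:M x y measurableT _ (measurable_itv `]-oo, r[).
rewrite setTI; congr (measurable _); apply/seteqP; split => B /=;
  by rewrite in_itv/= /eball /= mul1mx.
Qed.

Lemma measurable_box (x y : 'cV[R]_D) :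
  measurable (box x y : set (caratheodory_type (@lebesgue_outer_measure R D))).
Proof.
rewrite (_ : box x y = \bigcap_(i in [set: 'I_D])
  ([set z | z i 0 <= y i 0] `\` [set z | z i 0 <= x i 0])); last first.
  apply/seteqP; split => z /=.
    by move=> h i _; have /andP[h1 h2] := h i; split => //=; apply/negP; rewrite -ltNge.
  by move=> h i; have [h1 /negP] := h i I; rewrite -ltNge => ->.
apply: fin_bigcap_measurable => // i _.
by apply: measurableD; exact: halfspace_caratheodory.
Qed.

(* Counting cells of a fine grid that meet the ellipsoid. *)
Lemma law_ellipsoid_le i (x q : 'cV[R]_D) (P : 'M[R]_D) (rho C : R) :
  (forall y r, 0 < r -> (rifs_law S i [set B | rifs_set S i B /\
       eball y r ((B : 'M[R]_D) *m x)] <= (C * r ^+ D)%:E)%E) ->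
  \det P != 0 -> 0 < rho -> 0 <= C ->
  (rifs_law S i [set B | rifs_set S i B /\
       (enorm (P *m ((B : 'M[R]_D) *m x) - q) <= rho)%R]
   <= (C * (D.+1%:R * 8) ^+ D * rho ^+ D / `|\det P|)%:E)%E.
Proof.
move=> hC P0 rho0 C0.
pose a := entry_sum P * D%:R.
have a0 : 0 <= a by rewrite mulr_ge0// !sumr_ge0// => *; rewrite sumr_ge0.
(* At this mesh the image of a cell under [P] has diameter at most [a * h <= rho], so cells that
   meet the ellipsoid lie in the one of twice the size, whose volume bounds their number. *)
pose h := rho / (a + 1).
have h0 : 0 < h by rewrite divr_gt0// ltr_wpDl.
have ah : a * h <= rho.
  by rewrite mulrA ler_pdivrMr ?ltr_wpDl// mulrDr mulr1 mulrC lerDl ltW.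
have [N NP] : exists N : nat, enorm x < N%:R * h.
  exists (Num.trunc (enorm x / h)).+1; rewrite -ltr_pdivrMr//.
  by have /andP[] := truncn_itv (divr_ge0 (enorm_ge0 x) (ltW h0)).
pose K := (N + N)%N.
pose lo (f : {ffun 'I_D -> 'I_K}) : 'cV[R]_D := \col_j ((f j)%:R * h - N%:R * h).
pose hi (f : {ffun 'I_D -> 'I_K}) : 'cV[R]_D := \col_j ((f j).+1%:R * h - N%:R * h).
pose Ell rr := [set p : 'cV[R]_D | (enorm (P *m p - q) <= rr)%R].
pose G := [set f : {ffun 'I_D -> 'I_K} | `[< exists p, box (lo f) (hi f) p /\ Ell rho p >]]%SET.
have lohi f j : lo f j 0 <= hi f j 0 by rewrite !mxE lerD2r ler_wpM2r ?(ltW h0)// ler_nat.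
have cell f p p' : box (lo f) (hi f) p -> box (lo f) (hi f) p' -> enorm (p - p') <= D%:R * h.
  move=> hp hp'; apply: enorm_le_entries => j; rewrite !mxE.
  have := hp j; have := hp' j; rewrite !mxE -!natr1 => /andP[h1 h2] /andP[h3 h4].
  by rewrite ler_norml; apply/andP; split; lra.
have EG f : f \in G -> box (lo f) (hi f) `<=` Ell (2 * rho).
  rewrite inE => /asboolP[p [pb pE]] p' pb'; rewrite /Ell /=.
  rewrite (_ : P *m p' - q = P *m (p' - p) + (P *m p - q)); last first.
    by rewrite mulmxBr addrA subrK.
  apply: le_trans (enormD _ _) _; rewrite mulr_natl mulr2n lerD//.
  apply: le_trans (enorm_mul_entry_sum _ _) _; apply: le_trans ah.
  rewrite /a -mulrA ler_wpM2l ?(cell f)//.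
  by apply: sumr_ge0 => *; exact: sumr_ge0.
have disj f g p : box (lo f) (hi f) p -> box (lo g) (hi g) p -> f = g.
  move=> hf hg; apply/ffunP => j; apply/val_inj/eqP.
  have := hf j; have := hg j; rewrite !mxE => /andP[h1 h2] /andP[h3 h4].
  have lt1 : (f j < (g j).+1)%N by rewrite -(ltr_nat R) -(ltr_pM2r h0); lra.
  have lt2 : (g j < (f j).+1)%N by rewrite -(ltr_nat R) -(ltr_pM2r h0); lra.
  by rewrite eqn_leq -ltnS lt1 -ltnS lt2.
have volG : (#|G|%:R * h ^+ D <= (8 * rho) ^+ D / `|\det P|)%R.
  pose F f : set (caratheodory_type (@lebesgue_outer_measure R D)) :=
    if f \in G then box (lo f) (hi f) else set0.
  have FU : (@volume R d (\bigcup_f F f) = \sum_f @volume R d (F f))%E.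
    apply: measure_bigcup_fintype => [f|f g p]; rewrite /F.
      by case: ifP => _; [exact: measurable_box|exact: measurable0].
    by case: ifP => // _; case: ifP => // _; exact: disj.
  have := @volume_ellipsoid_le R d P q (2 * rho) P0 (mulr_gt0 (ltr0Sn _ 1) rho0).
  rewrite mulrA -natrM -lee_fin => UB; apply: le_trans UB.
  apply: (@le_trans _ _ (\sum_f @volume R d (F f))%E).
    rewrite (bigID (mem G))/= -[leLHS]adde0; apply: leeD; last by apply: sume_ge0.
    rewrite mulr_natl -sumr_const -sumEFin; apply: lee_sum => f fG.
    rewrite /F fG; apply: le_trans (box_volume_le_lebesgue (lohi f)).
    rewrite lee_fin /box_volume -[D in h ^+ D]card_ord -prodr_const.
    by apply: ler_prod => j _; rewrite !mxE -natr1 ltW//=; lra.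
  rewrite -FU; apply: le_lebesgue_outer => p [f _]; rewrite /F; case: ifP => // fG.
  exact: EG.
(* Each cell lies in a ball of radius [D.+1 * h]; the mesh cancels between the number of cells and
   the bound for each. [D.+1] replaces [D] since [eball] is open. *)
apply: (@le_trans _ _ (\sum_(f in G) (C * (D.+1%:R * h) ^+ D)%:E)%E); last first.
  rewrite sumEFin lee_fin sumr_const -[leLHS]mulr_natr.
  have := ler_wpM2l (mulr_ge0 C0 (exprn_ge0 D (ler0n R D.+1))) volG.
  rewrite [(8 * rho) ^+ D]exprMn [(D.+1%:R * h) ^+ D]exprMn [(D.+1%:R * 8) ^+ D]exprMn => hh.
  apply: le_trans (le_trans _ hh) _; rewrite le_eqVlt; apply/orP; left; apply/eqP.
    by rewrite -!mulrA; congr (_ * (_ * _)); rewrite mulrC.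
  by rewrite !mulrA.
apply: (@le_trans _ _ (\sum_(f in G) rifs_law S i [set B | rifs_set S i B /\
     eball (hi f) (D.+1%:R * h) ((B : 'M[R]_D) *m x)])%E); last first.
  by apply: lee_sum => f _; apply: hC; rewrite mulr_gt0.
apply: measure_le_sum => [|f|B [iB eB]].
- exact: measurable_law_event.
- exact: measurable_law_ball.
have nx j : - (N%:R * h) < ((B : 'M[R]_D) *m x) j 0 < N%:R * h.
  rewrite -ltr_norml; apply: le_lt_trans (entry_le_enorm _ _) _.
  apply: le_lt_trans NP; apply: le_trans (enorm_mul_opnorm _ _) _.
  by rewrite ler_piMl ?enorm_ge0// ltW//; have [] := rifs_set_contraction iB.
have [f fP] : {f : 'I_D -> 'I_K & forall j,
    (f j)%:R * h < ((B : 'M[R]_D) *m x) j 0 + N%:R * h <= (f j).+1%:R * h}.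
  apply: (@choice _ _ (fun j (k : 'I_K) =>
    k%:R * h < ((B : 'M[R]_D) *m x) j 0 + N%:R * h <= k.+1%:R * h)) => j.
  apply: exists_grid_cell; have /andP[h1 h2] := nx j.
  by rewrite natrD mulrDl; apply/andP; split; lra.
have bf : box (lo (finfun f)) (hi (finfun f)) ((B : 'M[R]_D) *m x).
  move=> j; have /andP[h1 h2] := fP j.
  by rewrite [lo _ _ _]mxE [hi _ _ _]mxE ffunE; apply/andP; split; lra.
exists (finfun f); split; first exact: mem_index_enum.
  by rewrite inE; apply/asboolP; exists ((B : 'M[R]_D) *m x).
split => //; rewrite /eball/=.
apply: (@le_lt_trans _ _ (D%:R * h)); last by rewrite ltr_pM2r// ltr_nat.
apply: (cell (finfun f)) => //.
by move=> j; rewrite !mxE !ffunE lexx andbT ltrD2r ltr_pM2r// ltr_nat.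
Qed.

End law_regularity.

Section transversality.
Context {R : realType} {A : pointedFinType} {d : nat}.
Variable S : rifs R A d.+1.
Variable eta : probability (family_space R A d.+1) R.
Hypothesis eta_product : is_product_law S eta.
Local Notation Fam := (family_space R A d.+1).
Local Notation Mat := (borel_mx R d.+1).
Local Notation D := d.+1.
Implicit Types (w : Fam) (a : word A) (i j : A) (v s : seq A) (u : nat -> A).
Local Notation t := (rifs_trans S).
Local Notation proj := (rifs_proj S).

(** The index of the matrix met when [x] is read after the possibly empty word [v]. *)
Definition word_rcons v x : word A := if v is y :: s then (y, rcons s x) else (x, [::]).

Lemma word_seq_rcons v x : word_seq (word_rcons v x) = rcons v x.
Proof. by case: v. Qed.

Lemma last_letter_rcons v x : last_letter (word_rcons v x) = x.
Proof. by case: v => // y s; rewrite /last_letter/= last_rcons. Qed.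

Lemma vertex_subfamilies v x w : vertex_mx x (subfamilies v w) = w (word_rcons v x).
Proof. by rewrite /vertex_mx subfamiliesE; case: v => // y s; rewrite cats1. Qed.

Lemma path_mx_ext v w w' :
  (forall a, (size (word_seq a) <= size v)%N -> w a = w' a) -> path_mx v w = path_mx v w'.
Proof.
elim: v w w' => //= x v IH w w' h; rewrite /vertex_mx h//; congr (_ *m _).
by apply: IH => a av; apply: h.
Qed.

Lemma det_path_mx_neq0 v w : rifs_product_set S w -> \det (path_mx v w) != 0.
Proof.
elim: v w => [|x v IH] w hw /=; first by rewrite det1 oner_neq0.
rewrite det_mulmx mulf_neq0 ?IH//; last exact: product_set_subfamily.
by apply: contraction_det_neq0; apply: rifs_set_contraction (product_set_vertex x hw).
Qed.

Lemma path_mx_resample v x w (B : Mat) :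
  path_mx v (resample (word_rcons v x) w B) = path_mx v w.
Proof.
apply: path_mx_ext => a; rewrite /resample; case: eqP => // ->.
by rewrite word_seq_rcons size_rcons ltnn.
Qed.

Lemma vertex_resample v x y w (B : Mat) :
  vertex_mx y (subfamilies v (resample (word_rcons v x) w B)) =
  if y == x then B : 'M[R]_D else vertex_mx y (subfamilies v w).
Proof.
have inj : injective (word_rcons v).
  by move=> z z' /(congr1 (@word_seq A)); rewrite !word_seq_rcons => /rcons_inj[].
by rewrite !vertex_subfamilies /resample (inj_eq inj).
Qed.

Lemma subfamilies_resample v x y w (B : Mat) :
  subfamilies (rcons v y) (resample (word_rcons v x) w B) = subfamilies (rcons v y) w.
Proof.
apply/funext => a; rewrite !subfamiliesE; case: v => [|z v] /=; rewrite /resample; case: eqP => //.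
move=> /(congr1 (@size A \o @word_seq A)) /=; rewrite size_cat !size_rcons /= addnS => -[].
by move=> e; exfalso; lia.
Qed.

Lemma proj_subfamilies_cons v x u w : rifs_product_set S w ->
  proj (subfamilies v w) (cat_seq [:: x] u) =
  vertex_mx x (subfamilies v w) *m proj (subfamilies (rcons v x) w) u + t x.
Proof. by move=> hw; rewrite proj_cons ?subfamilies_rcons//; exact: product_set_subfamilies. Qed.

(* y plays the role of the other point, seen from the branching vertex. *)
Definition law_regular (Q : 'M[R]_D -> Prop) (mu0 C : R) : Prop :=
  forall i x y P rho, rifs_attractors S x -> Q P -> \det P != 0 -> 0 < rho ->
    mu0 <= enorm y ->
    (rifs_law S i [set B | rifs_set S i B /\
        (enorm (P *m ((B : 'M[R]_D) *m x) - P *m y) <= rho)%R]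
     <= (C * rho ^+ D / `|\det P|)%:E)%E.

Definition close_event v u u' (kap rho : R) : set Fam :=
  [set w | [/\ rifs_product_set S w, kap <= `|\det (path_mx v w)| &
     (enorm (proj w (cat_seq v u) - proj w (cat_seq v u')) <= rho)%R]].

(** Seen from the branching vertex, the points are close when the matrix of letter [i] sends the
    tail of the first point near the second point minus [t i]. Distant non-singularity applies when
    this target is away from 0. *)
Definition far_event v i u' (mu0 : R) : set Fam :=
  [set w | rifs_product_set S w /\ mu0 <= enorm (proj (subfamilies v w) u' - t i)].

Lemma measurable_close_event v u u' kap rho : measurable (close_event v u u' kap rho).
Proof.
rewrite (_ : close_event _ _ _ _ _ = [set w : Fam | kap <= `|\det (path_mx v w)|] `&`
  [set w : Fam | rifs_product_set S w /\
    (enorm (proj w (cat_seq v u) - proj w (cat_seq v u')) <= rho)%R]); last first.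
  by apply/seteqP; split => w /=; [move=> []|move=> [? []]].
apply: measurableI; last exact: measurable_proj_close.
have := @measurable_norm_det_path_mx R A D v measurableT _ (measurable_itv `[kap, +oo[).
by rewrite setTI; congr (measurable _); apply/seteqP; split => w /=; rewrite in_itv/= andbT.
Qed.

Lemma measurable_subfamilies v : measurable_fun [set: Fam] (subfamilies v : Fam -> Fam).
Proof.
apply: measurable_into_family => a.
rewrite (_ : (fun w => _) = (fun w : Fam => w (if v is x :: s then (x, s ++ word_seq a) else a))).
  exact: measurable_family_coord.
by apply/funext => w; rewrite subfamiliesE; case: v.
Qed.

Lemma measurable_far_event v i u' mu0 : measurable (far_event v i u' mu0).
Proof.
have [r0|r0] := leP mu0 0.
  rewrite (_ : far_event _ _ _ _ = rifs_product_set S); first exact: measurable_product_set.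
  by apply/seteqP; split => w /=; [case|split => //; apply: le_trans r0 (enorm_ge0 _)].
pose f w : R := \sum_(k < D) (proj (subfamilies v w) u' k 0 - t i k 0) ^+ 2.
have mf : measurable_fun (rifs_product_set S) f.
  apply: measurable_sum => k; apply: measurable_funX; apply: measurable_funB => //.
  apply: (@measurable_comp _ _ _ _ _ _ (rifs_product_set S : set Fam)
     (fun w : Fam => proj w u' k 0) _ (subfamilies v : Fam -> Fam)).
  - exact: measurable_product_set.
  - by move=> _ [w hw <-]; exact: product_set_subfamilies.
  - exact: measurable_proj.
  - by apply: measurable_funTS; exact: measurable_subfamilies.
have := mf (measurable_product_set S) _ (measurable_itv `[(mu0 ^+ 2), +oo[).
have fE w : f w = enorm (proj (subfamilies v w) u' - t i) ^+ 2.
  by rewrite sqr_enorm; apply: eq_bigr => k _; rewrite !mxE.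
congr (measurable _); apply/seteqP; split => w /=; rewrite in_itv/= andbT fE
  ler_sqr ?nnegrE ?enorm_ge0 ?(ltW r0)//.
Qed.

Section one_sided.
Variables (Q : 'M[R]_D -> Prop) (mu0 C : R).
Hypothesis C0 : 0 <= C.
Hypothesis regular : law_regular Q mu0 C.
Hypothesis Qpath : forall v w, rifs_product_set S w -> Q (path_mx v w).

(** Resampling the matrix at [rcons v i] changes neither the product along [v], nor the tail behind
    [i], nor the point through [j]. Given these, the event confines one random matrix as in
    [law_regular]. *)
Lemma measure_close_far_le v i j u u' kap rho : i != j -> 0 < kap -> 0 < rho ->
  (eta (close_event v (cat_seq [:: i] u) (cat_seq [:: j] u') kap rho `&`
        far_event v i (cat_seq [:: j] u') mu0) <= (C * rho ^+ D / kap)%:E)%E.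
Proof.
move=> ij kap0 rho0.
set E := _ `&` _.
have mE : measurable E.
  by apply: measurableI; [exact: measurable_close_event|exact: measurable_far_event].
have K0 : 0 <= C * rho ^+ D / kap.
  by apply: divr_ge0 (ltW kap0); apply: mulr_ge0 C0 _; exact: exprn_ge0 (ltW rho0).
apply: (@law_le_of_slices R A D S eta eta_product (word_rcons v i)) => //.
  by move=> w [[]].
move=> w hw; rewrite last_letter_rcons.
pose P := path_mx v w; pose x := proj (subfamilies (rcons v i) w) u.
pose y := proj (subfamilies v w) (cat_seq [:: j] u') - t i.
have slP B : slice (word_rcons v i) E w B -> [/\ kap <= `|\det P|, mu0 <= enorm y,
    rifs_set S i B & enorm (P *m ((B : 'M[R]_D) *m x) - P *m y) <= rho].
  move=> [[hB kP cl] [_ far]].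
  have yE : proj (subfamilies v (resample (word_rcons v i) w B)) (cat_seq [:: j] u') =
      proj (subfamilies v w) (cat_seq [:: j] u').
    rewrite (proj_subfamilies_cons v j u' hB) (proj_subfamilies_cons v j u' hw).
    by rewrite subfamilies_resample vertex_resample eq_sym (negPf ij).
  split.
  - by move: kP; rewrite path_mx_resample.
  - by move: far; rewrite yE.
  - by have := hB (word_rcons v i); rewrite /resample eqxx last_letter_rcons.
  - move: cl; rewrite (proj_cat_sub v _ _ hB) path_mx_resample yE (proj_subfamilies_cons v i u hB).
    rewrite subfamilies_resample vertex_resample eqxx -mulmxBr.
    rewrite (_ : (B : 'M[R]_D) *m x - y = (B : 'M[R]_D) *m x + t i -
      proj (subfamilies v w) (cat_seq [:: j] u')) //.
    by rewrite /y opprB addrA.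
have [[kP mP]|nP] := pselect (kap <= `|\det P| /\ mu0 <= enorm y); last first.
  rewrite (_ : slice _ _ _ = set0) ?measure0 ?lee_fin//.
  by apply/seteqP; split => // B /slP[kP mP _ _]; apply: nP.
apply: (@le_trans _ _ (C * rho ^+ D / `|\det P|)%:E).
  apply: le_trans (regular i (proj_attractor (rcons v i) u hw) (Qpath v hw)
    (det_path_mx_neq0 v hw) rho0 mP).
  apply: le_measure; rewrite ?inE.
  - exact: measurable_slice.
  - exact: measurable_law_event.
  - by move=> B /slP[].
rewrite lee_fin ler_wpM2l//; last by rewrite lef_pV2 ?posrE// (lt_le_trans kap0).
by apply: mulr_ge0 C0 _; exact: exprn_ge0 (ltW rho0).
Qed.

End one_sided.

Definition transversality (C : R) : Prop := forall v i j u u' kap rho,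
  i != j -> 0 < kap -> 0 < rho ->
  (eta (close_event v (cat_seq [:: i] u) (cat_seq [:: j] u') kap rho)
     <= (C * rho ^+ D / kap)%:E)%E.

(** With [mu0 = 0] the far event is the whole product set, so resampling on one side is enough. *)
Lemma nonsingular_transversal : nonsingular S -> exists2 C, 0 < C & transversality C.
Proof.
move=> [C C0 hC]; exists (C * (D.+1%:R * 8) ^+ D).
  by apply: mulr_gt0 C0 _; apply: exprn_gt0; rewrite mulr_gt0.
move=> v i j u u' kap rho ij kap0 rho0.
have reg : law_regular (fun=> True) 0 (C * (D.+1%:R * 8) ^+ D).
  move=> k x y P r ax _ P0 r0 _; apply: law_ellipsoid_le => //; last exact: ltW.
  by move=> z s s0; exact: hC.
have CC : 0 <= C * (D.+1%:R * 8) ^+ D.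
  by apply: mulr_ge0 (ltW C0) _; apply: exprn_ge0; rewrite mulr_ge0.
have := @measure_close_far_le (fun=> True) 0 _ CC reg (fun _ _ _ => I) v i j u u' kap rho ij kap0 rho0.
congr (_ <= _)%E; congr (eta _); apply/seteqP; split => w; first by case.
by move=> h; split => //; split; [case: h|exact: enorm_ge0].
Qed.

(** What products keep of similarities: ellipsoids are balls of radius [rho / c], with [c] read off
    the determinant. A ball around a far target can thus be used directly, without a grid. *)
Definition conformal (P : 'M[R]_D) : Prop := exists c : R, [/\ 0 <= c, c ^+ D = `|\det P| &
  forall z, enorm (P *m z) = c * enorm z].

Lemma conformal1 : conformal 1%:M.
Proof. by exists 1; split; rewrite ?expr1n ?det1 ?normr1// => z; rewrite mul1mx mul1r. Qed.

Lemma conformalM P P' : conformal P -> conformal P' -> conformal (P *m P').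
Proof.
move=> [c [c0 cP Pz]] [c' [c0' cP' Pz']]; exists (c * c'); split.
- exact: mulr_ge0.
- by rewrite exprMn cP cP' det_mulmx normrM.
- by move=> z; rewrite -mulmxA Pz Pz' mulrA.
Qed.

Lemma similarity_conformal P : similarity_mx P -> conformal P.
Proof.
move=> [_ [c [Om oO ->]]]; exists `|c|; split => //.
  by rewrite detZ normrM normrX orthogonal_det// mulr1.
by move=> z; rewrite -scalemxAl enormZ orthogonal_enorm.
Qed.

Lemma min_trans_dist_le i j : i != j -> min_trans_dist S <= enorm (t i - t j).
Proof.
move=> ij; apply: inf_lbound; last by exists (i, j).
by exists 0 => _ [p _ <-]; exact: enorm_ge0.
Qed.

Lemma min_trans_dist_gt0 i j : i != j -> 0 < min_trans_dist S.
Proof.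
move=> ij; pose f (p : A * A) := if p.1 == p.2 then 1 else enorm (t p.1 - t p.2).
have f0 p : 0 < f p.
  rewrite /f; case: ifPn => // pp; rewrite lt_def enorm_ge0 andbT.
  by apply: contra pp => /eqP/enorm_eq0/eqP; rewrite subr_eq0 => /eqP/(@rifs_trans_inj _ _ _ S) ->.
apply: (@lt_le_trans _ _ (\big[Num.min/1]_p f p)).
  by elim/big_rec: _ => // p r _ r0; rewrite lt_min r0 f0.
apply: lb_le_inf; first by exists (enorm (t i - t j)), (i, j).
move=> _ [p /= pp <-]; rewrite (bigD1 p)//= ge_min; apply/orP; left.
by rewrite /f (negPf pp).
Qed.

Lemma distantly_nonsingular_regular C : 0 < C -> 
  (forall i x y (r : R), rifs_attractors S x -> ~ eball 0 (8^-1 * min_trans_dist S) y ->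
    0 < r -> (rifs_law S i [set M | rifs_set S i M /\ eball y r ((M : 'M[R]_D) *m x)]
     <= (C * r ^+ D)%:E)%E) ->
  law_regular conformal (8^-1 * min_trans_dist S) (C * 2 ^+ D).
Proof.
move=> C0 hC i x y P rho ax [c [c0 cP Pz]] P0 rho0 my.
have c1 : 0 < c.
  rewrite lt_def c0 andbT; apply: contra P0 => /eqP c00.
  by rewrite -normr_eq0 -cP c00 expr0n.
have r0 : 0 < 2 * rho / c by rewrite divr_gt0 ?mulr_gt0.
apply: le_trans (le_trans _ (hC i x y (2 * rho / c) ax _ r0)) _.
- apply: le_measure; rewrite ?inE.
  + exact: measurable_law_event.
  + exact: measurable_law_ball.
  + move=> B [iB]; rewrite -mulmxBr Pz => cl; split => //; rewrite /eball/= ltr_pdivlMr// mulrC.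
    by apply: le_lt_trans cl _; rewrite mulr_natl mulr2n ltrDl.
- by rewrite /eball/= subr0; apply/negP; rewrite -leNgt.
- by rewrite lee_fin expr_div_n cP exprMn !mulrA.
Qed.

(** For small [rho] the points seen from the branching vertex are within [mu / 8]. If moreover each
    were within [mu / 8] of the translation of the other letter, the two translations would be
    closer than [mu]. So at least one side has a far target and can be resampled. *)
Lemma similarity_transversal : (forall i, rifs_set S i `<=` similarity_mx) ->
  distantly_nonsingular S -> exists2 C, 0 < C & transversality C.
Proof.
move=> sim [C C0 hC]; pose mu := min_trans_dist S.
have reg := distantly_nonsingular_regular C0 hC.
have Qpath v w : rifs_product_set S w -> conformal (path_mx v w).
  elim: v w => [|x v IH] w hw /=; first exact: conformal1.
  apply: conformalM; last by apply: IH; exact: product_set_subfamily.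
  by apply: similarity_conformal; apply: sim (product_set_vertex x hw).
have C20 : 0 < C * 2 ^+ D by rewrite mulr_gt0// exprn_gt0.
(* The factor 2 counts the two sides; the last term makes the bound at least 1 when [rho] is large.
   The absolute value keeps it nonnegative before [mu] is known to be positive, which takes two
   letters. *)
exists (C * 2 ^+ D * 2 + `|8 / mu| ^+ D).
  by apply: ltr_wpDr; [exact: exprn_ge0|rewrite mulr_gt0].
move=> v i j u u' kap rho ij kap0 rho0.
have mu0 : 0 < mu by exact: min_trans_dist_gt0 ij.
pose c := kap `^ (D%:R^-1).
have c0 : 0 < c by exact: powR_gt0.
have cD : c ^+ D = kap by rewrite /c powR_root_expr// ltW.
have kr0 : 0 <= rho ^+ D / kap.
  by apply: divr_ge0 (ltW kap0); exact: exprn_ge0 (ltW rho0).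
have [big|small] := ltP (mu / 8) (rho / c).
  apply: (@le_trans _ _ 1%E).
    apply: probability_le1; exact: measurable_close_event.
  rewrite lee_fin -mulrA mulrDl; apply: ler_wpDl.
    by apply: mulr_ge0 kr0; rewrite mulr_ge0// ltW.
  rewrite -cD -expr_div_n -exprMn; apply: exprn_ege1.
  rewrite ger0_norm ?divr_ge0 ?(ltW mu0)//.
  rewrite (_ : 8 / mu = (mu / 8)^-1); last by rewrite invf_div.
  by rewrite mulrC ler_pdivlMr ?mul1r ?divr_gt0// ltW.
pose E1 := close_event v (cat_seq [:: i] u) (cat_seq [:: j] u') kap rho `&`
        far_event v i (cat_seq [:: j] u') (8^-1 * mu).
pose E2 := close_event v (cat_seq [:: j] u') (cat_seq [:: i] u) kap rho `&`
        far_event v j (cat_seq [:: i] u) (8^-1 * mu).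
have mE1 : measurable E1.
  by apply: measurableI; [exact: measurable_close_event|exact: measurable_far_event].
have mE2 : measurable E2.
  by apply: measurableI; [exact: measurable_close_event|exact: measurable_far_event].
have h1 : (eta E1 <= (C * 2 ^+ D * rho ^+ D / kap)%:E)%E.
  exact: (measure_close_far_le (ltW C20) reg Qpath).
have h2 : (eta E2 <= (C * 2 ^+ D * rho ^+ D / kap)%:E)%E.
  by apply: (measure_close_far_le (ltW C20) reg Qpath) => //; rewrite eq_sym.
apply: (@le_trans _ _ (eta (E1 `|` E2))).
  apply: le_measure; rewrite ?inE; first exact: measurable_close_event.
    exact: measurableU.
  move=> w hE; have [hw kP cl] := hE.
  pose pi := proj (subfamilies v w) (cat_seq [:: i] u).
  pose pj := proj (subfamilies v w) (cat_seq [:: j] u').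
  have pij : enorm (pi - pj) <= mu / 8.
    have [cP [cP0 cPD Pz]] := Qpath v w hw.
    have ccP : c <= cP by rewrite -(@ler_pXn2r _ D) ?nnegrE ?(ltW c0)// cD cPD.
    apply: le_trans small; rewrite ler_pdivlMr// mulrC.
    apply: le_trans (ler_wpM2r (enorm_ge0 _) ccP) _.
    by rewrite -Pz -proj_cat_sub.
  have [f1|f1] := leP (8^-1 * mu) (enorm (pj - t i)); first by left.
  have [f2|f2] := leP (8^-1 * mu) (enorm (pi - t j)).
    by right; split; [split; [exact: hw|exact: kP|rewrite enormB]|split; [exact: hw|]].
  have := min_trans_dist_le ij; rewrite -/mu.
  have := enorm_dist_triangle (t i) pj (t j); have := enorm_dist_triangle pj pi (t j).
  rewrite (enormB (t i) pj) (enormB pj pi).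
  by move=> h3 h4 h5; exfalso; lra.
apply: le_trans (measureU2 _ mE1 mE2) _; apply: le_trans (leeD h1 h2) _.
rewrite -EFinD lee_fin -!mulrA mulrDl -!mulrA; apply: ler_wpDr.
  by apply: mulr_ge0 kr0; exact: exprn_ge0.
by rewrite mulr_natl mulr2n !mulrDr.
Qed.

End transversality.

(** * Moments of determinants *)

(** Taylor's bound for unbounded [X]: the remainder is integrable as soon as the exponential moment
    at [s0] is. The 16 comes from [y ^+ 2 <= 4 * expR y] at [y = s0 * X / 2]. *)
Lemma expR_le_quadratic {R : realType} (s0 s X : R) : 0 < s -> 2 * s <= s0 -> 0 <= X ->
  expR (s * X) <= 1 + s * X + s ^+ 2 * (16 / s0 ^+ 2) * expR (s0 * X).
Proof.
move=> s_gt0 ss0 X0; have s00 : 0 < s0 by lra.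
have y0 : 0 <= s * X by rewrite mulr_ge0// ltW.
have e1 y : 0 <= y -> expR y <= 1 + y + y ^+ 2 * expR y :> R.
  move=> y_ge0; have h1 : expR y <= 1 + y * expR y.
    have := expR_ge1Dx (- y); rewrite expRN => h.
    have := ler_wpM2r (expR_ge0 y) h; rewrite mulVf ?gt_eqF ?expR_gt0//; lra.
  by have := ler_wpM2l y_ge0 h1; rewrite expr2; lra.
have e2 y : 0 <= y -> y ^+ 2 <= 4 * expR y :> R.
  move=> y_ge0; have h1 := expR_ge1Dx (y / 2).
  have h2 : (1 + y / 2) ^+ 2 <= expR (y / 2) ^+ 2.
    by rewrite ler_sqr// nnegrE ?expR_ge0//; lra.
  rewrite -expRM_natl mulrCA divff ?pnatr_eq0// mulr1 in h2.
  by move: h2; rewrite !expr2; lra.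
apply: le_trans (e1 _ y0) _; rewrite lerD2l exprMn -[leLHS]mulrA -[leRHS]mulrA ler_wpM2l ?sqr_ge0//.
have h := e2 (s0 * X / 2) ltac:(rewrite divr_ge0// mulr_ge0// ltW//).
have h3 : X ^+ 2 <= 16 / s0 ^+ 2 * expR (s0 * X / 2).
  rewrite mulrAC ler_pdivlMr ?exprn_gt0//.
  move: h; rewrite !expr2; lra.
apply: le_trans (ler_wpM2r (expR_ge0 _) h3) _.
rewrite -!mulrA ler_wpM2l// ler_wpM2l ?invr_ge0 ?exprn_ge0 ?(ltW s00)//.
rewrite -expRD ler_expR.
have := ler_wpM2r X0 ss0; lra.
Qed.

Section determinant_moments.
Context {R : realType} {A : pointedFinType} {d : nat}.
Variable S : rifs R A d.+1.
Variable eta : probability (family_space R A d.+1) R.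
Hypothesis eta_product : is_product_law S eta.
Hypothesis log_moments : finite_log_moments S.
Local Notation Fam := (family_space R A d.+1).
Local Notation Mat := (borel_mx R d.+1).
Local Notation D := d.+1.
Implicit Types (w : Fam) (a : word A) (i j x : A) (v s : seq A) (B : Mat).

Definition letter_weight i : R := fine (letter_lyapunov S i).

Definition neg_log_det B : R := - ln `|\det (B : 'M[R]_D)|.

Lemma neg_log_det_ge0 i B : rifs_set S i B -> 0 <= neg_log_det B.
Proof.
move=> /rifs_set_contraction /contraction_det_le1 h.
by rewrite /neg_log_det oppr_ge0 ln_le0.
Qed.

Lemma measurable_abs_det : measurable_fun [set: Mat] (fun B : Mat => `|\det (B : 'M[R]_D)|).
Proof. by apply: measurableT_comp => //; exact: measurable_det. Qed.

Lemma measurable_neg_log_det : measurable_fun [set: Mat] neg_log_det.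
Proof.
apply: measurableT_comp => //.
by apply: (measurableT_comp (@measurable_ln R)); exact: measurable_abs_det.
Qed.

Lemma letter_lyapunovE i : letter_lyapunov S i = (\int[rifs_law S i]_(B in rifs_set S i) (neg_log_det B)%:E)%E.
Proof.
rewrite /letter_lyapunov.
have -> : (\int[rifs_law S i]_(M in rifs_set S i) (ln `|\det (M : 'M[R]_D)|)%:E)%E =
    (\int[rifs_law S i]_(B in rifs_set S i) - (neg_log_det B)%:E)%E.
  by apply: eq_integral => B _; rewrite -EFinN opprK.
rewrite integral_ge0N ?oppeK// => B iB; by rewrite lee_fin (neg_log_det_ge0 iB).
Qed.

Lemma letter_weight_ge0 i : 0 <= letter_weight i.
Proof.
apply: fine_ge0; rewrite letter_lyapunovE; apply: integral_ge0 => B iB.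
by rewrite lee_fin (neg_log_det_ge0 iB).
Qed.

Lemma letter_weightE i :
  (\int[rifs_law S i]_(B in rifs_set S i) (neg_log_det B)%:E)%E = (letter_weight i)%:E.
Proof. by rewrite -letter_lyapunovE /letter_weight fineK//; case: log_moments => + _; exact. Qed.

Lemma powR_detE i B (s : R) : rifs_set S i B ->
  `|\det (B : 'M[R]_D)| `^ (- s) = expR (s * neg_log_det B).
Proof.
move=> /rifs_set_contraction /contraction_det_neq0 h.
by rewrite /powR normr_eq0 (negPf h) mulrN mulNr.
Qed.

(** To first order in [s] the logarithm of the moment is [s * letter_weight i], so a small [s] costs
    at most [s * tau] more; one [s] serves all letters of the finite alphabet. *)
Lemma exists_moment_exponent (tau : R) : 0 < tau -> exists2 s : R, 0 < s & forall i,
  (\int[rifs_law S i]_(B in rifs_set S i) (`|\det (B : 'M[R]_D)| `^ (- s))%:E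
     <= (expR (s * (letter_weight i + tau)))%:E)%E.
Proof.
move=> tau0; have [_ [delta delta0 hd]] := log_moments.
pose s0 := delta / 2; have s00 : 0 < s0 by rewrite divr_gt0.
pose I i := (\int[rifs_law S i]_(B in rifs_set S i) (expR (s0 * neg_log_det B))%:E)%E.
have IE i : (\int[rifs_law S i]_(B in rifs_set S i) (`|\det (B : 'M[R]_D)| `^ (- s0))%:E)%E = I i.
  by apply: eq_integral => B; rewrite inE => iB; rewrite (powR_detE s0 iB).
have I0 i : (0 <= I i)%E by apply: integral_ge0 => B _; rewrite lee_fin expR_ge0.
have Ifin i : I i \is a fin_num.
  have := hd i (- s0); rewrite normrN gtr0_norm// ltr_pdivrMr// ltr_pMr// ltr1n IE.
  move=> /(_ isT); rewrite ge0_fin_numE//.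
  by case: (I i) (I0 i) => [r _ _|//|//]; rewrite ltry.
pose M := \sum_i fine (I i) + 1.
have IM i : fine (I i) <= M.
  rewrite /M (bigD1 i)//= -addrA lerDl addr_ge0// sumr_ge0// => j _; exact: fine_ge0.
have M0 : 0 < M by rewrite ltr_wpDl// sumr_ge0// => j _; exact: fine_ge0.
pose K := 16 / s0 ^+ 2; have K0 : 0 < K by rewrite divr_gt0// exprn_gt0.
(* The second entry makes the quadratic term [s ^+ 2 * K * M] at most [s * tau]. *)
pose s := Num.min (s0 / 2) (tau / (K * M)).
have sgt0 : 0 < s by rewrite lt_min !divr_gt0// mulr_gt0.
have ss0 : 2 * s <= s0.
  have : s <= s0 / 2 by rewrite ge_min lexx.
  lra.
have sKM : s * (K * M) <= tau.
  by rewrite -ler_pdivlMr ?(mulr_gt0 K0 M0)// ge_min lexx orbT.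
exists s => // i.
have mX : measurable_fun (rifs_set S i) neg_log_det.
  exact: measurable_funTS measurable_neg_log_det.
have mE (c : R) : measurable_fun (rifs_set S i) (fun B => expR (c * neg_log_det B)).
  by apply: (measurableT_comp (@measurable_expR R)); apply: measurable_funM.
have mS := rifs_set_measurable S i.
apply: (@le_trans _ _ (\int[rifs_law S i]_(B in rifs_set S i)
   (1 + (s%:E * (neg_log_det B)%:E + (s ^+ 2 * K)%:E * (expR (s0 * neg_log_det B))%:E)))%E).
  apply: ge0_le_integral => //.
  - apply/measurable_EFinP; apply: measurable_funTS.
    by apply: (measurableT_comp (@measurable_powR R (- s))); exact: measurable_abs_det.
  - rewrite (_ : (fun B => _) = EFin \o (fun B => 1 + (s * neg_log_det B + s ^+ 2 * K * expR (s0 * neg_log_det B))))//.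
    apply/measurable_EFinP; apply: measurable_funD => //.
    by apply: measurable_funD; apply: measurable_funM.
  - move=> B iB; rewrite (powR_detE s iB) -!EFinM -!EFinD lee_fin addrA.
    apply: expR_le_quadratic => //; exact: neg_log_det_ge0 iB.
have s2K : 0 <= s ^+ 2 * K by rewrite mulr_ge0 ?exprn_ge0 ?(ltW sgt0) ?(ltW K0).
rewrite ge0_integralD//=; first last.
- rewrite (_ : (fun B => _) = EFin \o (fun B => (s * neg_log_det B + s ^+ 2 * K * expR (s0 * neg_log_det B))))//.
  by apply/measurable_EFinP; apply: measurable_funD; apply: measurable_funM.
- move=> B iB; rewrite -!EFinM -EFinD lee_fin addr_ge0// mulr_ge0 ?expR_ge0 ?(ltW sgt0)//.
  exact: neg_log_det_ge0 iB.
rewrite ge0_integralD//=; first last.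
- rewrite (_ : (fun B => _) = EFin \o (fun B => s ^+ 2 * K * expR (s0 * neg_log_det B)))//.
  by apply/measurable_EFinP; apply: measurable_funM.
- by move=> B iB; rewrite -EFinM lee_fin mulr_ge0 ?expR_ge0.
- rewrite (_ : (fun B => _) = EFin \o (fun B => s * neg_log_det B))//.
  by apply/measurable_EFinP; apply: measurable_funM.
- move=> B iB; rewrite -EFinM lee_fin mulr_ge0 ?(ltW sgt0)//; exact: neg_log_det_ge0 iB.
have -> : (\int[rifs_law S i]_(_ in rifs_set S i) 1 = 1)%E.
  by etransitivity; [exact: (integral_cst (rifs_law S i) mS 1%E)|rewrite mul1e; exact: rifs_law_supported].
rewrite ge0_integralZl_EFin ?(ltW sgt0)//; first last.
- exact/measurable_EFinP.
- by move=> B iB; rewrite lee_fin; exact: neg_log_det_ge0 iB.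
rewrite ge0_integralZl_EFin//; last exact/measurable_EFinP.
rewrite letter_weightE -/(I i) -(fineK (Ifin i)) -!EFinM -!EFinD lee_fin.
apply: le_trans (expR_ge1Dx _); rewrite lerD2l mulrDr lerD2l.
rewrite (_ : s ^+ 2 * K * fine (I i) = s * (s * (K * fine (I i)))); last by rewrite expr2 !mulrA.
rewrite ler_wpM2l ?(ltW sgt0)//; apply: le_trans sKM.
by rewrite ler_wpM2l ?(ltW sgt0)// ler_wpM2l ?(ltW K0).
Qed.

Lemma integral_resample a (f : Fam -> \bar R) : measurable_fun [set: Fam] f ->
  (forall w, (0 <= f w)%E) ->
  (\int[eta]_w f w = \int[eta]_w \int[rifs_law S (last_letter a)]_B f (resample a w B))%E.
Proof.
move=> mf f0.
transitivity (\int[pushforward (eta \x rifs_law S (last_letter a))%E (resample_pair a)]_w f w)%E.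
  by apply: eq_measure_integral => E mE _; exact: resample_law.
rewrite (ge0_integral_pushforward (measurable_resample_pair a))//.
rewrite preimage_setT fubini_tonelli1//; last by move=> x; exact: f0.
by apply: measurableT_comp => //; exact: measurable_resample_pair.
Qed.

Section path_products.
Variable g : A -> Mat -> R.
Hypothesis g0 : forall i B, 0 <= g i B.
Hypothesis mg : forall i, measurable_fun [set: Mat] (g i).

Fixpoint path_prod s w : R :=
  if s is x :: s' then g x (vertex_mx x w) * path_prod s' (subfamily x w) else 1.

Lemma path_prod_ge0 s w : 0 <= path_prod s w.
Proof. by elim: s w => //= x s IH w; rewrite mulr_ge0. Qed.

Lemma path_prod_ext v w w' :
  (forall a, (size (word_seq a) <= size v)%N -> w a = w' a) -> path_prod v w = path_prod v w'.
Proof.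
elim: v w w' => //= x v IH w w' h; rewrite /vertex_mx h//; congr (_ * _).
by apply: IH => a av; apply: h.
Qed.

Lemma path_prod_rcons v x w :
  path_prod (rcons v x) w = path_prod v w * g x (w (word_rcons v x)).
Proof.
rewrite -vertex_subfamilies; elim: v w => [|y v IH] w /=; first by rewrite mulr1 mul1r.
by rewrite IH mulrA.
Qed.

Lemma measurable_path_prod s : measurable_fun [set: Fam] (path_prod s).
Proof.
elim/last_ind: s => [|s x IH]; first exact: measurable_cst.
rewrite (_ : path_prod _ = fun w : Fam => path_prod s w * g x (w (word_rcons s x))).
  by apply: measurable_funM => //; apply: (measurableT_comp (mg x)); exact: measurable_family_coord.
by apply/funext => w; rewrite path_prod_rcons.
Qed.

(* The matrices along a path are independent. *)
Lemma integral_path_prod_le (K : A -> R) s : (forall i, 0 <= K i) ->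
  (forall i, (\int[rifs_law S i]_B (g i B)%:E <= (K i)%:E)%E) ->
  (\int[eta]_w (path_prod s w)%:E <= (\prod_(x <- s) K x)%:E)%E.
Proof.
move=> K0 hK; elim/last_ind: s => [|s x IH].
  rewrite big_nil (integral_cst eta measurableT 1%E) mul1e; exact: probability_le1.
rewrite (integral_resample (word_rcons s x)); first last.
- by move=> w; rewrite lee_fin path_prod_ge0.
- apply/measurable_EFinP; exact: measurable_path_prod.
rewrite last_letter_rcons -cats1 big_cat big_seq1/=.
pose c := (\int[rifs_law S x]_B (g x B)%:E)%E.
have c0 : (0 <= c)%E by apply: integral_ge0 => B _; rewrite lee_fin.
have cfin : c \is a fin_num by rewrite ge0_fin_numE//; apply: le_lt_trans (hK x) (ltry _).
have E w : (\int[rifs_law S x]_B (path_prod (rcons s x) (resample (word_rcons s x) w B))%:E =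
    (fine c * path_prod s w)%:E)%E.
  rewrite mulrC EFinM fineK// -ge0_integralZl_EFin//; first last.
  - exact: path_prod_ge0.
  - exact/measurable_EFinP.
  - by move=> B _; rewrite lee_fin.
  apply: eq_integral => B _; rewrite -EFinM path_prod_rcons; congr (_ * g x _)%:E.
    apply: path_prod_ext => b; rewrite /resample; case: eqP => // ->.
    by rewrite word_seq_rcons size_rcons ltnn.
  by rewrite /resample eqxx.
rewrite cats1; under eq_integral do rewrite E EFinM.
rewrite ge0_integralZl_EFin//; first last.
- exact: fine_ge0.
- apply/measurable_EFinP; exact: measurable_path_prod.
- by move=> w _; rewrite lee_fin path_prod_ge0.
rewrite EFinM muleC; apply: lee_pmul => //.
- by apply: integral_ge0 => w _; rewrite lee_fin path_prod_ge0.
- by rewrite lee_fin fine_ge0.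
- by rewrite (fineK cfin); exact: hK.
Qed.

End path_products.

Definition thin_event v (z : R) : set Fam :=
  [set w | rifs_product_set S w /\ (`|\det (path_mx v w)| < z)%R].

Lemma measurable_thin_event v z : measurable (thin_event v z).
Proof.
apply: measurableI; first exact: measurable_product_set.
have := @measurable_norm_det_path_mx R A D v measurableT _ (measurable_itv `]-oo, z[).
by rewrite setTI; congr (measurable _); apply/seteqP; split => w /=; rewrite in_itv.
Qed.

(** Chernoff's bound: Markov's inequality for the power [- s] of the determinant, whose expectation
    factors along the path. *)
Lemma det_path_small_le (tau : R) : 0 < tau -> exists2 s : R, 0 < s & forall v (z : R), 0 < z ->
  (eta (thin_event v z) <=
    (z `^ s * expR (s * (weight letter_weight v + tau * (size v)%:R)))%:E)%E.
Proof.
move=> /exists_moment_exponent[s s0 hs]; exists s => // v z z0.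
(* The indicator makes the moment bound, known over [rifs_set S i], a bound over all matrices; it
   equals 1 on the product set. *)
pose g i B := \1_(rifs_set S i) B * `|\det (B : 'M[R]_D)| `^ (- s).
have g0 i B : 0 <= g i B by rewrite mulr_ge0 ?powR_ge0.
have mg i : measurable_fun [set: Mat] (g i).
  apply: measurable_funM; first exact: (measurable_indic (rifs_set_measurable S i)).
  by apply: (measurableT_comp (@measurable_powR R (- s))); exact: measurable_abs_det.
pose K i := expR (s * (letter_weight i + tau)).
have gK i : (\int[rifs_law S i]_B (g i B)%:E <= (K i)%:E)%E.
  apply: le_trans (hs i); rewrite [leRHS]integral_mkcond le_eqVlt; apply/orP; left; apply/eqP.
  apply: eq_integral => B _; rewrite patchE /g indicE.
  by case: ifP => _; rewrite ?mul1r ?mul0r.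
have gE w : rifs_product_set S w -> path_prod g v w = `|\det (path_mx v w)| `^ (- s).
  elim: v w => [|x v IH] w hw /=; first by rewrite det1 normr1 powR1.
  rewrite IH; last exact: product_set_subfamily.
  rewrite det_mulmx normrM powRM ?normr_ge0// /g indicE mem_set ?mul1r//.
  exact: product_set_vertex.
have prodK : \prod_(x <- v) K x = expR (s * (weight letter_weight v + tau * (size v)%:R)).
  elim: v {gE} => [|x v IH]; first by rewrite big_nil /weight big_nil mulr0 addr0 mulr0 expR0.
  rewrite big_cons IH /K -expRD /weight big_cons /= -natr1; congr expR; ring.
have mE := measurable_thin_event v z.
have zs : 0 < z `^ s by exact: powR_gt0.
have h : ((z `^ (- s))%:E * eta (thin_event v z) <= (\prod_(x <- v) K x)%:E)%E.
  apply: le_trans (integral_path_prod_le g0 mg v (fun i => expR_ge0 _) gK).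
  rewrite -(integral_cst eta mE); apply: (@le_trans _ _ (\int[eta]_(w in thin_event v z) (path_prod g v w)%:E)%E).
    apply: ge0_le_integral => //.
    - by move=> w _; rewrite lee_fin powR_ge0.
    - apply: measurable_funTS; apply/measurable_EFinP; exact: measurable_path_prod.
    - move=> w [hw dz]; rewrite lee_fin gE// !powRN lef_pV2 ?posrE ?powR_gt0//.
        by apply: ge0_ler_powR; rewrite ?nnegrE ?(ltW s0) ?(ltW z0) ?(ltW dz).
      by rewrite normr_gt0 (det_path_mx_neq0 v hw).
  apply: ge0_subset_integral => //.
  - apply/measurable_EFinP; exact: measurable_path_prod.
  - by move=> w _; rewrite lee_fin path_prod_ge0.
rewrite -prodK EFinM.
have zs0 : (0 <= (z `^ s)%:E)%E by rewrite lee_fin ltW.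
have := lee_wpmul2l zs0 h; rewrite muleA.
by rewrite -[X in (X * eta (thin_event v z))%E]EFinM powRN divff ?gt_eqF// mul1e.
Qed.

End determinant_moments.

(** * Density of good levels *)

Section counting_events.
Context {disp : measure_display} {T : measurableType disp} {R : realType}.
Variable mu : probability T R.

Lemma measurable_count_indic (I : Type) (r : seq I) (E : I -> set T) :
  (forall i, measurable (E i)) ->
  measurable_fun [set: T] (fun w => \sum_(i <- r) \1_(E i) w : R).
Proof.
by move=> mE; apply: measurable_sum => i; exact: measurable_indic.
Qed.

Lemma measurable_count_gt (I : Type) (r : seq I) (E : I -> set T) (l : R) :
  (forall i, measurable (E i)) -> measurable [set w | l < \sum_(i <- r) \1_(E i) w].
Proof.
move=> mE; have := measurable_count_indic r mE measurableT (measurable_itv `]l, +oo[).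
by rewrite setTI; congr (measurable _); apply/seteqP; split => w /=; rewrite in_itv/= andbT.
Qed.

Lemma count_gt_measure_le (I : eqType) (r : seq I) (E : I -> set T) (p l : R) :
  (forall i, measurable (E i)) -> 0 < l ->
  (forall i, i \in r -> (mu (E i) <= p%:E)%E) ->
  (mu [set w | (l < \sum_(i <- r) \1_(E i) w)%R] <= ((size r)%:R * p / l)%:E)%E.
Proof.
move=> mE l0 hp; set F := [set w | _].
have mF : measurable F by exact: measurable_count_gt.
have h : (l%:E * mu F <= ((size r)%:R * p)%:E)%E.
  rewrite -(integral_cst mu mF).
  apply: (@le_trans _ _ (\int[mu]_w (\sum_(i <- r) (\1_(E i) w)%:E))%E).
    apply: (@le_trans _ _ (\int[mu]_(w in F) (\sum_(i <- r) (\1_(E i) w)%:E))%E).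
      apply: ge0_le_integral => //.
      - by move=> w _; rewrite lee_fin ltW.
      - apply: emeasurable_sum => i; apply/measurable_EFinP/measurable_funTS.
        exact: measurable_indic.
      - by move=> w Fw; rewrite sumEFin lee_fin ltW.
    apply: ge0_subset_integral => //.
    - by apply: emeasurable_sum => i; apply/measurable_EFinP; exact: measurable_indic.
    - by move=> w _; rewrite sumEFin lee_fin sumr_ge0.
  rewrite ge0_integral_sum//; last by move=> i; apply/measurable_EFinP; exact: measurable_indic.
  rewrite (_ : ((size r)%:R * p)%:E = (\sum_(i <- r) p%:E)%E); last first.
    by rewrite sumEFin big_const_seq count_predT iter_addr_0 mulr_natl.
  rewrite big_seq [leRHS]big_seq; apply: lee_sum => i ir.
  by rewrite integral_indic// setIT; exact: hp.
have Ffin : mu F \is a fin_num.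
  by rewrite ge0_fin_numE//; apply: le_lt_trans (probability_le1 mu mF) (ltry _).
move: h; rewrite -(fineK Ffin) -EFinM !lee_fin => h.
by rewrite ler_pdivlMr// mulrC.
Qed.

Lemma measure_bigcup_nondecreasing_le (F : nat -> set T) (p : \bar R) :
  (forall n, measurable (F n)) -> (forall n m, (n <= m)%N -> F n `<=` F m) ->
  (forall n, (mu (F n) <= p)%E) -> (mu (\bigcup_n F n) <= p)%E.
Proof.
move=> mF nF hp.
have h : (mu \o F) @ \oo --> mu (\bigcup_n F n).
  apply: nondecreasing_cvg_mu => //; first exact: bigcup_measurable.
  by move=> n m nm; apply/subsetPset; exact: nF.
rewrite -(cvg_lim _ h)//; apply: lime_le; first by apply/cvg_ex; eexists; exact: h.
exact: nearW.
Qed.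

End counting_events.

Lemma limn_esup_ge_frequently {R : realType} (u : nat -> \bar R) (l : \bar R) :
  (forall k, exists2 n, (k <= n)%N & (l <= u n)%E) -> (l <= limn_esup u)%E.
Proof.
move=> h; apply: le_ereal_inf_tmp => _ [V [k _ kV] <-].
have [n kn ln] := h k; apply: le_trans ln _; apply: ereal_sup_ubound.
by exists n => //; exact: kV.
Qed.

Section density.
Context {disp : measure_display} {T : measurableType disp} {R : realType}.
Variable mu : probability T R.
Variables (F : nat -> set T) (p eps : R).
Hypothesis mF : forall n, measurable (F n).
Hypothesis Fp : forall n, (mu (F n) <= p%:E)%E.
Hypothesis eps0 : 0 < eps.

(** Concerns the levels 1 to [n.+1]; the shift keeps their number positive. *)
Let fails n : set T := [set w | (eps * n.+1%:R < \sum_(j <- index_iota 1 n.+2) \1_(F j) w)%R].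

Definition low_density : set T := \bigcup_k \bigcap_(n in [set n | (k <= n)%N]) fails n.

Lemma measurable_low_density : measurable low_density.
Proof.
apply: bigcup_measurable => k _; apply: bigcap_measurable; first by exists k => /=.
by move=> n _; exact: measurable_count_gt.
Qed.

(** A lower limit of events, each of probability at most [p / eps] by Markov's inequality: the
    increasing union is over intersections, and the k-th one lies in [fails k]. *)
Lemma low_density_measure_le : (mu low_density <= (p / eps)%:E)%E.
Proof.
apply: measure_bigcup_nondecreasing_le => [k|k l kl w h n ln|k].
- apply: bigcap_measurable; first by exists k => /=.
  by move=> n _; exact: measurable_count_gt.
- by apply: h; exact: leq_trans ln.
apply: (@le_trans _ _ (mu (fails k))).
  apply: le_measure; rewrite ?inE; last by move=> w; apply => /=.
    apply: bigcap_measurable; first by exists k => /=.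
    by move=> n _; exact: measurable_count_gt.
  exact: measurable_count_gt.
apply: le_trans (count_gt_measure_le mF _ (fun j _ => Fp j)) _.
  by rewrite mulr_gt0.
rewrite lee_fin size_iota subSS subn0 le_eqVlt; apply/orP; left; apply/eqP.
have : (k.+1%:R : R) != 0 by rewrite pnatr_eq0.
by move: (k.+1%:R : R) => N N0; field; rewrite N0 gt_eqF.
Qed.

(** Off the lower limit, infinitely many initial segments have a proportion of failures at most
    [eps]; this yields an upper density. *)
Lemma low_densityP w : ~ low_density w ->
  ((1 - eps)%:E <= upper_density [set n | (0 < n)%N /\ ~ F n w])%E.
Proof.
move=> nw; apply: limn_esup_ge_frequently => k.
have [n kn nf] : exists2 n, (k <= n)%N & ~ fails n w.
  apply: contrapT => h; apply: nw; exists k => // n /= kn.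
  by apply: contrapT => nf; apply: h; exists n.
exists n.+1; first exact: ltnW.
rewrite lee_fin ler_pdivlMr//; move: nf => /= /negP; rewrite -leNgt => nf.
set B := [set n | _].
have e : ((\sum_(1 <= j < n.+2) (j \in B))%N%:R : R) + \sum_(j <- index_iota 1 n.+2) \1_(F j) w = n.+1%:R.
  rewrite natr_sum -big_split/= (eq_big_nat _ _ (F2 := fun=> 1)).
    by rewrite sumr_const_nat subSS subn0.
  move=> j /andP[j0 _]; rewrite indicE.
  have [Fj|nFj] := pselect (F j w).
    by rewrite (mem_set Fj) memNset ?add0r// => -[].
  by rewrite (memNset nFj) mem_set ?addr0.
by rewrite mulrBl mul1r -e lerBlDr lerD2l e.
Qed.

End density.

Lemma geometric_series_le {R : realFieldType} (x : R) N : 0 < x < 1 ->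
  \sum_(0 <= k < N) x ^+ k <= (1 - x)^-1.
Proof.
move=> /andP[x0 x1]; rewrite big_mkord -[leRHS]mul1r ler_pdivlMr ?subr_gt0//.
rewrite -[1 - x]opprB mulrN mulrC -subrX1 opprB gerBl.
by rewrite exprn_ge0// ltW.
Qed.

Lemma le_sum_term {R : numDomainType} (I : eqType) (r : seq I) (P : pred I) (F : I -> R) i :
  i \in r -> P i -> (forall j, 0 <= F j) -> F i <= \sum_(j <- r | P j) F j.
Proof. by move=> ir Pi F0; rewrite (big_rem i ir)/= Pi lerDl sumr_ge0. Qed.

Section common_prefix.
Variable A : eqType.
Implicit Types s t : seq A.

Fixpoint common_prefix s t : seq A :=
  if s is x :: s' then if t is y :: t' then
    if x == y then x :: common_prefix s' t' else [::] else [::] else [::].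

Lemma common_prefix_split s t : ~~ prefix s t -> ~~ prefix t s ->
  exists i j r r', [/\ i != j, s = common_prefix s t ++ i :: r &
                      t = common_prefix s t ++ j :: r'].
Proof.
elim: s t => [|x s IH] [|y t]//=; rewrite [y == x]eq_sym.
case: eqP => [<-|/eqP xy] /=; last by exists x, y, s, t.
by move=> st ts; have [i [j [r [r' [ij es et]]]]] := IH _ st ts;
  exists i, j, r, r'; split => //; [rewrite {1}es|rewrite {1}et].
Qed.

End common_prefix.

Lemma measurable_exists_seq (disp : measure_display) (T : measurableType disp)
    (I : eqType) (r : seq I) (P : pred I) (F : I -> set T) :
  (forall i, measurable (F i)) ->
  measurable [set x | exists i, [/\ i \in r, P i & F i x]].
Proof.
move=> mF; elim: r => [|j r IH].
  by rewrite (_ : [set x | _] = set0)//; apply/seteqP; split => // x [i []].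
rewrite (_ : [set x | _] = (if P j then F j else set0) `|`
   [set x | exists i, [/\ i \in r, P i & F i x]]).
  by apply: measurableU => //; case: ifP.
apply/seteqP; split => x /=.
  move=> [i [+ Pi Fi]]; rewrite inE => /predU1P[ij|ir]; last by right; exists i.
  by left; rewrite -ij Pi.
case=> [|[i [ir Pi Fi]]]; last by exists i; split => //; rewrite inE ir orbT.
by case: ifP => // Pj Fj; exists j; rewrite mem_head.
Qed.

(** * Separation of the points of a level *)

Section separation.
Context {R : realType} {A : pointedFinType} {d : nat}.
Variable S : rifs R A d.+1.
Variable eta : probability (family_space R A d.+1) R.
Hypothesis eta_product : is_product_law S eta.
Hypothesis log_moments : finite_log_moments S.
Variable m : probability (symbolic_space A) R.
Local Notation Fam := (family_space R A d.+1).
Local Notation D := d.+1.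
Local Notation mass := (cylinder_mass m).
Local Notation c := (decay_constant m).
Local Notation lam := (letter_weight S).
Implicit Types (w : Fam) (a : word A) (v s : seq A).

Variables (Ct alpha C c1 th : R) (W : nat -> seq (word A)) (b : nat -> A).
Hypothesis c_gt0 : 0 < c.
Hypothesis Ct0 : 0 < Ct.
Hypothesis trans : transversality S eta Ct.
Hypothesis alpha0 : 0 < alpha.
Hypothesis C0 : 0 < C.
Hypothesis c10 : 0 < c1.
Hypothesis th0 : 0 < th.
Hypothesis W_uniq : forall n, (0 < n)%N -> uniq (W n).
Hypothesis W_level : forall n a, (0 < n)%N -> a \in W n -> level_words m n a.
Hypothesis W_mass : forall n a, (0 < n)%N -> a \in W n -> c1 * c ^+ n <= mass (word_seq a).
Hypothesis W_typical : forall n a, (0 < n)%N -> a \in W n -> typical_word m lam alpha C (word_seq a).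
Hypothesis W_total : forall n, (0 < n)%N -> th <= \sum_(a <- W n) mass (word_seq a).
Hypothesis W_prefix : forall n v, (0 < n)%N ->
  \sum_(a <- W n | prefix v (word_seq a)) mass (word_seq a) <= mass v.

Definition level_scale n : R := (c ^+ n) `^ (D%:R^-1).

Lemma level_scale_exp n : level_scale n ^+ D = c ^+ n.
Proof. by rewrite /level_scale powR_root_expr// exprn_ge0// ltW. Qed.

Lemma level_scale_gt0 n : 0 < level_scale n.
Proof. by rewrite powR_gt0// exprn_gt0. Qed.

Lemma level_words_not_prefix n a a' : level_words m n a -> level_words m n a' -> a != a' ->
  ~~ prefix (word_seq a) (word_seq a').
Proof.
move=> la la' aa'; apply/negP => /prefixP[r e].
have cyl s : cylinder s (cat_seq s b).
  rewrite /cylinder/=; apply: (@eq_from_nth _ (b 0%N)); rewrite size_mkseq// => k ks.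
  by rewrite nth_mkseq// cat_seqE; apply: set_nth_default.
have h := cyl (word_seq a'); have h' : cylinder (word_seq a) (cat_seq (word_seq a') b).
  by apply: (@cylinder_prefix _ (word_seq a) r); rewrite -e.
by have := level_words_antichain la la' h' h; apply/eqP.
Qed.

Section bad_words.
Variables (M sg tau : R).
Hypothesis M0 : 0 < M.
Hypothesis sg0 : 0 < sg.
Hypothesis tau0 : 0 < tau.

(** Dividing by it in the transversality bound leaves [1 / mass v], to be compensated by the mass of
    the words below [v], and a factor geometric in the length. *)
Definition threshold v : R := mass v * expR (tau * (size v)%:R) / M.

Definition close_pair n a a' : set Fam :=
  let v := common_prefix (word_seq a) (word_seq a') in
  close_event S v (cat_seq (drop (size v) (word_seq a)) b)
    (cat_seq (drop (size v) (word_seq a')) b) (threshold v) (sg * level_scale n).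

Definition thin_prefix a k : set Fam :=
  thin_event S (take k (word_seq a)) (threshold (take k (word_seq a))).

Definition bad_word n a : set Fam :=
  [set w | exists k, [/\ k \in iota 0 (size (word_seq a)).+1, true & thin_prefix a k w]] `|`
  [set w | exists a', [/\ a' \in W n, a' != a & close_pair n a a' w]].

Lemma measurable_thin_prefix a k : measurable (thin_prefix a k).
Proof. exact: measurable_thin_event. Qed.

Lemma measurable_close_pair n a a' : measurable (close_pair n a a').
Proof. exact: measurable_close_event. Qed.

Lemma measurable_bad_word n a : measurable (bad_word n a).
Proof.
apply: measurableU; apply: (measurable_exists_seq _ (fun=> _)).
  by move=> k; exact: measurable_thin_prefix.
by move=> a'; exact: measurable_close_pair.
Qed.

(** Two close points are accounted for at their common prefix: either the determinant there is below
    the threshold, or the pair is a close pair. *)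
Lemma not_bad_word_separated n a a' w : (0 < n)%N -> a \in W n -> a' \in W n -> a != a' ->
  rifs_product_set S w -> ~ bad_word n a w ->
  sg * level_scale n < enorm (rifs_proj S w (cat_word a b) - rifs_proj S w (cat_word a' b)).
Proof.
move=> n0 aW a'W aa' hw nb; rewrite ltNge; apply/negP => cl; apply: nb.
have [i [j [r [r' [ij es es']]]]] := common_prefix_split
  (level_words_not_prefix (W_level n0 aW) (W_level n0 a'W) aa')
  (level_words_not_prefix (W_level n0 a'W) (W_level n0 aW) (contra_neq (@esym _ _ _) aa')).
set v := common_prefix _ _ in es es'.
have dE s x t : s = v ++ x :: t -> v ++ drop (size v) s = s.
  by move=> ->; rewrite drop_size_cat.
have [thick|thin] := leP (threshold v) `|\det (path_mx v w)|.
  right; exists a'; split; [exact: a'W|by rewrite eq_sym|].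
  rewrite /close_pair -/v; split; [exact: hw|exact: thick|rewrite -!cat_seq_cat].
  by rewrite (dE _ _ _ es) (dE _ _ _ es') -!cat_wordE.
left; exists (size v); split => //.
  by rewrite mem_iota add0n leq0n ltnS [in leqRHS]es size_cat leq_addr.
rewrite /thin_prefix (_ : take (size v) (word_seq a) = v)//.
by rewrite [in LHS]es take_size_cat.
Qed.

Lemma prefix_mass_gt0 n a k : (0 < n)%N -> a \in W n -> 0 < mass (take k (word_seq a)).
Proof.
move=> n0 aW; apply: (@lt_le_trans _ _ (mass (word_seq a))).
  by apply: lt_le_trans (W_mass n0 aW); rewrite mulr_gt0// exprn_gt0.
by rewrite -{1}(cat_take_drop k (word_seq a)); exact: mass_cat_le.
Qed.

Let L := Ct * sg ^+ D * M / c1.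
Let q := expR (- tau).

Let L0 : 0 <= L.
Proof. by rewrite /L !mulr_ge0 ?invr_ge0 ?exprn_ge0 ?ltW. Qed.

Let q01 : 0 < q < 1.
Proof. by rewrite /q expR_gt0 -[ltRHS]expR0 ltr_expR oppr_lt0. Qed.

(** Since [c ^+ n] is at most [mass (word_seq a') / c1], the volume factor of transversality becomes
    a mass, ready to be summed over [a']. *)
Lemma close_pair_measure_le n a a' : (0 < n)%N -> a \in W n -> a' \in W n -> a' != a ->
  exists k, [/\ (k <= size (word_seq a))%N, prefix (take k (word_seq a)) (word_seq a') &
  (eta (close_pair n a a') <=
     (L * q ^+ k * (mass (word_seq a') / mass (take k (word_seq a))))%:E)%E].
Proof.
move=> n0 aW a'W a'a; have aa' : a != a' by rewrite eq_sym.
have [i [j [r [r' [ij es es']]]]] := common_prefix_split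
  (level_words_not_prefix (W_level n0 aW) (W_level n0 a'W) aa')
  (level_words_not_prefix (W_level n0 a'W) (W_level n0 aW) a'a).
rewrite /close_pair; set v := common_prefix _ _ in es es' *.
have vE : take (size v) (word_seq a) = v by rewrite [in LHS]es take_size_cat.
exists (size v); rewrite vE; split.
- by rewrite [in leqRHS]es size_cat leq_addr.
- by apply/prefixP; exists (j :: r').
have v0 : 0 < mass v by rewrite -vE; exact: prefix_mass_gt0 n0 aW.
have z0 : 0 < threshold v by rewrite /threshold divr_gt0// mulr_gt0// expR_gt0.
have -> : drop (size v) (word_seq a) = i :: r by rewrite [in LHS]es drop_size_cat.
have -> : drop (size v) (word_seq a') = j :: r' by rewrite [in LHS]es' drop_size_cat.
rewrite -(cat1s i r) -(cat1s j r') !cat_seq_cat.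
apply: le_trans (trans v _ _ ij z0 _) _; first by rewrite mulr_gt0// level_scale_gt0.
rewrite lee_fin exprMn level_scale_exp /threshold /q -expRM_natl.
have -> : expR ((size v)%:R * - tau) = (expR (tau * (size v)%:R))^-1.
  by rewrite -expRN mulrN mulrC.
set E := expR (tau * _); have E0 : 0 < E by exact: expR_gt0.
have h : c ^+ n <= mass (word_seq a') / c1.
  by rewrite ler_pdivlMr// mulrC; exact: W_mass.
have K0 : 0 <= Ct * sg ^+ D * M / (mass v * E).
  by rewrite divr_ge0 ?mulr_ge0 ?exprn_ge0 ?ltW.
have := ler_wpM2l K0 h; congr (_ <= _).
  by field; rewrite !gt_eqF.
by rewrite /L; field; rewrite !gt_eqF.
Qed.

(** Each [a'] is charged to every length at which it shares a prefix with [a]. After exchanging the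
    sums, [W_prefix] cancels the denominators and a geometric series remains. *)
Lemma sum_close_pair_le n a : (0 < n)%N -> a \in W n ->
  (\sum_(a' <- W n | a' != a) eta (close_pair n a a') <= (L / (1 - q))%:E)%E.
Proof.
move=> n0 aW; set s := word_seq a.
pose f k a' := L * q ^+ k * (mass (word_seq a') / mass (take k s)).
have f0 k a' : 0 <= f k a'.
  apply: mulr_ge0; first by rewrite mulr_ge0// exprn_ge0 ?expR_ge0.
  by rewrite divr_ge0 ?mass_ge0.
apply: (@le_trans _ _ (\sum_(a' <- W n) (\sum_(k <- iota 0 (size s).+1 | prefix (take k s) (word_seq a')) f k a')%:E)%E).
  rewrite big_mkcond/= big_seq [leRHS]big_seq; apply: lee_sum => a' a'W.
  case: ifP => aa'; last by rewrite lee_fin sumr_ge0.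
  have [k [ks pk h]] := close_pair_measure_le n0 aW a'W aa'.
  apply: le_trans h _; rewrite lee_fin.
  have kI : k \in iota 0 (size s).+1 by rewrite mem_iota add0n leq0n ltnS.
  exact: (@le_sum_term _ _ _ (fun k => prefix (take k s) (word_seq a')) (fun k => f k a')
    k kI pk (fun k => f0 k a')).
rewrite sumEFin lee_fin (exchange_big_dep xpredT)//.
apply: (@le_trans _ _ (\sum_(k <- iota 0 (size s).+1) L * q ^+ k)).
  apply: ler_sum => k _; rewrite /f -mulr_sumr -mulr_suml.
  rewrite -[leRHS]mulr1 ler_wpM2l//.
    by rewrite mulr_ge0// exprn_ge0 ?expR_ge0.
  rewrite ler_pdivrMr ?mul1r; last exact: prefix_mass_gt0 n0 aW.
  exact: W_prefix.
rewrite -mulr_sumr ler_wpM2l//.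
exact: (@geometric_series_le R q (size s).+1 q01).
Qed.

Variable sigma : R.
Hypothesis sigma0 : 0 < sigma.
Hypothesis tauE : tau = alpha / 4.
Hypothesis thin_le : forall v (z : R), 0 < z ->
  (eta (thin_event S v z) <= (z `^ sigma * expR (sigma * (weight lam v + tau * (size v)%:R)))%:E)%E.

Let P := (C / M) `^ sigma.
Let p := expR (- (sigma * (alpha / 2))).

Let p01 : 0 < p < 1.
Proof. by rewrite /p expR_gt0 -[ltRHS]expR0 ltr_expR oppr_lt0 mulr_gt0// divr_gt0. Qed.

(** Typicality replaces the mass in the threshold by [expR] of minus the weight, which cancels the
    weight in Chernoff's bound; the rate left is [alpha - 2 * tau = alpha / 2]. *)
Lemma thin_prefix_measure_le n a k : (0 < n)%N -> a \in W n -> (k <= size (word_seq a))%N ->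
  (eta (thin_prefix a k) <= (P * p ^+ k)%:E)%E.
Proof.
move=> n0 aW ks; rewrite /thin_prefix; set v := take k _.
have v0 : 0 < mass v by exact: prefix_mass_gt0 n0 aW.
have sv : size v = k by rewrite size_takel.
have z0 : 0 < threshold v by rewrite /threshold divr_gt0// mulr_gt0// expR_gt0.
apply: le_trans (thin_le v z0) _; rewrite lee_fin.
pose y := - (alpha * k%:R + weight lam v) + tau * k%:R.
have zy : threshold v <= C / M * expR y.
  rewrite /threshold sv [C / M * _]mulrAC ler_wpM2r ?invr_ge0 ?(ltW M0)//.
  by rewrite expRD mulrA ler_wpM2r ?expR_ge0//; exact: (W_typical n0 aW ks).
have CM : 0 <= C / M by rewrite divr_ge0 ?ltW.
apply: (@le_trans _ _ ((C / M * expR y) `^ sigma *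
    expR (sigma * (weight lam v + tau * (size v)%:R)))).
  rewrite ler_wpM2r ?expR_ge0// ge0_ler_powR ?nnegrE ?(ltW sigma0) ?(ltW z0)//.
  by rewrite mulr_ge0 ?expR_ge0.
rewrite powRM ?expR_ge0// -/P -mulrA ler_wpM2l ?powR_ge0//.
rewrite -expRM mulrC -expRD /p -expRM_natl ler_expR sv /y tauE le_eqVlt.
by apply/orP; left; apply/eqP; field.
Qed.

Lemma bad_word_measure_le n a : (0 < n)%N -> a \in W n ->
  (eta (bad_word n a) <= (P / (1 - p) + L / (1 - q))%:E)%E.
Proof.
move=> n0 aW.
have m1 : measurable [set w | exists k, [/\ k \in iota 0 (size (word_seq a)).+1, true & thin_prefix a k w]].
  by apply: (measurable_exists_seq _ (fun=> true)) => k; exact: measurable_thin_prefix.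
have m2 : measurable [set w | exists a', [/\ a' \in W n, a' != a & close_pair n a a' w]].
  by apply: (measurable_exists_seq _ (fun a' => a' != a)) => a'; exact: measurable_close_pair.
apply: le_trans (measureU2 _ m1 m2) _; rewrite EFinD; apply: leeD.
  apply: le_trans (@measure_le_sum _ _ _ eta _ (iota 0 (size (word_seq a)).+1)
    (fun=> true) (thin_prefix a) _ m1 _ _) _ => //.
    by move=> k; exact: measurable_thin_prefix.
  apply: (@le_trans _ _ (\sum_(k <- iota 0 (size (word_seq a)).+1) (P * p ^+ k)%:E)%E).
    rewrite big_seq [leRHS]big_seq; apply: lee_sum => k; rewrite mem_iota add0n ltnS => /andP[_ ks].
    exact: thin_prefix_measure_le n0 aW ks.
  rewrite sumEFin lee_fin -mulr_sumr ler_wpM2l ?powR_ge0//.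
  exact: (@geometric_series_le R p (size (word_seq a)).+1 p01).
apply: le_trans (sum_close_pair_le n0 aW).
apply: (@measure_le_sum _ _ _ eta _ (W n) (fun a' => a' != a) (close_pair n a)) => //.
by move=> a'; exact: measurable_close_pair.
Qed.

End bad_words.

Definition separated_words w (sg : R) n (T : seq (word A)) : Prop :=
  [/\ uniq T, {subset T <= W n}, (size (W n) <= 2 * size T)%N &
    forall a a', a \in T -> a' \in T -> a != a' ->
      sg * level_scale n <
        enorm (rifs_proj S w (cat_word a b) - rifs_proj S w (cat_word a' b))].

Lemma exists_density_event (eps p : R) : 0 < eps -> 0 < p -> exists sg E,
  [/\ 0 < sg, measurable E, (eta E <= p%:E)%E &
    forall w, rifs_product_set S w -> ~ E w -> exists B : set nat,
      ((1 - eps)%:E <= upper_density B)%E /\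
      forall n, B n -> (0 < n)%N /\ exists T, separated_words w sg n T].
Proof.
move=> eps0 p0; pose tau := alpha / 4; have tau0 : 0 < tau by rewrite divr_gt0.
have [sigma sigma0 thin_le] := det_path_small_le eta_product log_moments tau0.
pose pp := expR (- (sigma * (alpha / 2))).
have pp1 : 0 < 1 - pp.
  by rewrite subr_gt0 /pp -[ltRHS]expR0 ltr_expR oppr_lt0 mulr_gt0// divr_gt0.
pose q := expR (- tau).
have q1 : 0 < 1 - q by rewrite subr_gt0 /q -[ltRHS]expR0 ltr_expR oppr_lt0.
(* Words are bad with probability at most [e], levels with more than half bad words occur with
   probability at most [2 * e], and low density with at most [2 * e / eps = p]. *)
pose e := p * eps / 2; have e0 : 0 < e by rewrite divr_gt0// mulr_gt0.
pose y := e / 2 * (1 - pp); have y0 : 0 < y by rewrite mulr_gt0// divr_gt0.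
(* [M] is fixed first, so that thin prefixes cost at most [e / 2]; [sg] is chosen after it, since
   the cost of close pairs grows with [M]. *)
pose t := y `^ sigma^-1; have t0 : 0 < t by exact: powR_gt0.
pose M := C / t; have M0 : 0 < M by rewrite divr_gt0.
have CM : (C / M) `^ sigma = y.
  rewrite (_ : C / M = t); last by rewrite /M; field; rewrite !gt_eqF.
  by rewrite /t -powRrM mulVf ?gt_eqF// powRr1// ltW.
pose z := e / 2 * (1 - q) * c1 / (Ct * M).
have z0 : 0 < z.
  by apply: divr_gt0; [do 2 apply: mulr_gt0 => //; exact: divr_gt0|exact: mulr_gt0].
pose sg := Num.min 1 z; have sg0 : 0 < sg by rewrite lt_min ltr01.
have sgD : sg ^+ D <= z.
  apply: (@le_trans _ _ sg); last by rewrite ge_min lexx orbT.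
  rewrite exprS ler_piMr ?(ltW sg0)// exprn_ile1 ?(ltW sg0)//.
  by rewrite ge_min lexx.
have bad_le n a : (0 < n)%N -> a \in W n -> (eta (bad_word M sg tau n a) <= e%:E)%E.
  move=> n0 aW; apply: le_trans (bad_word_measure_le M0 sg0 tau0 sigma0 (erefl _) thin_le n0 aW) _.
  rewrite lee_fin CM -/pp -/q (_ : e = e / 2 + e / 2); last by field.
  apply: lerD; first by rewrite ler_pdivrMr// /y.
  rewrite ler_pdivrMr// ler_pdivrMr//.
  have CM0 : 0 < Ct * M by exact: mulr_gt0.
  move: sgD; rewrite /z ler_pdivlMr//.
  by rewrite (_ : Ct * sg ^+ D * M = sg ^+ D * (Ct * M))// mulrAC mulrC.
pose F (n : nat) : set Fam := if (0 < n)%N then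
  [set w | ((size (W n))%:R / 2 < \sum_(a <- W n) \1_(bad_word M sg tau n a) w :> R)%R] else set0.
have mF n : measurable (F n).
  rewrite /F; case: ifP => // _; apply: measurable_count_gt => a.
  exact: measurable_bad_word.
have Fe n : (eta (F n) <= (2 * e)%:E)%E.
  rewrite /F; case: ifP => n0; last by rewrite measure0 lee_fin mulr_ge0// ltW.
  have W0 : 0 < (size (W n))%:R :> R.
    rewrite ltr0n; case: (W n) (W_total n0) => //=.
    by rewrite big_nil leNgt th0.
  apply: le_trans (count_gt_measure_le (mu := eta) (fun a => measurable_bad_word M sg tau n a) _
    (fun a aW => bad_le n a n0 aW)) _; first by rewrite divr_gt0.
  rewrite lee_fin le_eqVlt; apply/orP; left; apply/eqP.
  by move: W0; move: (_%:R) => N N0; field; rewrite gt_eqF.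
exists sg, (low_density F eps); split => //.
- exact: measurable_low_density.
- apply: le_trans (low_density_measure_le mF Fe eps0) _.
  by rewrite lee_fin /e le_eqVlt; apply/orP; left; apply/eqP; field; rewrite gt_eqF.
move=> w hw nE; exists [set n | (0 < n)%N /\ ~ F n w]; split.
  exact: low_densityP nE.
move=> n [n0 nF]; split => //; exists [seq a <- W n | `[< ~ bad_word M sg tau n a w >]]; split.
- by rewrite filter_uniq// W_uniq.
- by move=> a; rewrite mem_filter => /andP[].
- move: nF; rewrite /F n0 => /negP; rewrite -leNgt.
  rewrite -(ler_nat R) natrM size_filter -sum1_count natr_sum.
  have -> : (size (W n))%:R = \sum_(a <- W n | `[< ~ bad_word M sg tau n a w >]) 1%:R +
      \sum_(a <- W n) \1_(bad_word M sg tau n a) w :> R.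
    rewrite [X in X + _]big_mkcond -big_split/= -sum1_size natr_sum.
    apply: eq_bigr => a _; rewrite indicE.
    have [ba|nba] := pselect (bad_word M sg tau n a w).
      by rewrite (mem_set ba) asboolF ?add0r// => /(_ ba).
    by rewrite (memNset nba) asboolT ?addr0.
  by move=> h; lra.
- move=> a a'; rewrite !mem_filter => /andP[/asboolP nb aW] /andP[_ a'W] aa'.
  exact: not_bad_word_separated n0 aW a'W aa' hw nb.
Qed.

(** The constant [sg] deteriorates as the exceptional probability tends to 0, so it is chosen after
    [w]: outside the intersection of the events some [k], hence some [sg], works. *)
Lemma ae_separated_levels (eps : R) : 0 < eps ->
  {ae eta, forall w, rifs_product_set S w -> exists (sg : R) (B : set nat),
    [/\ 0 < sg, ((1 - eps)%:E <= upper_density B)%E &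
      forall n, B n -> (0 < n)%N /\ exists T, separated_words w sg n T]}.
Proof.
move=> eps0.
have [E hE] : {E : nat -> set Fam & forall k, measurable (E k) /\ (eta (E k) <= (k.+1%:R^-1)%:E)%E /\
    exists2 sg : R, 0 < sg & forall w, rifs_product_set S w -> ~ E k w -> exists B : set nat,
      ((1 - eps)%:E <= upper_density B)%E /\
      forall n, B n -> (0 < n)%N /\ exists T, separated_words w sg n T}.
  apply: (@choice _ _ (fun k Ek => measurable Ek /\ (eta Ek <= (k.+1%:R^-1)%:E)%E /\
    exists2 sg : R, 0 < sg & forall w, rifs_product_set S w -> ~ Ek w -> exists B : set nat,
      ((1 - eps)%:E <= upper_density B)%E /\
      forall n, B n -> (0 < n)%N /\ exists T, separated_words w sg n T)) => k.
  have k0 : 0 < k.+1%:R^-1 :> R by rewrite invr_gt0.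
  have [sg [Ek [sg0 mE eE hEk]]] := exists_density_event eps0 k0.
  by exists Ek; split => //; split => //; exists sg.
exists (\bigcap_k E k); split.
- by apply: bigcapT_measurable => k; case: (hE k).
- apply/eqP; rewrite eq_le measure_ge0 andbT; apply/lee_addgt0Pr => e e0; rewrite add0e.
  have [k ke] : exists k, k.+1%:R^-1 < e.
    have [k _ /(_ k (leqnn k))] := near_infty_natSinv_lt (PosNum e0).
    by exists k.
  have [mEk [eEk _]] := hE k.
  apply: le_trans (le_trans (le_measure eta _ _ _) eEk) _; rewrite ?inE//.
  + by apply: bigcapT_measurable => j; case: (hE j).
  + by move=> w; apply.
  + by rewrite lee_fin ltW.
move=> w /= nw k _; apply: contrapT => nEk; apply: nw => hw.
have [_ [_ [sg sg0 hsg]]] := hE k; have [B [dB hB]] := hsg w hw nEk.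
by exists sg, B.
Qed.

End separation.

(** * Limsup sets *)

(** Turns an infinitely-often condition into a countable intersection of unions, for words through
    [pickle] and for levels through the identity. *)
Lemma infinite_set_injP (T : eqType) (f : T -> nat) (P : set T) : injective f ->
  infinite_set P <-> forall N, exists a, (N <= f a)%N /\ P a.
Proof.
move=> fi; split => [iP N|h /finite_seqP[s Ps]].
  apply: contrapT => h; apply: iP; apply: (@sub_finite_set _ _ (f @^-1` `I_N)).
    move=> a Pa /=; rewrite ltnNge; apply/negP => Nf; apply: h; by exists a.
  by apply: finite_preimage (finite_II N) => x y _ _; exact: fi.
have [a [+ Pa]] := h (\max_(a <- s) f a).+1.
have aS : a \in s by move: Pa; rewrite Ps.
by rewrite leqNgt ltnS (big_rem a aS)/= leq_maxl.
Qed.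

Lemma divergence_class_partial_sums {R : realType} (g : nat -> R) (eps : R) (B : set nat) :
  divergence_class_eps eps g -> ((1 - eps)%:E < upper_density B)%E ->
  forall T, exists N, T <= \sum_(0 <= n < N | `[< B n >]) g n.
Proof.
move=> [g0 hg] /hg gB T; apply: contrapT => h.
have hT N : \sum_(0 <= n < N | `[< B n >]) g n <= T.
  by rewrite leNgt; apply/negP => hN; apply: h; exists N; exact: ltW.
have : (\sum_(0 <= n <oo | `[< B n >]) (g n)%:E <= T%:E)%E.
  apply: lime_le.
    by apply: is_cvg_nneseries => n _ _; rewrite lee_fin.
  by apply: nearW => N; rewrite sumEFin lee_fin.
rewrite nneseries_esum; last by move=> n _; rewrite lee_fin.
rewrite (_ : [set x | `[< B x >]] = B) ?gB ?leye_eq//.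
by apply/seteqP; split => n /= /asboolP.
Qed.

Section limsup_sets.
Context {R : realType} {A : pointedFinType} {d : nat}.
Variable S : rifs R A d.+1.
Variable m : probability (symbolic_space A) R.
Local Notation Fam := (family_space R A d.+1).
Local Notation D := d.+1.
Local Notation mass := (cylinder_mass m).
Local Notation c := (decay_constant m).
Local Notation leb := (@lebesgue_outer_measure R D).
Implicit Types (a : word A) (b : nat -> A).
Variables (w : Fam) (b : nat -> A).
Local Notation point a := (rifs_proj S w (cat_word a b)).

Lemma word_balls_caratheodory (P : set (word A)) (r : word A -> R) :
  caratheodory_measurable leb [set x | exists a, P a /\ enorm (x - point a) <= r a].
Proof.
rewrite (_ : [set x | _] = \bigcup_k
   (if unpickle k is Some a then if `[< P a >] then closed_eball (point a) (r a) else set0 else set0)).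
  apply: caratheodory_measurable_bigcup => k; case: unpickle => [a|]; last exact: caratheodory_measurable_set0.
  by case: ifP => _; [exact: closed_ball_caratheodory|exact: caratheodory_measurable_set0].
apply/seteqP; split => x /=.
  by move=> [a [Pa xa]]; exists (pickle a) => //; rewrite pickleK asboolT.
by move=> [k _]; case: unpickle => // a; case: ifP => // /asboolP Pa xa; exists a.
Qed.

Lemma caratheodory_bigcap (F : nat -> set 'cV[R]_D) :
  (forall n, caratheodory_measurable leb (F n)) -> caratheodory_measurable leb (\bigcap_n F n).
Proof.
move=> mF; rewrite -[\bigcap_n _]setCK setC_bigcap.
apply: caratheodory_measurable_setC; apply: caratheodory_measurable_bigcup => n.
exact: caratheodory_measurable_setC.
Qed.

Lemma limsup_set_caratheodory Psi : caratheodory_measurable leb (limsup_set S w b Psi).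
Proof.
rewrite (_ : limsup_set S w b Psi = \bigcap_N
  [set x | exists a, (N <= pickle a)%N /\ enorm (x - point a) <= Psi a]).
  by apply: caratheodory_bigcap => N; exact: (word_balls_caratheodory (fun a => (N <= pickle a)%N)).
apply/seteqP; split => x /=.
  by move=> /(infinite_set_injP _ (pcan_inj pickleK)) h N _; exact: h.
by move=> h; apply/(infinite_set_injP _ (pcan_inj pickleK)) => N; exact: (h N I).
Qed.

Lemma level_limsup_set_caratheodory g : caratheodory_measurable leb (level_limsup_set S w b m g).
Proof.
pose E n := if (0 < n)%N then [set x | exists a, level_words m n a /\
   enorm (x - point a) <= level_radius m D g n a] else set0.
rewrite (_ : level_limsup_set S w b m g = \bigcap_N \bigcup_k (E (N + k)%N)).
  apply: caratheodory_bigcap => N; apply: caratheodory_measurable_bigcup => k.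
  rewrite /E; case: ifP => _; last exact: caratheodory_measurable_set0.
  exact: word_balls_caratheodory.
apply/seteqP; split => x /=.
  move=> /(infinite_set_injP _ (@inj_id nat)) h N _; have [n [Nn [n0 [a la xa]]]] := h N.
  by exists (n - N)%N => //; rewrite subnKC// /E n0; exists a.
move=> h; apply/(infinite_set_injP _ (@inj_id nat)) => N.
have [k _] := h N I; rewrite /E; case: ifP => // n0 [a [la xa]].
by exists (N + k)%N; split; [exact: leq_addr|split => //; exists a].
Qed.

Variables (c1 th sg : R) (W T : nat -> seq (word A)) (B : set nat).
Hypothesis c01 : 0 < c < 1.
Hypothesis c10 : 0 < c1.
Hypothesis th0 : 0 < th.
Hypothesis W_level : forall n a, (0 < n)%N -> a \in W n -> level_words m n a.
Hypothesis W_mass : forall n a, (0 < n)%N -> a \in W n -> c1 * c ^+ n <= mass (word_seq a).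
Hypothesis W_total : forall n, (0 < n)%N -> th <= \sum_(a <- W n) mass (word_seq a).
Hypothesis W_prefix : forall n v, (0 < n)%N ->
  \sum_(a <- W n | prefix v (word_seq a)) mass (word_seq a) <= mass v.
Hypothesis sg0 : 0 < sg.
Hypothesis hw : rifs_product_set S w.
Hypothesis B0 : forall n, B n -> (0 < n)%N.
Hypothesis BT : forall n, B n -> separated_words S m W b w sg n (T n).

Let c_gt0 : 0 < c. Proof. by case/andP: c01. Qed.

Definition level_points n : seq 'cV[R]_D := [seq point a | a <- T n].

Let in_B : pred nat := fun n => `[< B n >].

Lemma level_points_limsup_positive (kap : R) (g : nat -> R) : 0 < kap ->
  (forall n, 0 <= g n) ->
  (forall T, exists N, T <= \sum_(0 <= n < N | `[< B n >]) g n) ->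
  (0 < leb (limsup_balls kap (@level_scale R A d m) in_B level_points g))%E.
Proof.
move=> kap0 g0 gdiv; have [R0 R0P] := exists_proj_bound S.
have cn0 n : 0 < c ^+ n by rewrite exprn_gt0.
have cstE n (x : R) : \sum_(a <- W n) x = (size (W n))%:R * x.
  by rewrite big_const_seq count_predT iter_addr_0 mulr_natl.
have th2 : 0 < th / 2 by rewrite divr_gt0.
have c1V : 0 < c1^-1 by rewrite invr_gt0.
(* Words of a level have mass between [c1 * c ^+ n] and [c ^+ n], so the total mass, between [th]
   and 1, bounds their number on both sides. At least half are kept, whence [th / 2]. *)
apply: (limsup_balls_positive (c := c) (s := sg) (th := th / 2) (Kc := c1^-1) (R0 := R0)) => //.
- by move=> n; exact: level_scale_gt0.
- by move=> n; exact: level_scale_exp.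
- move=> n /asboolP /BT [uT TW _ sT].
  have ne a a' : a \in T n -> a' \in T n -> a != a' -> point a != point a'.
    move=> aT a'T aa'; apply/eqP => e; have := sT _ _ aT a'T aa'.
    by rewrite e subrr enorm0 ltNge ltW// mulr_gt0// level_scale_gt0.
  split.
    rewrite map_inj_in_uniq// => a a' aT a'T e; apply/eqP; apply: contraT => aa'.
    by have := ne _ _ aT a'T aa'; rewrite e eqxx.
  move=> _ _ /mapP[a aT ->] /mapP[a' a'T ->] h; apply: sT => //.
  by apply: contra h => /eqP->.
- by move=> n y _ /mapP[a _ ->]; exact: R0P.
- move=> n /asboolP Bn; have n0 := B0 Bn; have [_ _ sz _] := BT Bn.
  rewrite size_map ler_pdivrMr// mulrAC -natrM mulnC.
  apply: (@le_trans _ _ ((size (W n))%:R * c ^+ n)); last by rewrite ler_wpM2r ?(ltW (cn0 n))// ler_nat.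
  apply: le_trans (W_total n0) _.
  rewrite -cstE big_seq [leRHS]big_seq; apply: ler_sum => a aW.
  by have /andP[] := W_level n0 aW.
- move=> n /asboolP Bn; have n0 := B0 Bn; have [uT TW _ _] := BT Bn.
  rewrite size_map -[leRHS]mul1r ler_pdivlMr//.
  have sTW : (size (T n) <= size (W n))%N by exact: uniq_leq_size.
  apply: (@le_trans _ _ ((size (W n))%:R * (c1 * c ^+ n))).
    rewrite -mulrA [c ^+ n * _]mulrC ler_wpM2r ?ler_nat//.
    by rewrite mulr_ge0 ?ltW.
  have := W_prefix [::] n0; rewrite mass_nil; apply: le_trans.
  rewrite -cstE big_seq [leRHS]big_seq_cond.
  rewrite [leRHS](eq_bigl (fun a => a \in W n)); last by move=> a; rewrite prefix0s andbT.
  by apply: ler_sum => a aW; exact: W_mass.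
Qed.

Lemma ball_radius_le_level_radius (g : nat -> R) n a : (0 < n)%N -> 0 <= g n -> a \in W n ->
  @ball_radius R d (c1 `^ (D%:R^-1)) (@level_scale R A d m) g n <= level_radius m D g n a.
Proof.
move=> n0 g0 aW; rewrite /ball_radius /level_scale /level_radius.
have cn0 : 0 <= c1 * c ^+ n by rewrite mulr_ge0 ?exprn_ge0 ?ltW.
rewrite -powRM ?exprn_ge0 ?(ltW c10) ?(ltW c_gt0)// -powRM//.
apply: ge0_ler_powR; rewrite ?nnegrE ?invr_ge0//; first exact: mulr_ge0.
  by apply: mulr_ge0 => //; exact: mass_ge0.
by apply: ler_wpM2r => //; exact: W_mass.
Qed.

Lemma level_limsup_set_positive g :
  (forall n, 0 <= g n) ->
  (forall T, exists N, T <= \sum_(0 <= n < N | `[< B n >]) g n) ->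
  positive_lebesgue_measure (level_limsup_set S w b m g).
Proof.
move=> g0 gdiv; split; first exact: level_limsup_set_caratheodory.
have k0 : 0 < c1 `^ (D%:R^-1) by exact: powR_gt0.
apply: lt_le_trans (level_points_limsup_positive k0 g0 gdiv) _.
apply: le_lebesgue_outer => x h; apply/(infinite_set_injP _ (@inj_id nat)) => N.
have [n [Nn /asboolP Bn [_ /mapP[a aT ->] xa]]] := h N.
have [_ TW _ _] := BT Bn; have aW := TW _ aT.
exists n; split => //; split; first exact: B0.
exists a; first exact: W_level (B0 Bn) aW.
by apply: le_trans xa _; exact: ball_radius_le_level_radius (B0 Bn) (g0 n) aW.
Qed.

Lemma limsup_set_positive g Psi : equivalent_to m D Psi g ->
  (forall n, 0 <= g n) ->
  (forall T, exists N, T <= \sum_(0 <= n < N | `[< B n >]) g n) ->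
  positive_lebesgue_measure (limsup_set S w b Psi).
Proof.
move=> [K K1 KP] g0 gdiv; split; first exact: limsup_set_caratheodory.
have K0 : 0 < K by exact: lt_le_trans K1.
have k0 : 0 < K^-1 * c1 `^ (D%:R^-1) by rewrite mulr_gt0 ?powR_gt0 ?invr_gt0.
apply: lt_le_trans (level_points_limsup_positive k0 g0 gdiv) _.
apply: le_lebesgue_outer => x h /finite_seqP[s sE].
(* Infinitely many levels must give infinitely many words: a finite list has a least positive mass,
   while words of high level have smaller mass. *)
pose e := \big[Num.min/1]_(a <- s | 0 < mass (word_seq a)) mass (word_seq a).
have e0 : 0 < e by rewrite /e; elim/big_rec: _ => // a y ? y0; rewrite lt_min y0 andbT.
have [N hN] := exists_expr_lt c01 e0.
have [n [Nn /asboolP Bn [_ /mapP[a aT ->] xa]]] := h N.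
have n0 := B0 Bn; have [_ TW _ _] := BT Bn; have aW := TW _ aT.
have la := W_level n0 aW.
have ain : a \in s.
  suff : [set a | enorm (x - point a) <= Psi a] a by rewrite sE.
  apply: le_trans xa _; have /andP[+ _] := KP n a n0 la; apply: le_trans.
  rewrite /ball_radius -!mulrA ler_wpM2l ?invr_ge0 ?(ltW K0)// mulrA.
  exact: ball_radius_le_level_radius n0 (g0 n) aW.
have ma : 0 < mass (word_seq a).
  by apply: lt_le_trans (W_mass n0 aW); rewrite mulr_gt0// exprn_gt0.
have ea : e <= mass (word_seq a).
  rewrite /e; elim: s ain {sE e e0 hN} => // y s IH.
  rewrite inE big_cons => /predU1P[<-|/IH h']; first by rewrite ma ge_min lexx.
  by case: ifP => // _; rewrite ge_min h' orbT.
have /andP[mc _] := la.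
have : c ^+ n <= c ^+ N by apply: ler_wiXn2l => //; rewrite ltW//; case/andP: c01.
by move=> cN; have := le_lt_trans (le_trans ea (le_trans mc cN)) hN; rewrite ltxx.
Qed.

End limsup_sets.

(** * From separated levels to all functions of the class *)

Lemma lyapunovE {R : realType} {A : pointedFinType} {d : nat} (S : rifs R A d.+1)
    (m : probability (symbolic_space A) R) : finite_log_moments S ->
  lyapunov S m = (\sum_a cylinder_mass m [:: a] * letter_weight S a)%:E.
Proof.
move=> [fin _]; rewrite /lyapunov -sumEFin; apply: eq_bigr => a _.
exact: (f_equal2 mule (massE m [:: a]) (esym (fineK (fin a)))).
Qed.

Lemma ae_good_levels (R : realType) (A : pointedFinType) (d : nat)
  (S : rifs R A d.+1)
  (eta : probability (family_space R A d.+1) R)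
  (eta_product : is_product_law S eta)
  (log_moments : finite_log_moments S)
  (case_A_or_B :
     ((forall i, rifs_set S i `<=` similarity_mx) /\ distantly_nonsingular S)
     \/ ((forall i, rifs_set S i `<=` contraction_mx) /\ nonsingular S))
  (m : probability (symbolic_space A) R)
  (m_slow : slowly_decaying m)
  (m_invariant : shift_invariant m)
  (entropy_gt : 1 < entropy m / fine (lyapunov S m)) (b : nat -> A) :
  {ae eta, forall w, rifs_product_set S w -> forall g, divergence_class g ->
     positive_lebesgue_measure (level_limsup_set S w b m g) /\
     forall Psi, equivalent_to m d.+1 Psi g -> positive_lebesgue_measure (limsup_set S w b Psi)}.
Proof.
have lam0 := @letter_weight_ge0 R A d S.
have hlam : \sum_a cylinder_mass m [:: a] * letter_weight S a < entropy m.
  move: entropy_gt; rewrite (lyapunovE _ log_moments)/=; set l := \sum_a _.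
  have l0 : 0 <= l by apply: sumr_ge0 => a _; rewrite mulr_ge0 ?mass_ge0.
  (* If the exponent were 0, the quotient would be 0 by convention, contrary to the hypothesis. *)
  move: l0; rewrite le_eqVlt => /predU1P[<-|l0]; first by rewrite invr0 mulr0 ltr10.
  by rewrite ltr_pdivlMr// mul1r.
have [alpha [C [alpha0 C0 typ]]] := typical_set_positive m_invariant lam0 hlam.
have c0 := decay_constant_gt0 m_slow.
have c1 := decay_constant_lt1 m_slow lam0 alpha0 C0 typ.
have [c' [th [W [c'0 th0 WP]]]] := exists_level_selection m_slow lam0 alpha0 C0 typ.
have [Ct Ct0 trans] : exists2 Ct, 0 < Ct & transversality S eta Ct.
  by case: case_A_or_B => -[h1 h2]; [exact: similarity_transversal|exact: nonsingular_transversal].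
have W_uniq n : (0 < n)%N -> uniq (W n) by move=> /WP[].
have W_level n a : (0 < n)%N -> a \in W n -> level_words m n a.
  by move=> /WP[_ h _ _] /h[].
have W_mass n a : (0 < n)%N -> a \in W n ->
    c' * decay_constant m ^+ n <= cylinder_mass m (word_seq a).
  by move=> /WP[_ h _ _] /h[].
have W_typical n a : (0 < n)%N -> a \in W n ->
    typical_word m (letter_weight S) alpha C (word_seq a).
  by move=> /WP[_ h _ _] /h[].
have W_total n : (0 < n)%N -> th <= \sum_(a <- W n) cylinder_mass m (word_seq a) by move=> /WP[].
have W_prefix n v : (0 < n)%N ->
  \sum_(a <- W n | prefix v (word_seq a)) cylinder_mass m (word_seq a) <= cylinder_mass m v.
  by move=> /WP[_ _ _]; exact.
(* Countably many densities are treated at once; the [eps] belonging to [g] is compared with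
   [k.+1%:R^-1] only afterwards, so the null set is the same for all [g]. *)
have := @ae_foralln _ _ _ eta _ (fun k : nat => ae_separated_levels eta_product log_moments b c0 Ct0
  trans alpha0 C0 c'0 th0 W_uniq W_level W_mass W_typical W_total W_prefix (eps := k.+1%:R^-1)
  (ltac:(by rewrite invr_gt0))).
apply: ae_imply => w hk hw g [eps /andP[eps0 eps1] gdiv].
have [k ke] : exists k, k.+1%:R^-1 < eps.
  have [k _ /(_ k (leqnn k))] := near_infty_natSinv_lt (PosNum eps0).
  by exists k.
have [sg [B [sg0 dB hB]]] := hk k hw.
have [T TP] : {T : nat -> seq (word A) & forall n, B n -> separated_words S m W b w sg n (T n)}.
  apply: (@choice _ _ (fun n Tn => B n -> separated_words S m W b w sg n Tn)) => n.
  have [Bn|nB] := pselect (B n); last by exists [::] => /nB.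
  by have [_ [Tn hTn]] := hB n Bn; exists Tn.
have B0 n : B n -> (0 < n)%N by move=> /hB[].
have density : ((1 - eps)%:E < upper_density B)%E.
  by apply: lt_le_trans dB; rewrite lte_fin ltrD2l ltrN2.
have sums := divergence_class_partial_sums gdiv density.
have [g0 _] := gdiv.
have c01 : 0 < decay_constant m < 1 by rewrite c0 c1.
split=> [|Psi eqP].
  exact: (level_limsup_set_positive c01 c'0 th0 W_level W_mass W_total W_prefix sg0 hw B0 TP g0 sums).
exact: (limsup_set_positive c01 c'0 th0 W_level W_mass W_total W_prefix sg0 hw B0 TP eqP g0 sums).
Qed.

Theorem theorem3p4 (R : realType) (A : pointedFinType) (d : nat)
  (d_gt0 : (0 < d)%N)
  (S : rifs R A d)
  (eta : probability (family_space R A d) R)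
  (eta_product : is_product_law S eta)
  (log_moments : finite_log_moments S)
  (case_A_or_B :
     ((forall i, rifs_set S i `<=` similarity_mx) /\ distantly_nonsingular S)
     \/ ((forall i, rifs_set S i `<=` contraction_mx) /\ nonsingular S))
  (m : probability (symbolic_space A) R)
  (m_slow : slowly_decaying m)
  (m_invariant : shift_invariant m)
  (m_ergodic : shift_ergodic m)
  (entropy_gt : 1 < entropy m / fine (lyapunov S m)) :
  (forall b : nat -> A,
     {ae eta, forall w, rifs_product_set S w ->
        forall g : nat -> R, divergence_class g ->
          positive_lebesgue_measure (level_limsup_set S w b m g)}) /\
  (forall b : nat -> A,
     {ae eta, forall w, rifs_product_set S w ->
        forall Psi : word A -> R, (forall a, 0 <= Psi a) ->
          (exists2 g : nat -> R,
             divergence_class g & equivalent_to m d Psi g) ->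
          positive_lebesgue_measure (limsup_set S w b Psi)}).
Proof.
case: d d_gt0 S eta eta_product log_moments case_A_or_B entropy_gt => // d _ S eta
  eta_product log_moments case_A_or_B entropy_gt.
split=> b; apply: ae_imply (ae_good_levels eta_product log_moments case_A_or_B m_slow
  m_invariant entropy_gt b) => w hw wS.
  by move=> g gG; have [] := hw wS g gG.
move=> Psi _ [g gG eqP]; have [_] := hw wS g gG; exact.
Qed.
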